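(* Let $d,p,\kappa\ge1$ be integers and $\alpha\in(0,d/\kappa)$. Let $\eta(x)=[\eta_1(x),\ldots,\eta_p(x)]'$, $x\in\mathbb{R}^d$, be a (measurable, mean-square continuous) vector homogeneous isotropic Gaussian random field with $\mathbf{E}\eta(x)=0$ and $$\mathbf{E}\eta(0)\eta(0)'=\mathcal{I},\qquad \mathbf{E}\eta(0)\eta(x)'=\mathcal{I}\cdot\|x\|^{-\alpha}L(\|x\|),\quad x\ne0,$$ where $\mathcal{I}$ is the $p\times p$ unit matrix and $L(\cdot)$ is slowly varying at infinity. For each $r>0$ let $G_r\in\mathbf{L}_2(\mathbb{R}^p,\phi(\|w\|)\,dw)$ have Hermite coefficients $C_\nu(r)$, and suppose that for each sufficiently large $r$ the Hermite rank of $G_r$ equals $\kappa$ and that $$\left(\sum_{\nu\in N_\kappa}\frac{C_\nu^2(r)}{\nu!}\right)^{-1}\sum_{l\ge\kappa+1}\sum_{\nu\in N_l}\frac{C_\nu^2(r)}{\nu!}=o(r^{\gamma/2}),\qquad r\to\infty,$$ where $\gamma\in(0,\min(\alpha,d-\alpha\kappa))$. Define $$K_r:=\int_{\Delta(r)}G_r(\eta(x))\,dx,\qquad K_{r,\kappa}:=\sum_{\nu\in N_\kappa}\frac{C_\nu(r)}{\nu!}\int_{\Delta(r)}e_\nu(\eta(x))\,dx.$$ If the limit distribution as $r\to\infty$ exists for at least one of the random variables $$\frac{K_r}{\sqrt{\mathbf{Var}\,K_r}}\quad\text{and}\quad\frac{K_{r,\kappa}}{\sqrt{\mathbf{Var}\,K_{r,\kappa}}},$$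 then the limit distribution of the other random variable exists too, and the two limit distributions coincide.
   Context: $\Delta\subset\mathbb{R}^d$ is a Jordan-measurable convex bounded set with $|\Delta|>0$ containing the origin in its interior, and $\Delta(r)=r\Delta$, $r>0$. Homogeneous isotropic means $\mathbf{E}\eta(x)\eta(y)'$ depends only on $\|x-y\|$. $\phi(\|w\|)=\prod_{j=1}^p\phi(w_j)$ with $\phi(t)=\frac{1}{\sqrt{2\pi}}e^{-t^2/2}$; $\mathbf{L}_2(\mathbb{R}^p,\phi(\|w\|)dw)$ is the space of $G$ with $\int_{\mathbb{R}^p}G^2(w)\phi(\|w\|)dw<\infty$. $H_k$ are the (probabilists', monic) Hermite polynomials. For $\nu=(k_1,\ldots,k_p)$ with nonnegative integer entries: $e_\nu(w)=\prod_{j=1}^pH_{k_j}(w_j)$, $\nu!=k_1!\cdots k_p!$, $N_k=\{\nu:\sum_jk_j=k,\ k_j\ge0\}$, and the Hermite coefficients of $G_r$ are $C_\nu(r)=\int_{\mathbb{R}^p}G_r(w)e_\nu(w)\phi(\|w\|)\,dw$. $G$ has Hermite rank $\kappa\ge1$ if its coefficients satisfy $C_\nu=0$ for all $\nu\in N_k$, $0\le k\le\kappa-1$, and $C_\nu\ne0$ for at least one $\nu\in N_\kappa$. *)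

(* Defs.v *)
From HB Require Import structures.
From mathcomp Require Import all_boot all_order all_algebra.
From mathcomp Require Import all_classical all_reals all_analysis.

Set Implicit Arguments.
Unset Strict Implicit.
Unset Printing Implicit Defensive.

Import Order.TTheory GRing.Theory Num.Theory.
Import numFieldNormedType.Exports.

Local Open Scope classical_set_scope.
Local Open Scope ring_scope.

(* R^n is 'rV[R]_n.  The library norm and topology on 'rV[R]_n come from the
   sup norm, hence the separate Euclidean norm [enorm].  The sigma-algebra is
   the one generated by the coordinates, i.e. the Borel sigma-algebra. *)

Definition measure_rV_display : measure_display -> measure_display.
Proof. exact. Qed.

Section measurable_rV.
Context {d} {T : sigmaRingType d}.
Variable n : nat.

Let coors : 'I_n -> 'rV[T]_n -> T := fun i x => x ord0 i.

Let rV_set0 : g_sigma_preimage coors set0.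
Proof. exact: sigma_algebra0. Qed.

Let rV_setC A : g_sigma_preimage coors A -> g_sigma_preimage coors (~` A).
Proof. exact: sigma_algebraC. Qed.

Let rV_bigcup (F : (set 'rV[T]_n)^nat) :
  (forall i, g_sigma_preimage coors (F i)) ->
  g_sigma_preimage coors (\bigcup_i (F i)).
Proof. exact: sigma_algebra_bigcup. Qed.

HB.instance Definition _ := @isMeasurable.Build (measure_rV_display d)
  'rV[T]_n (g_sigma_preimage coors) rV_set0 rV_setC rV_bigcup.

End measurable_rV.

Definition rV_cons (T : Type) (n : nat) (z : 'rV[T]_n * T) : 'rV[T]_n.+1 :=
  \row_i (if unlift ord0 i is Some j then z.1 ord0 j else z.2).

Lemma measurable_coord_rV d (T : measurableType d) n (i : 'I_n) :
  measurable_fun [set: 'rV[T]_n] (fun x : 'rV[T]_n => x ord0 i).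
Proof.
move=> _ Y mY; rewrite setTI; apply: sub_sigma_algebra => /=.
rewrite -bigcup_seq/=; exists i => /=; first by rewrite mem_index_enum.
by exists Y => //; rewrite setTI.
Qed.

Lemma measurable_fun_rVP d1 d2 (T1 : measurableType d1) (T2 : measurableType d2)
    n (f : T1 -> 'rV[T2]_n) :
  measurable_fun [set: T1] f <->
  forall i, measurable_fun [set: T1] (fun x => f x ord0 i).
Proof.
split=> [mf i|mf].
  exact: (measurableT_comp (measurable_coord_rV i) mf).
move=> _ A mA; rewrite setTI.
have : forall B, g_sigma_preimage (fun i (x : 'rV[T2]_n) => x ord0 i) B ->
    measurable (f @^-1` B).
  apply: smallest_sub.
    split => [|B mB|F mF] /=.
    - by rewrite preimage_set0.
    - by rewrite setTD preimage_setC; exact: measurableC.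
    - by rewrite preimage_bigcup; exact: bigcupT_measurable.
  rewrite -bigcup_seq/=; apply: bigcup_sub => i _ B [C mC <-].
  by rewrite setTI; have := mf i measurableT C mC; rewrite setTI.
exact.
Qed.

Lemma measurable_rV_cons d (T : measurableType d) n :
  measurable_fun [set: 'rV[T]_n * T] (@rV_cons T n).
Proof.
apply/measurable_fun_rVP => i; rewrite /rV_cons.
case E : (unlift ord0 i) => [j|].
  under eq_fun do rewrite mxE E.
  by apply: (measurableT_comp (measurable_coord_rV j)); exact: measurable_fst.
under eq_fun do rewrite mxE E.
exact: measurable_snd.
Qed.

Fixpoint lebesgue_rV (R : realType) (n : nat) :
    {measure set 'rV[R]_n -> \bar R} :=
  if n is m.+1 then
    measure_function_pushforward__canonical__measure_function_Measure
      (lebesgue_rV R m \x (@lebesgue_measure R))%E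
      (@measurable_rV_cons _ R m)
  else \d_(0 : 'rV[R]_0).

Definition box (R : realType) (n : nat) (a b : 'rV[R]_n) : set 'rV[R]_n :=
  [set x | forall i, x ord0 i \in `[a ord0 i, b ord0 i]].

Lemma measurable_box (R : realType) (n : nat) (a b : 'rV[R]_n) :
  measurable (box a b).
Proof.
have -> : box a b = \big[setI/setT]_(i < n)
    ((fun x : 'rV[R]_n => x ord0 i) @^-1` `[a ord0 i, b ord0 i]%classic).
  rewrite -bigcap_seq; apply/seteqP; split => x /= xab i.
    by move=> _; exact: xab.
  by apply: (xab i); rewrite /= mem_index_enum.
apply: bigsetI_measurable => i _.
by rewrite -[X in measurable X]setTI; exact: measurable_coord_rV.
Qed.

Lemma lebesgue_rV_box (R : realType) (n : nat) (a b : 'rV[R]_n) :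
  (forall i, a ord0 i <= b ord0 i) ->
  lebesgue_rV R n (box a b) = (\prod_i (b ord0 i - a ord0 i))%:E.
Proof.
elim: n a b => [|n IH] a b ab.
  by rewrite /= diracE big_ord0 mem_set// => -[].
pose tl (x : 'rV[R]_n.+1) : 'rV[R]_n := \row_i x ord0 (lift ord0 i).
rewrite /= /pushforward.
have -> : @rV_cons R n @^-1` box a b =
    box (tl a) (tl b) `*` `[a ord0 ord0, b ord0 ord0]%classic.
  apply/seteqP; split => -[v x] /=.
    move=> vx; split => [i|]; last by have := vx ord0; rewrite mxE unlift_none.
    by have := vx (lift ord0 i); rewrite /= !mxE liftK.
  move=> [vab xab] i; rewrite mxE; case: unliftP => [j ->|->//].
  by have := vab j; rewrite !mxE.
rewrite product_measure1E//; last exact: measurable_box.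
rewrite IH => [|i]; last by rewrite !mxE.
have := lebesgue_measure_itv `[a ord0 ord0, b ord0 ord0].
rewrite /= lte_fin => ->; case: ltP => [_|ba].
  rewrite big_ord_recl mulrC; congr (_ * _)%:E.
  by apply: eq_bigr => i _; rewrite !mxE.
have ab0 : b ord0 ord0 = a ord0 ord0 by apply: le_anti; rewrite ba ab.
by rewrite big_ord_recl ab0 subrr mul0r mule0.
Qed.

Definition enorm (R : realType) (n : nat) (x : 'rV[R]_n) : R :=
  Num.sqrt (\sum_i x ord0 i ^+ 2).

Section jordan.
Context {R : realType} {n : nat}.
Implicit Types A E : set 'rV[R]_n.

Definition elementary E :=
  exists s : seq ('rV[R]_n * 'rV[R]_n),
    E = [set x | exists2 ab, ab \in s & box ab.1 ab.2 x].

Definition inner_jordan_content A : \bar R :=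
  ereal_sup [set lebesgue_rV R n E | E in [set E | elementary E /\ E `<=` A]].

Definition outer_jordan_content A : \bar R :=
  ereal_inf [set lebesgue_rV R n E | E in [set E | elementary E /\ A `<=` E]].

(* The common value of the two contents is the volume |A|; unlike
   [lebesgue_rV R n A], it is meaningful without A being Borel. *)
Definition jordan_measurable A :=
  bounded_set A /\ inner_jordan_content A = outer_jordan_content A.

End jordan.

Definition dilate (R : realType) (n : nat) (r : R) (A : set 'rV[R]_n) :
  set 'rV[R]_n := [set r *: x | x in A].

(* Measurability and positivity are only required on a neighbourhood of +oo. *)
Definition slowly_varying (R : realType) (L : R -> R) :=
  (exists X : R, [/\ 0 < X, measurable_fun `[X, +oo[%classic L &
     forall x, X <= x -> 0 < L x]) /\
  (forall t, 0 < t -> L (t * x) / L x @[x --> +oo] --> (1 : R)).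

Section hermite.
Context {R : realType}.

(* Probabilists' normalization: Rodrigues' formula
   H_k(t) = (-1)^k e^(t^2/2) (d/dt)^k e^(-t^2/2) gives H_(k+1) = X H_k - H_k'. *)
Fixpoint hermite (k : nat) : {poly R} :=
  if k is k'.+1 then 'X * hermite k' - (hermite k')^`() else 1.

Context {p : nat}.

(* A multi-index of total degree k has all its entries at most k, so N_k is a
   finite set of functions 'I_p -> 'I_k.+1. *)
Definition multi_index (k : nat) : {set {ffun 'I_p -> 'I_k.+1}} :=
  [set nu : {ffun 'I_p -> 'I_k.+1} | (\sum_j nu j == k)%N]%SET.

Definition mfact (k : nat) (nu : {ffun 'I_p -> 'I_k}) : R :=
  (\prod_j (nu j)`!)%:R.

Definition hermite_prod (k : nat) (nu : {ffun 'I_p -> 'I_k}) (w : 'rV[R]_p) : R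
  := \prod_j (hermite (nu j)).[w ord0 j].

Definition gauss_density (w : 'rV[R]_p) : R :=
  \prod_j normal_pdf 0 1 (w ord0 j).

Implicit Type G : 'rV[R]_p -> R.

Definition gauss_L2 G :=
  measurable_fun setT G /\
  (\int[lebesgue_rV R p]_w (G w ^+ 2 * gauss_density w)%:E < +oo)%E.

Definition hermite_coef G (k : nat) (nu : {ffun 'I_p -> 'I_k}) : R :=
  \int[lebesgue_rV R p]_w (G w * hermite_prod nu w * gauss_density w).

Definition hermite_rank G (kappa : nat) :=
  [/\ (0 < kappa)%N,
      forall k, (k < kappa)%N ->
        forall nu, nu \in multi_index k -> hermite_coef G nu = 0 &
      exists2 nu, nu \in multi_index kappa & hermite_coef G nu != 0].

Definition hermite_energy G (k : nat) : R :=
  \sum_(nu in multi_index k) hermite_coef G nu ^+ 2 / mfact nu.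

Definition hermite_tail G (kappa : nat) : R :=
  fine (\sum_(kappa.+1 <= l <oo) (hermite_energy G l)%:E)%E.

End hermite.

Section random_field.
Context {dO : measure_display} {Omega : measurableType dO} {R : realType}.
Variable P : probability Omega R.

(* [normal_prob m 0] is not a Dirac mass, hence the case distinction. *)
Definition gaussian_rv (X : Omega -> R) :=
  exists m s : R, 0 <= s /\
    forall A : set R, measurable A ->
      P (X @^-1` A) = if s == 0 then \d_m A else normal_prob m s A.

Context {d p : nat}.
Implicit Type eta : 'rV[R]_d -> Omega -> 'rV[R]_p.

Definition measurable_field eta :=
  measurable_fun [set: 'rV[R]_d * Omega] (fun z => eta z.1 z.2).

Definition mean_square_continuous eta :=
  forall x,
    'E_P[(fun o => enorm (eta y o - eta x o) ^+ 2)%R]%E @[y --> x] --> 0%E.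

Definition gaussian_field eta :=
  forall (n : nat) (x : 'I_n -> 'rV[R]_d) (a : 'I_n -> 'rV[R]_p),
    gaussian_rv (fun o => \sum_i \sum_j a i ord0 j * eta (x i) o ord0 j).

Definition cross_moment (X Y : Omega -> 'rV[R]_p) : 'M[\bar R]_p :=
  \matrix_(i, j) 'E_P[(fun o => X o ord0 i * Y o ord0 j)%R]%E.

Definition homogeneous_isotropic eta :=
  forall x y x' y', enorm (x - y) = enorm (x' - y') ->
    cross_moment (eta x) (eta y) = cross_moment (eta x') (eta y').

(* A Jordan-measurable convex set need not be Borel.  The library integral over
   dilate r Delta is then a lower integral of the positive and negative parts,
   which is unaffected by the Lebesgue-null boundary of dilate r Delta. *)
Definition field_functional eta (Delta : set 'rV[R]_d) (G : 'rV[R]_p -> R)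
    (r : R) (o : Omega) : R :=
  \int[lebesgue_rV R d]_(x in dilate r Delta) G (eta x o).

Definition hermite_functional eta (Delta : set 'rV[R]_d) (G : 'rV[R]_p -> R)
    (kappa : nat) (r : R) (o : Omega) : R :=
  \sum_(nu in @multi_index p kappa)
    hermite_coef G nu / mfact nu *
      \int[lebesgue_rV R d]_(x in dilate r Delta) hermite_prod nu (eta x o).

Definition standardize (X : Omega -> R) (o : Omega) : R :=
  X o / Num.sqrt (fine 'V_P[X]%E).

Definition cvg_law (X : R -> Omega -> R) (mu : probability (measurableTypeR R) R)
    :=
  forall t : R, {for t, continuous (fun s : R => mu `]-oo, s]%classic)} ->
    P (X r @^-1` `]-oo, t]%classic) @[r --> +oo] --> mu `]-oo, t]%classic.

End random_field.

(* Main.v *)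
(* Write G_r = H + g, where H is the projection of G_r on the Hermite polynomials of
   degree kappa, so that K_r = K_(r,kappa) + R_r with R_r the integral of g(eta).  With
   k the correlation function, Mehler's formula gives
   E H(eta(x)) H(eta(y)) = k(x,y)^kappa E_kappa, where E_j is the degree j part of
   ||G_r||^2, and |E g(eta(x)) g(eta(y))| <= |k(x,y)|^(kappa+1) T, where T is the sum of
   the E_j for j > kappa; both rest on the coupling (Z, k Z + sqrt(1 - k^2) W) of
   (eta(x), eta(y)), with Z and W independent, which characteristic functions justify.
   By Potter's bounds on L, the double integrals of k^kappa and |k|^(kappa+1) over
   Delta(r) are, for large r, respectively at least c r^(2d - alpha kappa - gamma/2) and
   at most C r^(2d - alpha kappa - gamma).  Hence Var R_r / Var K_(r,kappa) is
   O((T / E_kappa) r^(-gamma/2)) = o(1): the two standardized variables are close in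
   L^2, and Slutsky's lemma applies. *)

Require Import Defs.
From HB Require Import structures.
From mathcomp Require Import all_boot all_order all_algebra.
From mathcomp Require Import all_classical all_reals all_analysis.
From mathcomp Require Import measurable_realfun ring lra.

Import Order.TTheory GRing.Theory Num.Theory.
Import numFieldNormedType.Exports.

Local Open Scope classical_set_scope.
Local Open Scope ring_scope.

Set Implicit Arguments.
Unset Strict Implicit.
Unset Printing Implicit Defensive.

(** * Square integrable functions *)

(** The double integral of |k|^(kappa+1) over Delta(r) gains at most about r^(-alpha) over that of
    |k|^kappa and cannot be of smaller order than r^d. Hence the comparison with t^(-beta), where
    beta = alpha kappa + gamma: the condition on gamma says exactly that beta < alpha (kappa + 1)
    and beta < d. Potter's slack in the lower bound is gamma / 2, which leaves a gain of gamma / 2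
    against the tail condition.

    Near the diagonal only |k| <= 1 is available, and k^kappa may be negative; a cube of fixed size
    around each point is given up there, at a cost that is negligible for large r.

    The remainder g has infinitely many degrees, so its covariance bound needs completeness of the
    Hermite polynomials. This comes from a monotone class argument started from cosines, which also
    shows that characteristic functions determine laws.

    Delta(r) need not be Borel, and for exceptional outcomes a path may fail to be integrable and
    its integral takes a default value: hence a measurable kernel of Delta(r), and identities that
    hold almost surely. *)

Section sq_integrable.
Context d (T : measurableType d) (R : realType) (mu : {measure set T -> \bar R}).
Implicit Types f g h : T -> R.

Definition integr f := mu.-integrable setT (EFin \o f).

Lemma integr_meas f : integr f -> measurable_fun setT f.
Proof. by move=> /measurable_int/measurable_EFinP. Qed.

Lemma le_integr f g : measurable_fun setT f -> integr g ->
  (forall x, `|f x| <= g x) -> integr f.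
Proof.
move=> mf ig fg; apply: (le_integrable _ _ _ ig) => //.
  exact/measurable_EFinP.
by move=> x _ /=; rewrite lee_fin (le_trans (fg x))// ler_norm.
Qed.

Lemma integrD f g : integr f -> integr g -> integr (fun x => f x + g x).
Proof. by move=> fi gi; have := integrableD measurableT fi gi. Qed.

Lemma integrB f g : integr f -> integr g -> integr (fun x => f x - g x).
Proof. by move=> fi gi; have := integrableB measurableT fi gi. Qed.

Lemma integrZ k f : integr f -> integr (fun x => k * f x).
Proof. by move=> fi; have := integrableZl measurableT k fi. Qed.

Lemma RintZ k f : integr f -> \int[mu]_x (k * f x) = k * \int[mu]_x f x.
Proof. by move=> fi; exact: RintegralZl. Qed.

Lemma RintD f g : integr f -> integr g ->
  \int[mu]_x (f x + g x) = \int[mu]_x f x + \int[mu]_x g x.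
Proof. by move=> fi gi; exact: RintegralD. Qed.

Lemma RintB f g : integr f -> integr g ->
  \int[mu]_x (f x - g x) = \int[mu]_x f x - \int[mu]_x g x.
Proof. by move=> fi gi; exact: RintegralB. Qed.

Lemma integr_sum I (s : seq I) (P : pred I) (F : I -> T -> R) :
  (forall i, P i -> integr (F i)) -> integr (fun x => \sum_(i <- s | P i) F i x).
Proof.
move=> iF; have := @integrable_sum _ _ _ mu _ measurableT I s P
  (fun i => EFin \o F i) iF.
by apply: eq_integrable => // x _; rewrite /= sumEFin.
Qed.

Lemma Rint_sum I (s : seq I) (P : pred I) (F : I -> T -> R) :
  (forall i, P i -> integr (F i)) ->
  \int[mu]_x (\sum_(i <- s | P i) F i x) = \sum_(i <- s | P i) \int[mu]_x F i x.
Proof.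
move=> iF; elim: s => [|i s IH].
  under eq_Rintegral do rewrite big_nil.
  by rewrite big_nil Rintegral_cst// mul0r.
have [Pi|Pi] := boolP (P i).
  under eq_Rintegral do rewrite big_cons Pi.
  by rewrite big_cons Pi RintD ?IH//; [exact: iF|exact: integr_sum].
by under eq_Rintegral do rewrite big_cons (negbTE Pi); rewrite big_cons (negbTE Pi).
Qed.

Definition sqi f :=
  measurable_fun setT f /\ integr (fun x => f x ^+ 2).

Lemma sqiM f g : sqi f -> sqi g -> integr (fun x => f x * g x).
Proof.
move=> [mf if2] [mg ig2]; apply: (@le_integr _ (fun x => f x ^+ 2 + g x ^+ 2)).
- exact: measurable_funM.
- exact: integrD.
- move=> x; rewrite normrM -(real_normK (num_real (f x))).
  rewrite -(real_normK (num_real (g x))).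
  have := sqr_ge0 (`|f x| - `|g x|); have := normr_ge0 (f x).
  have := normr_ge0 (g x); nra.
Qed.

Lemma sqiD f g : sqi f -> sqi g -> sqi (fun x => f x + g x).
Proof.
move=> sf sg; split; first by apply: measurable_funD; [case: sf|case: sg].
have -> : (fun x => (f x + g x) ^+ 2) =
    (fun x => f x ^+ 2 + (2 * (f x * g x) + g x ^+ 2)).
  by apply/funext => x; ring.
apply: integrD; first by case: sf.
by apply: integrD; [apply: integrZ; exact: sqiM|case: sg].
Qed.

Lemma sqiZ k f : sqi f -> sqi (fun x => k * f x).
Proof.
move=> [mf if2]; split; first exact: measurable_funM.
have -> : (fun x => (k * f x) ^+ 2) = (fun x => k ^+ 2 * f x ^+ 2).
  by apply/funext => x; rewrite exprMn.
exact: integrZ.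
Qed.

Lemma sqiB f g : sqi f -> sqi g -> sqi (fun x => f x - g x).
Proof.
move=> sf sg; have := sqiD sf (sqiZ (-1) sg).
by congr sqi; apply/funext => x; rewrite mulN1r.
Qed.

Lemma sqi0 : sqi (cst 0).
Proof.
by split => //; rewrite /integr /=; under eq_fun do rewrite expr0n/=; exact: integrable0.
Qed.

Lemma sqi_sum I (s : seq I) (P : pred I) (F : I -> T -> R) :
  (forall i, P i -> sqi (F i)) -> sqi (fun x => \sum_(i <- s | P i) F i x).
Proof.
move=> iF; elim: s => [|i s IH].
  by under eq_fun do rewrite big_nil; exact: sqi0.
have [Pi|Pi] := boolP (P i).
  by under eq_fun do rewrite big_cons Pi; apply: sqiD => //; exact: iF.
by under eq_fun do rewrite big_cons (negbTE Pi).
Qed.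

Lemma Rint_sq_ge0 f : 0 <= \int[mu]_x (f x ^+ 2).
Proof. by apply: Rintegral_ge0 => x _; exact: sqr_ge0. Qed.

Lemma Rint_sqD f g : sqi f -> sqi g ->
  \int[mu]_x ((f x + g x) ^+ 2) =
  \int[mu]_x (f x ^+ 2) + 2 * (\int[mu]_x (f x * g x)) + \int[mu]_x (g x ^+ 2).
Proof.
move=> sf sg.
have -> : (fun x => (f x + g x) ^+ 2) =
    (fun x => f x ^+ 2 + (2 * (f x * g x) + g x ^+ 2)).
  by apply/funext => x; ring.
have ifg := sqiM sf sg; case: sf sg => mf if2 [mg ig2].
rewrite (RintD if2 (integrD (integrZ 2 ifg) ig2)).
by rewrite (RintD (integrZ 2 ifg) ig2) (RintZ 2 ifg) addrA.
Qed.

Lemma Rint_sqB f g : sqi f -> sqi g ->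
  \int[mu]_x ((f x - g x) ^+ 2) =
  \int[mu]_x (f x ^+ 2) - 2 * (\int[mu]_x (f x * g x)) + \int[mu]_x (g x ^+ 2).
Proof.
move=> sf sg.
under eq_Rintegral do rewrite -[- g _]mulN1r.
rewrite (Rint_sqD sf (sqiZ (-1) sg)).
under [X in _ + 2 * X]eq_Rintegral do rewrite mulrCA.
under [X in _ + X]eq_Rintegral do rewrite exprMn sqrrN expr1n mul1r.
by rewrite (RintZ (-1) (sqiM sf sg)); ring.
Qed.

Lemma cauchy_schwarz f g : sqi f -> sqi g ->
  (\int[mu]_x (f x * g x)) ^+ 2 <=
  (\int[mu]_x (f x ^+ 2)) * (\int[mu]_x (g x ^+ 2)).
Proof.
move=> sf sg.
set A := \int[mu]_x (f x ^+ 2); set B := \int[mu]_x (f x * g x).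
set C := \int[mu]_x (g x ^+ 2).
have A0 : 0 <= A by exact: Rint_sq_ge0.
have C0 : 0 <= C by exact: Rint_sq_ge0.
have H (k : R) : 0 <= A + 2 * k * B + k ^+ 2 * C.
  have := Rint_sq_ge0 (fun x => f x + k * g x).
  rewrite (Rint_sqD sf (sqiZ k sg)).
  under [X in _ + 2 * X]eq_Rintegral do rewrite mulrCA.
  under [X in _ + X]eq_Rintegral do rewrite exprMn.
  rewrite (RintZ k (sqiM sf sg)) (RintZ (k ^+ 2) (proj2 sg)).
  by rewrite mulrA.
have [C00|Cn0] := eqVneq C 0.
  have [->|Bn0] := eqVneq B 0; first by rewrite C00 mulr0 expr0n.
  (* With C = 0 the quadratic is affine in k, and at this point it equals - A - 2 < 0. *)
  have := H (- (A + 1) / B); rewrite C00 mulr0 addr0 -mulrA divfK//.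
  by move=> h; exfalso; lra.
have Cp : 0 < C by rewrite lt_neqAle eq_sym Cn0.
(* The minimizer of the quadratic in k. *)
have := H (- B / C).
have -> : A + 2 * (- B / C) * B + (- B / C) ^+ 2 * C = (A * C - B ^+ 2) / C.
  by field.
by rewrite pmulr_lge0 ?invr_gt0// subr_ge0.
Qed.

Lemma Rint_sqD_le f g : sqi f -> sqi g ->
  \int[mu]_x ((f x + g x) ^+ 2) <=
  2 * (\int[mu]_x (f x ^+ 2)) + 2 * (\int[mu]_x (g x ^+ 2)).
Proof.
move=> sf sg; rewrite (Rint_sqD sf sg).
have := Rint_sqB sf sg; have := Rint_sq_ge0 (fun x => f x - g x); lra.
Qed.

End sq_integrable.

Section sq_integrable_finite.
Context d (T : measurableType d) (R : realType)
  (mu : {finite_measure set T -> \bar R}).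

Lemma integr_cst (k : R) : integr mu (cst k).
Proof. exact: finite_measure_integrable_cst. Qed.

Lemma integr_bounded (f : T -> R) M : measurable_fun setT f ->
  (forall x, `|f x| <= M) -> integr mu f.
Proof.
by move=> mf; exact: (le_integr mf (integr_cst M)).
Qed.

Lemma sqi_bounded (f : T -> R) M : measurable_fun setT f ->
  (forall x, `|f x| <= M) -> sqi mu f.
Proof.
move=> mf fM; split => //; apply: (@integr_bounded _ (M ^+ 2)).
  exact: measurable_funX.
move=> x; rewrite normrX lerXn2r// ?nnegrE//.
exact: le_trans (normr_ge0 _) (fM x).
Qed.

Lemma sqi_integr (f : T -> R) : sqi mu f -> integr mu f.
Proof.
move=> sf; have := sqiM sf (@sqi_bounded (cst 1) 1 _ _).
rewrite /integr /=; under eq_fun do rewrite mulr1.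
by apply => // x; rewrite normr1.
Qed.

End sq_integrable_finite.

Section dominated.
Context d (T : measurableType d) (R : realType) (mu : {measure set T -> \bar R}).

Lemma Rint_dominated (f_ : nat -> T -> R) (f g : T -> R) :
  (forall n, measurable_fun setT (f_ n)) ->
  (forall x, f_ n x @[n --> \oo] --> f x) ->
  integr mu g -> (forall n x, `|f_ n x| <= g x) ->
  integr mu f /\ \int[mu]_x f_ n x @[n --> \oo] --> \int[mu]_x f x.
Proof.
move=> mf ff ig fg.
have mlim : measurable_fun setT f.
  by apply: (measurable_fun_cvg (h := f_)) => // x _; exact: ff.
have [] := @dominated_convergence _ _ _ mu setT measurableT
  (fun n => EFin \o f_ n) (EFin \o f) (EFin \o g).
- by move=> n; exact/measurable_EFinP.
- exact/measurable_EFinP.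
- by apply: aeW => x _; apply: cvg_EFin; [exact: nearW|exact: ff].
- exact: ig.
- by apply: aeW => x n _; rewrite /= lee_fin.
move=> iff _ cv; split => //; apply: fine_cvg.
by rewrite fineK//; exact: integrable_fin_num.
Qed.

End dominated.

(** * A monotone class theorem for trigonometric functions *)

Section sign_polynomials.
Context {R : realType}.

(* The Newton-type iteration u |-> (3 u - u^3) / 2 drives [-1, 1] to the sign of its
   starting point. *)
Fixpoint sign_poly (k : nat) : {poly R} :=
  if k is k'.+1 then (3 / 2) *: sign_poly k' - (1 / 2) *: sign_poly k' ^+ 3 else 'X.

Lemma sign_polyS k y : (sign_poly k.+1).[y] = (3 * (sign_poly k).[y] - (sign_poly k).[y] ^+ 3) / 2.
Proof. by rewrite /= hornerD hornerN !hornerZ horner_exp; field. Qed.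

Lemma sign_polyN k y : (sign_poly k).[- y] = - (sign_poly k).[y].
Proof.
elim: k => [|k IH]; first by rewrite /= !hornerE.
by rewrite !sign_polyS IH; field.
Qed.

Lemma sign_poly0 k : (sign_poly k).[0] = 0.
Proof. by have := sign_polyN k 0; rewrite oppr0 => h; lra. Qed.

(** One step multiplies the error 1 - u by (1 - u) (2 + u) / 2, which is at most 1 - u / 2; as the
    iterates stay above y, convergence is geometric. *)
Lemma sign_poly_pos k (y : R) : 0 < y -> y <= 1 ->
  y <= (sign_poly k).[y] <= 1 /\ 1 - (sign_poly k).[y] <= (1 - y / 2) ^+ k.
Proof.
move=> y0 y1; elim: k => [|k [/andP[IH1 IH2] IH3]].
  by rewrite /= hornerX expr0; split; lra.
rewrite sign_polyS; move: IH1 IH2 IH3; set u := (sign_poly k).[y] => u1 u2 u3.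
have u0 : 0 <= u by lra.
have h1u : 0 <= u * ((1 - u) * (1 + u)) by rewrite !mulr_ge0//; lra.
have h2u : 0 <= (1 - u) ^+ 2 * (2 + u) by rewrite mulr_ge0 ?sqr_ge0//; lra.
split; first by apply/andP; split; nra.
rewrite [leRHS]exprS; set E := (1 - y / 2) ^+ k in u3 *.
have -> : 1 - (3 * u - u ^+ 3) / 2 = ((1 - u) * (2 + u) / 2) * (1 - u).
  by field.
have h1 : (1 - u) * (2 + u) / 2 <= 1 - y / 2 by nra.
apply: ler_pM => //; try nra.
Qed.

Lemma sign_poly_bound k (y : R) : `|y| <= 1 -> `|(sign_poly k).[y]| <= 1.
Proof.
have [y0|y0|->] := ltgtP y 0; last by rewrite sign_poly0 normr0.
- rewrite ltr0_norm// => y1; rewrite -normrN -sign_polyN.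
  have [||/andP[h1 h2] _] := @sign_poly_pos k (- y); rewrite ?oppr_gt0//.
  by rewrite ger0_norm//; lra.
- rewrite gtr0_norm// => y1.
  have [||/andP[h1 h2] _] := @sign_poly_pos k y => //.
  by rewrite ger0_norm//; lra.
Qed.

Lemma sign_poly_cvg (y : R) : `|y| <= 1 -> (sign_poly k).[y] @[k --> \oo] --> Num.sg y.
Proof.
have pos (z : R) : 0 < z -> z <= 1 -> (sign_poly k).[z] @[k --> \oo] --> (1 : R).
  move=> z0 z1; apply/cvgrPdist_lt => /= e e0.
  have : (1 - z / 2) ^+ k @[k --> \oo] --> (0 : R).
    by apply: cvg_expr; rewrite ger0_norm; lra.
  move=> /cvgr0Pnorm_lt /(_ _ e0); apply: filterS => k /= hk.
  have [/andP[h1 h2] h3] := sign_poly_pos k z0 z1.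
  rewrite ger0_norm ?subr_ge0//; apply: le_lt_trans h3 _.
  by apply: le_lt_trans hk; rewrite ler_norm.
have [y0|y0|->] := ltgtP y 0.
- rewrite ltr0_norm// => y1; rewrite ltr0_sg//.
  have := @pos (- y) _ y1; rewrite oppr_gt0 => /(_ y0) h.
  have -> : (fun k => (sign_poly k).[y]) = (fun k => - (sign_poly k).[- y]).
    by apply/funext => k; rewrite sign_polyN opprK.
  exact: cvgN.
- by rewrite gtr0_norm// => y1; rewrite gtr0_sg//; exact: pos.
- by move=> _; rewrite sgr0; under eq_fun do rewrite sign_poly0; exact: cvg_cst.
Qed.

End sign_polynomials.

Section lform.
Context {R : realType} {n : nat}.
Implicit Types s t x : 'rV[R]_n.

Definition lform t x : R := \sum_i t ord0 i * x ord0 i.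

Lemma lformD s t x : lform (s + t) x = lform s x + lform t x.
Proof. by rewrite /lform -big_split/=; apply: eq_bigr => i _; rewrite mxE mulrDl. Qed.

Lemma lformB s t x : lform (s - t) x = lform s x - lform t x.
Proof.
by rewrite /lform -sumrB; apply: eq_bigr => i _; rewrite !mxE mulrBl.
Qed.

Lemma lform0 x : lform 0 x = 0.
Proof. by rewrite /lform big1// => i _; rewrite mxE mul0r. Qed.

Lemma lform_delta a i x : lform (a *: delta_mx ord0 i) x = a * x ord0 i.
Proof.
rewrite /lform (bigD1 i)//= big1 => [|j ji]; first by rewrite !mxE !eqxx mulr1 addr0.
by rewrite !mxE (negbTE ji) andbF mulr0 mul0r.
Qed.

Lemma measurable_lform t : measurable_fun setT (lform t).
Proof.
apply: measurable_sum => i _.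
by apply: measurable_funM => //; exact: measurable_coord_rV.
Qed.

End lform.

Section trigonometric_class.
Context {R : realType} {n : nat}.
(** A functional monotone class argument generated by cosines; the phase in [Dcos] provides the
    sines and replaces complex exponentials. [D] is instantiated below by the functions with equal
    expectations under two laws, and by those that polynomials approximate in mean square. *)
Variable D : ('rV[R]_n -> R) -> Prop.
Hypothesis Dlin : forall a f g, D f -> D g -> D (fun x => a * f x + g x).
Hypothesis Dlim : forall (f_ : nat -> 'rV[R]_n -> R) (f : 'rV[R]_n -> R) (M : R), (forall k, D (f_ k)) ->
  (forall k x, `|f_ k x| <= M) -> (forall x, f_ k x @[k --> \oo] --> f x) -> D f.
Hypothesis Dcos : forall t c, D (fun x => cos (lform t x + c)).

Let D0 : D (fun=> 0).
Proof.
have := Dlin (-1) (Dcos 0 0) (Dcos 0 0).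
by congr D; apply/funext => x; rewrite mulN1r addNr.
Qed.

Let DZ a f : D f -> D (fun x => a * f x).
Proof. by move=> /(Dlin a) /(_ D0); congr D; apply/funext => x; rewrite addr0. Qed.

(* [C] is stable under multiplication by cosines, hence by limits of polynomials in
   sin ((x_i - c) / k), such as the sign of x_i - c. *)
Let C (f : 'rV[R]_n -> R) : Prop := (exists M : R, forall x, `|f x| <= M) /\
  forall t c, D (fun x => f x * cos (lform t x + c)).

Let C1 : C (fun=> 1).
Proof.
split; first by exists 1 => x; rewrite normr1.
by move=> t c; under eq_fun do rewrite mul1r.
Qed.

Let Clin a f g : C f -> C g -> C (fun x => a * f x + g x).
Proof.
move=> [[M fM] Cf] [[N gN] Cg]; split.
  exists (`|a| * M + N) => x; rewrite (le_trans (ler_normD _ _))// lerD//.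
  by rewrite normrM ler_wpM2l.
move=> t c; have := Dlin a (Cf t c) (Cg t c).
by congr D; apply/funext => x; rewrite mulrDl mulrA.
Qed.

Let Clim (f_ : nat -> 'rV[R]_n -> R) (f : 'rV[R]_n -> R) (M : R) : (forall k, C (f_ k)) ->
  (forall k x, `|f_ k x| <= M) -> (forall x, `|f x| <= M) ->
  (forall x, f_ k x @[k --> \oo] --> f x) -> C f.
Proof.
move=> Cf fM fM' ff; split; first by exists M.
move=> t c; apply: (@Dlim (fun k x => f_ k x * cos (lform t x + c)) _ M).
- by move=> k; case: (Cf k).
- move=> k x; rewrite normrM -[leRHS]mulr1 ler_pM//.
  by rewrite ler_norml cos_geN1 cos_le1.
- by move=> x; apply: cvgM; [exact: ff|exact: cvg_cst].
Qed.

Let Ccos f s c : C f -> C (fun x => f x * cos (lform s x + c)).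
Proof.
move=> [[M fM] Cf]; split.
  exists M => x; rewrite normrM -[leRHS]mulr1 ler_pM//.
  by rewrite ler_norml cos_geN1 cos_le1.
move=> t b; have := Dlin (1 / 2) (Cf (s + t) (c + b)) (DZ (1 / 2) (Cf (s - t) (c - b))).
congr D; apply/funext => x; rewrite lformD lformB.
have -> : lform s x + lform t x + (c + b) = (lform s x + c) + (lform t x + b) by ring.
have -> : lform s x - lform t x + (c - b) = (lform s x + c) - (lform t x + b) by ring.
by rewrite cosD cosB; field.
Qed.

Let Cpoly f s c (p : {poly R}) : C f -> C (fun x => f x * p.[cos (lform s x + c)]).
Proof.
elim/poly_ind: p f => [|p a IH] f Cf.
  have := Clin (-1) Cf Cf; congr C; apply/funext => x.
  by rewrite horner0 mulr0 mulN1r addNr.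
have := Clin a Cf (IH _ (Ccos s c Cf)); congr C; apply/funext => x.
by rewrite !hornerE; ring.
Qed.

Let Csg f s c : C f -> C (fun x => f x * Num.sg (cos (lform s x + c))).
Proof.
move=> Cf; have [[M fM] _] := Cf.
have cos1 x : `|cos (lform s x + c)| <= 1 by rewrite ler_norml cos_geN1 cos_le1.
apply: (@Clim (fun k x => f x * (sign_poly k).[cos (lform s x + c)]) _ M).
- by move=> k; exact: Cpoly.
- move=> k x; rewrite normrM -[leRHS]mulr1 ler_pM//; exact: sign_poly_bound.
- by move=> x; rewrite normrM -[leRHS]mulr1 ler_pM// normr_sg; case: (_ != _).
- by move=> x; apply: cvgM; [exact: cvg_cst|exact: sign_poly_cvg].
Qed.

Let Ccoord f i a : C f -> C (fun x => f x * Num.sg (x ord0 i - a)).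
Proof.
move=> Cf; have [[M fM] _] := Cf.
(* The phase pi / 2 turns the cosine into sin ((x_i - a) / (k + 1)). Once k + 1 exceeds |x_i - a|,
   the argument is less than 1 < pi in absolute value, and the sine has the sign of x_i - a. *)
pose s k : 'rV[R]_n := k.+1%:R^-1 *: delta_mx ord0 i.
apply: (@Clim (fun k x => f x *
  Num.sg (cos (lform (s k) x + (- (k.+1%:R^-1 * a) - pi / 2)))) _ M).
- by move=> k; exact: Csg.
- by move=> k x; rewrite normrM -[leRHS]mulr1 ler_pM// normr_sg; case: (_ != _).
- by move=> x; rewrite normrM -[leRHS]mulr1 ler_pM// normr_sg; case: (_ != _).
- move=> x; apply: cvgM; first exact: cvg_cst.
  apply: cvg_near_cst.
  set b := x ord0 i - a.
  exists (Num.truncn `|b|) => //= k /= bk; apply/eqP.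
  have kb : `|b| < k.+1%:R by apply: lt_le_trans (truncnS_gt _) _; rewrite ler_nat ltnS.
  rewrite lform_delta addrA -mulrBr -/b cosB cos_pihalf sin_pihalf mulr0 add0r mulr1.
  have k0 : 0 < k.+1%:R :> R by rewrite ltr0n.
  have pos z : 0 < z -> z < k.+1%:R -> 0 < sin (k.+1%:R^-1 * z) :> R.
    move=> z0 zk; apply: sin_gt0_pi; apply/andP; split.
      by apply: mulr_gt0 => //; rewrite invr_gt0.
    apply: (@lt_trans _ _ 1).
      by rewrite mulrC ltr_pdivrMr// mul1r.
    have := @pi_ge2 R; lra.
  have [b0|b0|b0] := ltgtP b 0; last by rewrite b0 mulr0 sin0.
  + rewrite (ltr0_sg b0) -[X in sin X]opprK -mulrN sinN.
    rewrite ltr0_sg// oppr_lt0; apply: pos; first by rewrite oppr_gt0.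
    by rewrite -(ltr0_norm b0).
  + rewrite (gtr0_sg b0) gtr0_sg//; apply: pos => //.
    by rewrite -(gtr0_norm b0).
Qed.

(** Asking that multiplication by the indicator preserve all of [C] makes these sets stable under
    intersection by construction. They form a sigma-algebra directly, without a lambda-system
    argument. *)
Let A_ (A : set 'rV[R]_n) := forall f, C f -> C (fun x => f x * \1_A x).

Let A_ray i a : A_ ((fun x : 'rV[R]_n => x ord0 i) @^-1` `]a, +oo[%classic).
Proof.
move=> f Cf.
have C0 : C (fun=> 0).
  have := Clin (-1) C1 C1; congr C; apply/funext => x; ring.
(* The indicator of b > 0 is (sg b ^ 2 + sg b) / 2. *)
have := Clin (1 / 2) (Ccoord i a (Ccoord i a Cf)) (Clin (1 / 2) (Ccoord i a Cf) C0).
congr C; apply/funext => x; rewrite indicE.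
have -> : (x \in (fun x : 'rV[R]_n => x ord0 i) @^-1` `]a, +oo[%classic) =
    (0 < x ord0 i - a).
  by apply/idP/idP; rewrite inE /= in_itv/= andbT subr_gt0.
by have [b0|b0|->] := ltgtP (x ord0 i - a) 0;
  rewrite ?(ltr0_sg b0) ?(gtr0_sg b0) ?sgr0 /=; field.
Qed.

Let A_C A : A_ A -> A_ (~` A).
Proof.
move=> hA f Cf; have := Clin (-1) (hA _ Cf) Cf; congr C; apply/funext => x.
by rewrite !indicE in_setC; case: (x \in A) => /=; ring.
Qed.

Let A_bigcup (F : nat -> set 'rV[R]_n) : (forall i, A_ (F i)) -> A_ (\bigcup_i F i).
Proof.
(* The indicator of the complement of the union is the limit of finite products of indicators of
   complements, which are eventually constant at each point. *)
move=> hF f Cf; rewrite -[\bigcup_i _]setCK; apply: A_C Cf => {}f Cf.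
have [[M fM] _] := Cf.
apply: (@Clim (fun k x => f x * \prod_(i < k) \1_(~` F i) x) _ M).
- elim=> [|k IH].
    by under eq_fun do rewrite big_ord0 mulr1.
  by under eq_fun do rewrite big_ord_recr /= mulrA; exact: (A_C (hF k)).
- move=> k x; rewrite normrM -[leRHS]mulr1 ler_pM// normr_prod.
  apply: prodr_ile1 => i _; rewrite normr_ge0/= indicE.
  by case: (_ \in _); rewrite ?normr0 ?normr1.
- move=> x; rewrite normrM -[leRHS]mulr1 ler_pM// indicE.
  by case: (_ \in _); rewrite ?normr0 ?normr1.
- move=> x; apply: cvgM; first exact: cvg_cst.
  apply: cvg_near_cst.
  have [xF|xF] := boolP (x \in \bigcup_i F i).
    have [j _ Fjx] := set_mem xF.
    exists j.+1 => //= k /= jk; apply/eqP.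
    rewrite (bigD1 (Ordinal jk))//= !indicE in_setC (mem_set Fjx)/= mul0r.
    by rewrite in_setC xF.
  apply: nearW => k /=; apply/eqP.
  rewrite indicE in_setC xF/= big1// => i _; rewrite indicE in_setC.
  case: (boolP (x \in F i)) => // /set_mem Fix.
  by move: xF; rewrite notin_setE; case; exists i.
Qed.

Lemma trig_class_indic (A : set 'rV[R]_n) : measurable A -> D \1_A.
Proof.
suff hA : measurable A -> A_ A.
  move=> /hA /(_ _ C1) [_ /(_ 0 0)]; congr D; apply/funext => x.
  by rewrite lform0 addr0 cos0 mulr1 mul1r.
have A_0 : A_ set0.
  move=> f Cf; have := Clin (-1) Cf Cf; congr C; apply/funext => x.
  by rewrite indic0 mulr0 mulN1r addNr.
move: A; apply: smallest_sub.
  split => [|B mB|F mF] //=; first by rewrite setTD; exact: A_C.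
  exact: A_bigcup.
rewrite -bigcup_seq/=; apply: bigcup_sub => i _ B [E mE <-] {B}; rewrite setTI.
suff : @measurable _ (measurableTypeR R) `<=`
    [set E | A_ ((fun x : 'rV[R]_n => x ord0 i) @^-1` E)] by exact.
have -> : @measurable _ (measurableTypeR R) = <<s @RGenOInfty.G R >>.
  exact: RGenOInfty.measurableE.
apply: smallest_sub.
  split => [|B mB|F mF] /=; first by rewrite preimage_set0.
    by rewrite setTD preimage_setC; exact: A_C.
  by rewrite preimage_bigcup; exact: A_bigcup.
by move=> _ [a ->]; exact: A_ray.
Qed.

Import HBNNSimple.

Lemma trig_class (f : 'rV[R]_n -> R) (M : R) : measurable_fun setT f ->
  (forall x, `|f x| <= M) -> D f.
Proof.
move=> mf fM.
have D1 : D (fun=> 1).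
  by have := Dcos 0 0; congr D; apply/funext => x; rewrite lform0 addr0 cos0.
(* Adding M makes f nonnegative, hence a limit of simple functions bounded by 2 M. *)
have mg : measurable_fun setT (fun x => (f x + M)%:E).
  by apply/measurable_EFinP; exact: measurable_funD.
have g0 x : [set: 'rV[R]_n] x -> (0 <= (f x + M)%:E)%E.
  by move=> _; have := fM x; rewrite lee_fin ler_norml; lra.
pose h := nnsfun_approx measurableT mg.
have Dfin (s : seq R) (A : R -> set 'rV[R]_n) : (forall y, measurable (A y)) ->
    D (fun x => \sum_(y <- s) y * \1_(A y) x).
  move=> mA; elim: s => [|y s IH].
    by under eq_fun do rewrite big_nil; exact: D0.
  under eq_fun do rewrite big_cons.
  by apply: Dlin => //; exact: trig_class_indic.
have Dh k : D (h k).
  have := Dfin (finmap.enum_fset (fset_set (range (h k))))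
    (fun y => h k @^-1` [set y]) (fun y => measurable_sfunP (h k) (measurable_set1 y)).
  by congr D; apply/funext => x; rewrite [RHS](fimfunE (h k)) fsbig_finite.
have Dg : D (fun x => f x + M).
  apply: (@Dlim (fun k x => h k x) _ (M + M)) => // [k x|x].
    rewrite ger0_norm; last exact: fun_ge0.
    apply: (@le_trans _ _ (f x + M)).
      rewrite -lee_fin /h nnsfun_approxE; exact: le_approx.
    by have := fM x; rewrite ler_norml; lra.
  have := cvg_nnsfun_approx measurableT mg g0 (x := x) Logic.I.
  by move=> /fine_cvg.
have := Dlin (- M) D1 Dg; congr D; apply/funext => x; ring.
Qed.

End trigonometric_class.

(** * Gaussian measures *)

Section density.
Context d (T : measurableType d) (R : realType).
Variables (mu nu : {measure set T -> \bar R}) (w : T -> R).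
Hypothesis mw : measurable_fun setT w.
Hypothesis w0 : forall x, 0 <= w x.
Hypothesis nuE : forall A, measurable A -> nu A = (\int[mu]_(x in A) (w x)%:E)%E.

Import HBNNSimple.

Lemma ge0_integral_density (f : T -> \bar R) : measurable_fun setT f ->
  (forall x, (0 <= f x)%E) ->
  (\int[nu]_x f x = \int[mu]_x (f x * (w x)%:E))%E.
Proof.
move=> mf f0; pose h := nnsfun_approx measurableT mf.
have hc x : EFin \o h^~ x @ \oo --> f x by exact: cvg_nnsfun_approx.
have mwE : measurable_fun setT (EFin \o w) by exact/measurable_EFinP.
transitivity (limn (fun n => \int[nu]_x (h n x)%:E)%E).
  rewrite -monotone_convergence//.
  - by apply: eq_integral => x _; apply/esym/cvg_lim => //; exact: hc.
  - by move=> n; exact/measurable_EFinP.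
  - by move=> n x _; rewrite lee_fin.
  - by move=> x _ m n mn; rewrite lee_fin; exact/lefP/nd_nnsfun_approx.
transitivity (limn (fun n => \int[mu]_x ((h n x)%:E * (w x)%:E))%E); last first.
  rewrite -monotone_convergence//.
  - apply: eq_integral => x _; apply/cvg_lim => //.
    by apply: cvgeZr => //; exact: hc.
  - move=> n; apply: emeasurable_funM => //; exact/measurable_EFinP.
  - by move=> n x _; rewrite mule_ge0// lee_fin.
  - move=> x _ m n mn; rewrite lee_wpmul2r// ?lee_fin//.
    by exact/lefP/nd_nnsfun_approx.
congr (limn _); apply/funext => n.
transitivity (\sum_(k \in range (h n))
    \int[nu]_x (k * \1_(h n @^-1` [set k]) x)%:E)%E.
  under eq_integral do rewrite fimfunE -fsumEFin//.
  rewrite ge0_integral_fsum//; last 2 first.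
  - by move=> y; exact/measurable_EFinP/measurable_funM.
  - by move=> y x _; rewrite nnfun_muleindic_ge0.
transitivity (\sum_(k \in range (h n))
    \int[mu]_x ((k * \1_(h n @^-1` [set k]) x)%:E * (w x)%:E))%E; last first.
  rewrite -ge0_integral_fsum//; last 2 first.
  - move=> y; apply: emeasurable_funM => //.
    by exact/measurable_EFinP/measurable_funM.
  - by move=> y x _; rewrite mule_ge0 ?lee_fin//; rewrite -lee_fin nnfun_muleindic_ge0.
  apply: eq_integral => x _; rewrite -ge0_mule_fsuml.
    by rewrite fsumEFin// -fimfunE.
  by move=> y; rewrite nnfun_muleindic_ge0.
apply: eq_fsbigr => r _.
have mr : measurable (h n @^-1` [set r]) by exact: measurable_sfunP.
have [r0|r0] := ltP r 0.
  rewrite preimage_nnfun0//; under eq_integral do rewrite indic0 mulr0.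
  rewrite integral0; under eq_integral do rewrite indic0 mulr0 mul0e.
  by rewrite integral0.
under eq_integral do rewrite EFinM.
rewrite ge0_integralZl//; last first.
  exact/measurable_EFinP.
rewrite integral_indic// setIT nuE//.
under [RHS]eq_integral do rewrite EFinM -muleA [X in (_ * X)%E]muleC.
rewrite ge0_integralZl//; last 2 first.
- by apply: emeasurable_funM => //; exact/measurable_EFinP.
- by move=> x _; rewrite mule_ge0// lee_fin.
congr (_ * _)%E; rewrite integral_mkcond; apply: eq_integral => x _.
rewrite patchE indicE; case: ifPn => // _; first by rewrite mule1.
by rewrite mule0.
Qed.

Lemma integr_density (f : T -> R) : integr nu f ->
  integr mu (fun x => f x * w x) /\ \int[nu]_x f x = \int[mu]_x (f x * w x).
Proof.
move=> nf; have mf := integr_meas nf.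
have mfw : measurable_fun setT (fun x => f x * w x) by exact: measurable_funM.
have key (g : T -> R) : measurable_fun setT g -> (forall x, 0 <= g x) ->
    (\int[nu]_x (g x)%:E = \int[mu]_x (g x * w x)%:E)%E.
  by move=> mg g0; rewrite ge0_integral_density//; exact/measurable_EFinP.
split.
  apply/integrableP; split; first exact/measurable_EFinP.
  move/integrableP : nf => [_]; rewrite /comp /=.
  rewrite (key (fun x => `|f x|))//; last exact: measurableT_comp.
  congr (_ < _)%E; apply: eq_integral => x _.
  by rewrite normrM (ger0_norm (w0 x)).
rewrite /Rintegral; congr fine; rewrite integralE [RHS]integralE.
have fp : measurable_fun setT (fun x => Num.max (f x) 0) by exact: measurable_maxr.
have fn : measurable_fun setT (fun x => Num.max (- f x) 0).
  by apply: measurable_maxr => //; exact: measurableT_comp.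
congr (_ - _)%E.
- transitivity (\int[nu]_x (Num.max (f x) 0)%:E)%E.
    by apply: eq_integral => x _; rewrite funeposE/= EFin_max.
  rewrite key//; last by move=> x; rewrite le_max lexx orbT.
  apply: eq_integral => x _; rewrite funeposE/= -EFin_max.
  by rewrite maxr_pMl// mul0r.
- transitivity (\int[nu]_x (Num.max (- f x) 0)%:E)%E.
    by apply: eq_integral => x _; rewrite funenegE/= EFin_max EFinN.
  rewrite key//; last by move=> x; rewrite le_max lexx orbT.
  apply: eq_integral => x _; rewrite funenegE/= -EFin_max.
  by rewrite maxr_pMl// mul0r mulNr.
Qed.

End density.

(** * The standard normal law: exponential moments, Stein's identity, characteristic function *)

Section standard_normal.
Context {R : realType}.
Local Notation phi := (normal_pdf (0 : R) 1).
Local Notation leb := (@lebesgue_measure R).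

Definition stdn : probability (measurableTypeR R) R := normal_prob 0 1.

Lemma ge0_integral_stdn (f : R -> \bar R) : measurable_fun setT f ->
  (forall x, (0 <= f x)%E) ->
  (\int[stdn]_x f x = \int[leb]_x (f x * (phi x)%:E))%E.
Proof.
move=> mf f0; apply: ge0_integral_density => //.
- exact: measurable_normal_pdf.
- exact: normal_pdf_ge0.
Qed.

Lemma Rint_stdn (f : R -> R) : integr stdn f ->
  integr leb (fun x => f x * phi x) /\ \int[stdn]_x f x = \int[leb]_x (f x * phi x).
Proof.
move=> nf; apply: integr_density => //.
- exact: measurable_normal_pdf.
- exact: normal_pdf_ge0.
Qed.

Lemma normal_pdf01E x : phi x = (Num.sqrt (pi *+ 2))^-1 * expR (- (x ^+ 2 / 2)).
Proof.
rewrite normal_pdfE ?oner_eq0// /normal_peak /normal_fun expr1n mul1r subr0.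
by rewrite mulNr.
Qed.

(** Completing the square: exp (t x) times the standard density is exp (t^2 / 2) times the normal
    density of mean t. *)
Lemma integral_expR_stdn (t : R) :
  (\int[stdn]_x (expR (t * x))%:E = (expR (t ^+ 2 / 2))%:E)%E.
Proof.
rewrite ge0_integral_stdn//.
- transitivity (\int[leb]_x ((expR (t ^+ 2 / 2))%:E * (normal_pdf t 1 x)%:E))%E.
    apply: eq_integral => x _; rewrite -!EFinM; congr EFin.
    rewrite normal_pdf01E normal_pdfE ?oner_eq0// /normal_peak /normal_fun expr1n mul1r.
    rewrite mulrCA [RHS]mulrCA; congr (_ * _); rewrite -!expRD; congr expR.
    by field.
  rewrite ge0_integralZl//.
  + by rewrite integral_normal_pdf mule1.
  + by apply/measurable_EFinP; exact: measurable_normal_pdf.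
  + by move=> x _; rewrite lee_fin normal_pdf_ge0.
- apply/measurable_EFinP; apply: measurableT_comp => //; exact: measurable_funM.
Qed.

Lemma integr_expR_stdn (t : R) : integr stdn (fun x : R => expR (t * x)).
Proof.
apply/integrableP; split.
  apply/measurable_EFinP; apply: measurableT_comp => //; exact: measurable_funM.
under eq_integral do rewrite /= ger0_norm ?expR_ge0//.
by rewrite integral_expR_stdn ltry.
Qed.

Lemma integr_expR_abs_stdn (k : R) : integr stdn (fun x : R => expR (k * `|x|)).
Proof.
apply: (@le_integr _ _ _ stdn _ (fun x : R => expR (k * x) + expR (- k * x))).
- apply: measurableT_comp => //; exact: measurable_funM.
- by apply: integrD; exact: integr_expR_stdn.
- move=> x; rewrite ger0_norm ?expR_ge0//.
  have := expR_ge0 (k * x); have := expR_ge0 (- k * x).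
  have [x0|x0] := ler0P x; rewrite ?mulrN ?mulNr; lra.
Qed.

(** Gives integrability of polynomials from the exponential moments, and the decay at infinity of a
    polynomial times the density. *)
Lemma poly_le_expR (q : {poly R}) :
  exists C (k : R), [/\ 0 <= C, 0 <= k & forall x, `|q.[x]| <= C * expR (k * `|x|)].
Proof.
elim/poly_ind: q => [|q a [C [k [C0 k0 qC]]]].
  by exists 0, 0; split => // x; rewrite horner0 normr0 mul0r.
exists (C + `|a|), (k + 1); split; [by rewrite addr_ge0|by rewrite addr_ge0|].
move=> x; rewrite !hornerE (le_trans (ler_normD _ _))// mulrDl lerD//.
  rewrite normrM mulrDl mul1r expRD mulrA ler_pM//.
  by apply: le_trans (expR_ge1Dx _); rewrite lerDr.
rewrite -[leLHS]mulr1 ler_wpM2l// -[leLHS]expR0 ler_expR mulr_ge0//.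
exact: addr_ge0.
Qed.

Lemma measurable_horner (q : {poly R}) : measurable_fun setT (fun x => q.[x]).
Proof. by apply: continuous_measurable_fun; exact: continuous_horner. Qed.

Lemma integr_horner_stdn (q : {poly R}) : integr stdn (fun x : R => q.[x]).
Proof.
have [C [k [C0 k0 qC]]] := poly_le_expR q.
apply: (@le_integr _ _ _ stdn _ (fun x : R => C * expR (k * `|x|))) => //.
- exact: measurable_horner.
- by apply: integrZ; exact: integr_expR_abs_stdn.
Qed.

End standard_normal.

Section stein.
Context {R : realType}.
Local Notation phi := (normal_pdf (0 : R) 1).
Local Notation leb := (@lebesgue_measure R).
Let c : R := (Num.sqrt (pi *+ 2))^-1.
Let e : {poly R} := - (1 / 2) *: 'X^2.

Let phie x : phi x = c * expR e.[x].
Proof. by rewrite normal_pdf01E /e hornerZ hornerXn; congr (_ * expR _); field. Qed.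

Let F (q : {poly R}) (x : R) := q.[x] * (c * expR e.[x]).

Let is_derive_F (q : {poly R}) (x : R) :
  is_derive x 1 (F q) ((q^`() - 'X * q).[x] * phi x).
Proof.
have he : is_derive x 1 (fun y => c * expR e.[y]) (c * (- x * expR e.[x])).
  have h1 : is_derive x 1 (fun y => expR e.[y]) (- x * expR e.[x]).
    have -> : - x * expR e.[x] = expR e.[x] * e^`().[x].
      rewrite /e derivZ derivXn /= hornerZ hornerMn hornerXn expr1 mulrC; congr (_ * _).
      by rewrite mulr2n; field.
    exact: (@is_derive1_comp _ expR (horner e) x).
  exact: (@is_deriveZ _ _ _ (fun y => expR e.[y]) c x 1).
have -> : (q^`() - 'X * q).[x] * phi x =
    q.[x] *: (c * (- x * expR e.[x])) + (c * expR e.[x]) *: q^`().[x].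
  rewrite phie hornerD hornerN hornerM hornerX /GRing.scale /=; ring.
exact: (@is_deriveM _ _ (horner q) (fun y => c * expR e.[y]) x 1).
Qed.

Let F_cvg0 (q : {poly R}) (s : R) : `|s| = 1 -> F q (s * n%:R) @[n --> \oo] --> (0 : R).
Proof.
move=> s1; have [C [k [C0 k0 qC]]] := poly_le_expR q.
have c0 : 0 <= c by rewrite invr_ge0 sqrtr_ge0.
(* Completing the square gives k n - n^2 / 2 <= (k + 1)^2 / 2 - n, and exp (- n) <= 1 / (n + 1). *)
pose E := expR ((k + 1) ^+ 2 / 2); pose B := C * (c * E).
have B0 : 0 <= B by rewrite !mulr_ge0// expR_ge0.
apply/cvgr0Pnorm_le => /= eps eps0.
have := @cvg_harmonic R; move/cvgr0Pnorm_lt => /(_ (eps / (B + 1)))[].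
  by rewrite divr_gt0// ltr_wpDl.
move=> N _ hN; exists N => // n /= Nn.
rewrite /F normrM (ger0_norm (x := c * _)) ?mulr_ge0 ?expR_ge0//.
have sn : `|s * n%:R| = n%:R by rewrite normrM s1 mul1r normr_nat.
apply: (@le_trans _ _ (C * expR (k * n%:R) * (c * expR e.[s * n%:R]))).
  by rewrite ler_wpM2r ?mulr_ge0 ?expR_ge0// -{2}sn.
have -> : e.[s * n%:R] = - (n%:R ^+ 2 / 2).
  by rewrite /e hornerZ hornerXn -real_normK ?num_real// sn; field.
have : `|n.+1%:R^-1| < eps / (B + 1) by exact: hN.
rewrite ger0_norm ?invr_ge0// ltr_pdivlMr ?ltr_wpDl// => hn.
have hB : B * n.+1%:R^-1 <= eps.
  apply: le_trans (ltW hn); rewrite mulrC; apply: ler_wpM2l; rewrite ?invr_ge0//; lra.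
apply: le_trans hB.
have -> : C * expR (k * n%:R) * (c * expR (- (n%:R ^+ 2 / 2))) =
    C * (c * expR (k * n%:R - n%:R ^+ 2 / 2)) by rewrite expRD; ring.
rewrite /B -!mulrA; apply: ler_wpM2l => //; apply: ler_wpM2l => //.
apply: (@le_trans _ _ (E * expR (- n%:R))).
  rewrite -expRD ler_expR.
  have := sqr_ge0 (n%:R - (k + 1)); lra.
apply: ler_wpM2l; first exact: expR_ge0.
rewrite expRN lef_pV2 ?posrE ?expR_gt0 ?ltr0n//.
by apply: le_trans (expR_ge1Dx _); rewrite -natr1 addrC.
Qed.

(** Times the density, the integrand is the derivative of [F q], which vanishes at both infinities.
    The moments, the orthogonality of Hermite polynomials and Mehler's formula all follow from this
    identity. *)
Lemma stein (q : {poly R}) : \int[stdn]_x (q^`() - 'X * q).[x] = 0.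
Proof.
set p := q^`() - 'X * q.
have [ip ->] := Rint_stdn (integr_horner_stdn p).
pose I_ (n : nat) : set R := `[(- n%:R)%R, n%:R]%classic.
pose f_ (n : nat) : R -> R := (fun x => p.[x] * phi x) \_ (I_ n).
have mI n : measurable (I_ n) by exact: measurable_itv.
have [] := @Rint_dominated _ _ _ leb f_ (fun x => p.[x] * phi x)
  (fun x => `|p.[x] * phi x|).
- move=> n; apply/(measurable_restrictT _ (mI n)).
  by apply: measurable_funTS; exact: (integr_meas ip).
- move=> x; apply: cvg_near_cst.
  exists (Num.truncn `|x|).+1 => //= n /= xn; apply/eqP.
  rewrite /f_ patchE mem_set// /I_ /= in_itv/= -ler_norml.
  by apply: le_trans (ltW (truncnS_gt _)) _; rewrite ler_nat.
- by apply: integrable_norm.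
- by move=> n x; rewrite /f_ patchE; case: ifPn => // _; rewrite normr0.
move=> _ cv.
have E (n : nat) : (0 < n)%N -> \int[leb]_x f_ n x = F q n%:R - F q (- n%:R).
  move=> n0; rewrite -Rintegral_mkcond /Rintegral.
  rewrite (@continuous_FTC2 _ _ (F q)) //=.
  - by rewrite -(ltr0n R) in n0; lra.
  - apply: continuous_subspaceT => x.
    apply: cvgM; first exact: continuous_horner.
    by apply: continuous_normal_pdf; exact: oner_neq0.
  - have cF x : {for x, continuous (F q)}.
      by apply/differentiable_continuous/derivable1_diffP; case: (is_derive_F q x).
    split.
    + by move=> x _; case: (is_derive_F q x).
    + by apply: cvg_at_right_filter; exact: cF.
    + by apply: cvg_at_left_filter; exact: cF.
  - by move=> x _; rewrite derive1E; case: (is_derive_F q x).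
have : \int[leb]_x f_ n x @[n --> \oo] --> (0 : R) - 0.
  apply: (@cvg_trans _ ((F q (1 * n%:R) - F q (- 1 * n%:R)) @[n --> \oo])).
    apply: near_eq_cvg; exists 1%N => // n /= n0.
    by rewrite E// mul1r mulN1r.
  by apply: cvgB; apply: F_cvg0; rewrite ?normrN normr1.
rewrite subr0 => cv0; exact: (cvg_unique _ cv cv0).
Qed.

End stein.

Section normal_characteristic.
Context {R : realType}.

Let m (k : nat) : R := \int[stdn]_x (x ^+ k).

Let iX k : integr (@stdn R) (fun x : R => x ^+ k).
Proof.
have := integr_horner_stdn ('X^k : {poly R}).
by congr integr; apply/funext => x; rewrite hornerXn.
Qed.

Let m0 : m 0 = 1.
Proof.
rewrite /m; under eq_Rintegral do rewrite expr0.
by rewrite Rintegral_cst// mul1r; exact: (congr1 fine (probability_setT (@stdn R))).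
Qed.

Let mS k : m k.+1 = k%:R * m k.-1.
Proof.
have := @stein R 'X^k.
under eq_Rintegral do rewrite hornerD hornerN hornerM hornerX derivXn hornerMn !hornerXn -exprS -mulr_natl.
by rewrite RintB// ?RintZ// => [/eqP|]; [rewrite subr_eq0 => /eqP ->|exact: integrZ].
Qed.

Let m_odd j : m j.*2.+1 = 0.
Proof. by elim: j => [|j IH]; rewrite mS ?mul0r// doubleS /= IH mulr0. Qed.

(** The quotient is the double factorial (2 j - 1)!!; in this form it cancels the (2 j)! of the
    cosine series and leaves an exponential series. *)
Let m_even j : m j.*2 = (j.*2)`!%:R / (2 ^+ j * j`!%:R).
Proof.
elim: j => [|j IH]; first by rewrite m0 expr0 mul1r divr1.
rewrite doubleS mS /= IH !factS exprS !natrM.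
have h1 : (j.+1)%:R != 0 :> R by rewrite pnatr_eq0.
have h2 : (j`!)%:R != 0 :> R by rewrite pnatr_eq0 -lt0n fact_gt0.
have h3 : 2 ^+ j != 0 :> R by rewrite expf_neq0// pnatr_eq0.
have -> : (j.*2.+2)%:R = 2 * (j.+1)%:R :> R by rewrite -doubleS -muln2 natrM mulrC.
set a : R := (j.+1)%:R in h1 *; set b : R := 2 ^+ j in h3 *.
set e : R := (j`!)%:R in h2 *.
by field; apply/and3P; split => //; rewrite nat1r.
Qed.

Lemma series_le_expR (x : R) (a : nat -> R) n :
  (forall k, `|a k| <= `|x| ^+ k / k`!%:R) -> `|\sum_(0 <= k < n) a k| <= expR `|x|.
Proof.
move=> ha; apply: le_trans (ler_norm_sum _ _ _) _.
apply: (@le_trans _ _ (series (exp_coeff `|x|) n)).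
  by rewrite /series /=; apply: ler_sum => k _; exact: ha.
have h : series (exp_coeff `|x|) n @[n --> \oo] --> expR `|x|.
  by have := is_cvg_series_exp_coeff `|x|; rewrite /expR.
rewrite -(cvg_lim (@Rhausdorff R) h); apply: nondecreasing_cvgn_le.
  by apply/nondecreasing_seqP => k; rewrite /series /= big_nat_recr//= lerDl exp_coeff_ge0.
exact: (cvgP _ h).
Qed.

Lemma cos_coeff'_sum_le (u : R) n : `|\sum_(0 <= k < n) cos_coeff' u k| <= expR `|u|.
Proof.
have -> : \sum_(0 <= k < n) cos_coeff' u k = \sum_(0 <= k < n.*2) cos_coeff u k.
  elim: n => [|n IH]; first by rewrite !big_geq.
  by rewrite doubleS !big_nat_recr//= IH cos_coeff'E cos_coeff_odd addr0.
apply: series_le_expR => k.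
rewrite /cos_coeff /= !normrM normrX normfV !normr_nat normrX normrN normr1.
rewrite expr1n mulr1 -mulrA ler_piMl ?mulr_ge0 ?invr_ge0//.
by case: odd; rewrite /= ?mulr0n.
Qed.

Lemma sin_coeff'_sum_le (u : R) n : `|\sum_(0 <= k < n) sin_coeff' u k| <= expR `|u|.
Proof.
have -> : \sum_(0 <= k < n) sin_coeff' u k = \sum_(0 <= k < n.*2) sin_coeff u k.
  elim: n => [|n IH]; first by rewrite !big_geq.
  by rewrite doubleS !big_nat_recr//= IH sin_coeff'E sin_coeff_even addr0.
apply: series_le_expR => k.
rewrite /sin_coeff /= !normrM normrX normfV !normr_nat normrX normrN normr1.
rewrite expr1n mulr1 -mulrA ler_piMl ?mulr_ge0 ?invr_ge0//.
by case: odd; rewrite /= ?mulr0n.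
Qed.

(** The bound exp (|s| |x|) on all partial sums is integrable, so the series may be integrated term
    by term. [b] lists the exponents: even ones for the cosine, odd ones for the sine. *)
Lemma Rint_series_stdn (s : R) (a : nat -> R -> R) (c : nat -> R) (b : nat -> nat)
    (f : R -> R) : (forall k u, a k u = c k * u ^+ b k) ->
  (forall u n, `|\sum_(0 <= k < n) a k u| <= expR `|u|) ->
  (forall u, series (a ^~ u) n @[n --> \oo] --> f u) ->
  integr (@stdn R) (fun x : R => f (s * x)) /\
  \sum_(0 <= k < n) (c k * s ^+ b k * m (b k)) @[n --> \oo] -->
  \int[stdn]_x f (s * x).
Proof.
move=> aE ale af.
have aE' k (x : R) : a k (s * x) = c k * s ^+ b k * x ^+ b k.
  by rewrite aE exprMn mulrA.
have ia k : integr (@stdn R) (fun x : R => c k * s ^+ b k * x ^+ b k).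
  by apply: integrZ; exact: iX.
have [||||iff cv] := @Rint_dominated _ _ _ (@stdn R)
  (fun n (x : R) => \sum_(0 <= k < n) a k (s * x)) (fun x : R => f (s * x))
  (fun x : R => expR (`|s| * `|x|)).
- move=> n; apply: measurable_sum => k; under eq_fun do rewrite aE'.
  exact: (integr_meas (ia k)).
- by move=> x; exact: af.
- exact: integr_expR_abs_stdn.
- by move=> n x; rewrite -normrM; exact: ale.
split => //; apply: cvg_trans cv; apply: near_eq_cvg; apply: nearW => n /=.
under eq_Rintegral => x _ do (under eq_bigr do rewrite aE').
rewrite (@Rint_sum _ _ _ (@stdn R) _ _ _ (fun k (x : R) => c k * s ^+ b k * x ^+ b k))//.
by apply: eq_bigr => k _; rewrite RintZ.
Qed.

Lemma Rint_cos_stdn (s : R) : integr (@stdn R) (fun x : R => cos (s * x)) /\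
  \int[stdn]_x cos (s * x) = expR (- (s ^+ 2 / 2)).
Proof.
have [i cv] := @Rint_series_stdn s (fun k u => cos_coeff' u k)
  (fun k => (-1) ^+ k / k.*2`!%:R) double (@cos R)
  (fun k u => mulrAC _ _ _) cos_coeff'_sum_le (@cvg_cos_coeff' R).
split => //; suff cv2 : \sum_(0 <= k < n)
    ((-1) ^+ k / k.*2`!%:R * s ^+ k.*2 * m k.*2) @[n --> \oo] -->
    expR (- (s ^+ 2 / 2)) by exact: (cvg_unique _ cv cv2).
have h : series (exp_coeff (- (s ^+ 2 / 2))) n @[n --> \oo] --> expR (- (s ^+ 2 / 2)).
  by have := is_cvg_series_exp_coeff (- (s ^+ 2 / 2)); rewrite /expR.
apply: cvg_trans h; apply: near_eq_cvg; apply: nearW => n.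
rewrite /series /=; apply: eq_bigr => k _.
rewrite m_even /exp_coeff /= (exprNn (s ^+ 2 / 2)) expr_div_n -exprM mul2n.
have h1 : (k.*2)`!%:R != 0 :> R by rewrite pnatr_eq0 -lt0n fact_gt0.
have h2 : (k`!)%:R != 0 :> R by rewrite pnatr_eq0 -lt0n fact_gt0.
have h3 : 2 ^+ k != 0 :> R by rewrite expf_neq0// pnatr_eq0.
by field; rewrite ?h1 ?h2 ?h3.
Qed.

Lemma Rint_sin_stdn (s : R) : integr (@stdn R) (fun x : R => sin (s * x)) /\
  \int[stdn]_x sin (s * x) = 0.
Proof.
have [i cv] := @Rint_series_stdn s (fun k u => sin_coeff' u k)
  (fun k => (-1) ^+ k / k.*2.+1`!%:R) (fun k => k.*2.+1) (@sin R)
  (fun k u => mulrAC _ _ _) sin_coeff'_sum_le (@cvg_sin_coeff' R).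
split => //; suff cv2 : \sum_(0 <= k < n)
    ((-1) ^+ k / k.*2.+1`!%:R * s ^+ k.*2.+1 * m k.*2.+1) @[n --> \oo] -->
    (0 : R) by exact: (cvg_unique _ cv cv2).
under eq_fun do (under eq_bigr do rewrite m_odd mulr0).
by under eq_fun do rewrite big1//; exact: cvg_cst.
Qed.

Lemma characteristic_stdn (s c : R) :
  \int[stdn]_x cos (s * x + c) = expR (- (s ^+ 2 / 2)) * cos c.
Proof.
have [ic ec] := Rint_cos_stdn s; have [is_ es] := Rint_sin_stdn s.
under eq_Rintegral do rewrite cosD mulrC [X in _ - X]mulrC.
rewrite RintB; [|exact: integrZ|exact: integrZ].
by rewrite !RintZ// ec es mulr0 subr0 mulrC.
Qed.

End normal_characteristic.

(** * Fubini's theorem and image measures for real-valued integrals *)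

Section fubini_real.
Context d1 d2 (T1 : measurableType d1) (T2 : measurableType d2) (R : realType).
Variables (m1 : {sigma_finite_measure set T1 -> \bar R})
  (m2 : {sigma_finite_measure set T2 -> \bar R}).

Lemma integr_prodM (f : T1 -> R) (g : T2 -> R) : integr m1 f -> integr m2 g ->
  integr (m1 \x m2)%E (fun z => f z.1 * g z.2).
Proof.
move=> fi gi; have mf := integr_meas fi; have mg := integr_meas gi.
have mfg : measurable_fun setT (fun z : T1 * T2 => f z.1 * g z.2).
  by apply: measurable_funM; apply: measurableT_comp.
apply/(@integrable12ltyP _ _ _ _ _ m1 m2); first exact/measurable_EFinP.
move/integrableP : fi => [_ fi]; move/integrableP : gi => [_ gi].
under eq_integral => x _ do (under eq_integral => y _ do rewrite /= normrM EFinM).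
under eq_integral => x _.
  rewrite ge0_integralZl//; last first.
    by apply/measurable_EFinP; exact: measurableT_comp.
  over.
rewrite ge0_integralZr//; last 2 first.
- by apply/measurable_EFinP; exact: measurableT_comp.
- exact: integral_ge0.
by rewrite lte_mul_pinfty// ?integral_ge0// ge0_fin_numE// integral_ge0.
Qed.

(** The inner real integral differs from the extended one only where the latter is infinite, which
    is a null set. *)
Lemma Rint_fubini (f : T1 * T2 -> R) : integr (m1 \x m2)%E f ->
  integr m1 (fun x => \int[m2]_y f (x, y)) /\
  \int[(m1 \x m2)%E]_z f z = \int[m1]_x \int[m2]_y f (x, y).
Proof.
move=> fi; pose F x := (\int[m2]_y (f (x, y))%:E)%E.
have iF : m1.-integrable setT F by exact: (integrable_fubini_F fi).
have mF : measurable_fun setT F by exact: measurable_int iF.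
have mFf : measurable_fun setT (fun x => fine (F x)) by exact: measurableT_comp.
have aeF : ae_eq m1 setT F (EFin \o (fun x => fine (F x))).
  have := integrable_ae measurableT iF.
  by apply: filterS => x /= h _; rewrite fineK//; exact: h.
split.
  apply/integrableP; split; first exact/measurable_EFinP.
  move/integrableP : iF => [_]; congr (_ < _)%E.
  apply: ae_eq_integral => //.
  - exact: measurableT_comp.
  - by do 2 apply: measurableT_comp => //; exact/measurable_EFinP.
  - by apply: filterS aeF => x /= h xT; rewrite h.
rewrite /Rintegral; congr fine; rewrite -(integral12_prod_meas1 fi).
apply: ae_eq_integral => //; exact/measurable_EFinP.
Qed.

Lemma Rint_fubini_swap (f : T1 * T2 -> R) : integr (m1 \x m2)%E f ->
  integr m2 (fun y => \int[m1]_x f (x, y)) /\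
  \int[(m1 \x m2)%E]_z f z = \int[m2]_y \int[m1]_x f (x, y).
Proof.
move=> fi; pose F y := (\int[m1]_x (f (x, y))%:E)%E.
have mf : measurable_fun setT (EFin \o f) by exact: measurable_int fi.
have iF : m2.-integrable setT F.
  apply/integrableP; split; first exact: (measurable_fubini_G fi).
  apply: le_lt_trans ((integrable21ltyP m1 m2 mf).1 fi).
  apply: ge0_le_integral => //.
  - by apply: measurableT_comp => //; exact: (measurable_fubini_G fi).
  - apply: (measurable_fun_fubini_tonelli_G (abse \o (EFin \o f))).
      exact: measurableT_comp.
    by move=> z; exact: abse_ge0.
  - move=> y _; apply: le_abse_integral => //; apply/measurable_EFinP.
    exact: (measurableT_comp (integr_meas fi)).
have mF : measurable_fun setT F by exact: measurable_int iF.
have mFf : measurable_fun setT (fun x => fine (F x)) by exact: measurableT_comp.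
have aeF : ae_eq m2 setT F (EFin \o (fun x => fine (F x))).
  have := integrable_ae measurableT iF.
  by apply: filterS => x /= h _; rewrite fineK//; exact: h.
split.
  apply/integrableP; split; first exact/measurable_EFinP.
  move/integrableP : iF => [_]; congr (_ < _)%E.
  apply: ae_eq_integral => //.
  - exact: measurableT_comp.
  - by do 2 apply: measurableT_comp => //; exact/measurable_EFinP.
  - by apply: filterS aeF => x /= h xT; rewrite h.
rewrite /Rintegral; congr fine; rewrite -(integral21_prod_meas1 fi).
apply: ae_eq_integral => //; exact/measurable_EFinP.
Qed.

End fubini_real.

Section pushforward_real.
Context d1 d2 (T1 : measurableType d1) (T2 : measurableType d2) (R : realType).
Variables (mu : {measure set T1 -> \bar R}) (nu : {measure set T2 -> \bar R}).
Variable phi : T1 -> T2.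
Hypothesis mphi : measurable_fun setT phi.
Hypothesis nuE : forall A, measurable A -> nu A = mu (phi @^-1` A).

Lemma ge0_integral_law (f : T2 -> \bar R) : measurable_fun setT f ->
  (forall y, (0 <= f y)%E) ->
  (\int[nu]_y f y = \int[mu]_x f (phi x))%E.
Proof.
move=> mf f0; rewrite (eq_measure_integral (pushforward mu phi)); last first.
  by move=> A mA _; rewrite nuE.
by rewrite ge0_integral_pushforward// preimage_setT.
Qed.

Lemma integr_law (f : T2 -> R) : measurable_fun setT f ->
  integr nu f <-> integr mu (f \o phi).
Proof.
move=> mf; have mfE : measurable_fun setT (EFin \o f) by exact/measurable_EFinP.
have E : (\int[nu]_y `|(f y)%:E| = \int[mu]_x `|(f (phi x))%:E|)%E.
  rewrite (ge0_integral_law (f := fun y => `|(f y)%:E|%E))//.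
  exact: measurableT_comp.
split => /integrableP[_ h]; apply/integrableP; split.
- by apply/measurable_EFinP; exact: measurableT_comp.
- by rewrite -E.
- exact/measurable_EFinP.
- by rewrite E.
Qed.

Lemma Rint_law (f : T2 -> R) : measurable_fun setT f -> integr mu (f \o phi) ->
  \int[nu]_y f y = \int[mu]_x f (phi x).
Proof.
move=> mf fi; rewrite /Rintegral; congr fine.
rewrite (eq_measure_integral (pushforward mu phi)); last first.
  by move=> A mA _; rewrite nuE.
rewrite integral_pushforward ?preimage_setT//.
exact/measurable_EFinP.
Qed.

Lemma sqi_law (f : T2 -> R) : sqi nu f -> sqi mu (f \o phi).
Proof.
move=> [mf fi]; split; first exact: measurableT_comp.
by move/integr_law : fi; apply; exact: measurable_funX.
Qed.

End pushforward_real.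

(** * The standard Gaussian measure on R^n *)

Definition rV_cons_mfun (R : realType) (m : nat) :
    {mfun ('rV[R]_m * measurableTypeR R)%type >-> 'rV[R]_m.+1} :=
  HB.pack_for {mfun ('rV[R]_m * measurableTypeR R)%type >-> 'rV[R]_m.+1}
    (@rV_cons R m)
    (@isMeasurableFun.Build _ _ ('rV[R]_m * measurableTypeR R)%type 'rV[R]_m.+1
       (@rV_cons R m) (@measurable_rV_cons _ R m)).

(** The recursion mirrors that of [lebesgue_rV], so that the density of one measure with respect to
    the other is found by induction on the dimension. *)
Fixpoint gauss_rV (R : realType) (n : nat) : probability 'rV[R]_n R :=
  if n is m.+1 then
    [the probability _ _ of distribution (gauss_rV R m \x @stdn R)%E (rV_cons_mfun R m)]
  else [the probability _ _ of \d_(0 : 'rV[R]_0)].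

Section gauss_rV.
Context {R : realType}.
Implicit Type n : nat.

Lemma gauss_rVSE n A : measurable A ->
  gauss_rV R n.+1 A = (gauss_rV R n \x stdn)%E (@rV_cons R n @^-1` A).
Proof. by []. Qed.

Let mcons n : @measurable_fun _ _ ('rV[R]_n * measurableTypeR R)%type 'rV[R]_n.+1
  setT (@rV_cons R n).
Proof. exact: measurable_rV_cons. Qed.

Lemma rV_cons0 n (v : 'rV[R]_n) x : rV_cons (v, x) ord0 ord0 = x.
Proof. by rewrite mxE unlift_none. Qed.

Lemma rV_consS n (v : 'rV[R]_n) x i : rV_cons (v, x) ord0 (lift ord0 i) = v ord0 i.
Proof. by rewrite mxE liftK. Qed.

(** Independence of the coordinates; it reduces the multivariate Hermite identities to one
    variable. *)
Lemma gauss_rV_prod n (f : 'I_n -> R -> R) : (forall i, integr stdn (f i)) ->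
  integr (gauss_rV R n) (fun x => \prod_i f i (x ord0 i)) /\
  \int[gauss_rV R n]_x \prod_i f i (x ord0 i) = \prod_i \int[stdn]_x f i x.
Proof.
elim: n f => [|n IH] f fi.
  split; first by under eq_fun do rewrite big_ord0; exact: integr_cst.
  under eq_Rintegral do rewrite big_ord0.
  rewrite big_ord0 Rintegral_cst// mul1r.
  exact: (congr1 fine (probability_setT (gauss_rV R 0))).
have [IH1 IH2] := IH (fun i => f (lift ord0 i)) (fun i => fi _).
have mf : measurable_fun setT (fun x : 'rV[R]_n.+1 => \prod_i f i (x ord0 i)).
  apply: measurable_prod => i _; apply: measurableT_comp.
    exact: (integr_meas (fi i)).
  exact: measurable_coord_rV.
have E v x : \prod_i f i (rV_cons (v, x) ord0 i) =
    \prod_i f (lift ord0 i) (v ord0 i) * f ord0 x.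
  rewrite big_ord_recl mulrC rV_cons0; congr (_ * _).
  by apply: eq_bigr => i _; rewrite rV_consS.
have iprod := integr_prodM IH1 (fi ord0).
have iprod' : integr (gauss_rV R n \x stdn)%E
    ((fun x : 'rV[R]_n.+1 => \prod_i f i (x ord0 i)) \o @rV_cons R n).
  by move: iprod; congr integr; apply/funext => -[v x]; rewrite /= E.
split.
  exact/(integr_law (@mcons n) (@gauss_rVSE n) mf).
rewrite (Rint_law (@mcons n) (@gauss_rVSE n) mf iprod').
have [_ ->] := Rint_fubini iprod'.
under eq_Rintegral => v _ do (under eq_Rintegral => x _ do rewrite /= E).
under eq_Rintegral => v _ do rewrite RintZ//.
under eq_Rintegral do rewrite mulrC.
by rewrite RintZ// IH2 [RHS]big_ord_recl.
Qed.

Lemma characteristic_gauss_rV n (t : 'rV[R]_n) c :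
  \int[gauss_rV R n]_x cos (lform t x + c) =
  expR (- ((\sum_i t ord0 i ^+ 2) / 2)) * cos c.
Proof.
elim: n t c => [|n IH] t c.
  under eq_Rintegral do rewrite /lform big_ord0 add0r.
  rewrite big_ord0 mul0r oppr0 expR0 mul1r Rintegral_cst//.
  by rewrite (congr1 fine (probability_setT (gauss_rV R 0))) mulr1.
pose t' : 'rV[R]_n := \row_i t ord0 (lift ord0 i).
have mcos : measurable_fun setT (fun x : 'rV[R]_n.+1 => cos (lform t x + c)).
  apply: measurableT_comp => //; first exact: (continuous_measurable_fun (@continuous_cos R)).
  by apply: measurable_funD => //; exact: measurable_lform.
have icos : integr (gauss_rV R n \x stdn)%E
    ((fun x : 'rV[R]_n.+1 => cos (lform t x + c)) \o @rV_cons R n).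
  apply: (@integr_bounded _ _ _ [the probability _ _ of (gauss_rV R n \x @stdn R)%E] _ 1).
    by apply: measurableT_comp => //; exact: mcons.
  by move=> z; rewrite ler_norml cos_geN1 cos_le1.
rewrite (Rint_law (@mcons n) (@gauss_rVSE n) mcos icos).
have [_ ->] := Rint_fubini icos.
have E v x : lform t (rV_cons (v, x)) + c = t ord0 ord0 * x + (lform t' v + c).
  rewrite /lform big_ord_recl rV_cons0 addrA; congr (_ + _ + _).
  by apply: eq_bigr => i _; rewrite rV_consS mxE.
under eq_Rintegral => v _ do (under eq_Rintegral => x _ do rewrite /= E).
under eq_Rintegral => v _ do rewrite characteristic_stdn.
rewrite RintZ; last first.
  apply: (@integr_bounded _ _ _ _ _ 1).
    apply: measurableT_comp => //; first exact: (continuous_measurable_fun (@continuous_cos R)).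
    by apply: measurable_funD => //; exact: measurable_lform.
  by move=> z; rewrite ler_norml cos_geN1 cos_le1.
rewrite IH mulrA -expRD -opprD -mulrDl big_ord_recl.
by under [in LHS]eq_bigr do rewrite mxE.
Qed.

Lemma lebesgue_rV_sigma_finite n : sigma_finite setT (lebesgue_rV R n).
Proof.
exists (fun k => box (const_mx (- k%:R)) (const_mx k%:R)).
  apply/esym; rewrite -subTset => x _.
  exists (Num.truncn (\sum_i `|x ord0 i|)).+1 => // i.
  rewrite !mxE in_itv/= -ler_norml; apply: le_trans (ltW (truncnS_gt _)).
  by rewrite (bigD1 i)//= lerDl sumr_ge0.
move=> k; split; first exact: measurable_box.
rewrite lebesgue_rV_box ?ltry// => i; rewrite !mxE.
by rewrite (le_trans (y := 0))// oppr_le0.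
Qed.

(** A copy of [lebesgue_rV] that carries the sigma-finite structure on which Tonelli's theorem
    relies. *)
Definition lebesgue_sf n : set 'rV[R]_n -> \bar R := lebesgue_rV R n.

HB.instance Definition _ n := Measure.copy (@lebesgue_sf n) (lebesgue_rV R n).

HB.instance Definition _ n :=
  @Measure_isSigmaFinite.Build _ _ _ (@lebesgue_sf n) (lebesgue_rV_sigma_finite n).

Lemma measurable_gauss_density n : measurable_fun setT (@gauss_density R n).
Proof.
apply: measurable_prod => i _; apply: measurableT_comp.
  exact: measurable_normal_pdf.
exact: measurable_coord_rV.
Qed.

Lemma gauss_density_ge0 n (x : 'rV[R]_n) : 0 <= gauss_density x.
Proof. by apply: prodr_ge0 => i _; exact: normal_pdf_ge0. Qed.

Lemma ge0_integral_gauss_rV n (f : 'rV[R]_n -> \bar R) : measurable_fun setT f ->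
  (forall x, (0 <= f x)%E) ->
  (\int[gauss_rV R n]_x f x =
   \int[lebesgue_rV R n]_x (f x * (gauss_density x)%:E))%E.
Proof.
elim: n f => [|n IH] f mf f0.
  rewrite /= !integral_dirac//.
    by rewrite !diracT !mul1e /gauss_density big_ord0 mule1.
  apply: emeasurable_funM => //; apply/measurable_EFinP.
  exact: measurable_gauss_density.
pose h (z : 'rV[R]_n * measurableTypeR R) : \bar R :=
  (f (rV_cons z) * (normal_pdf 0 1 z.2)%:E)%E.
have mphi : measurable_fun setT (fun x : R => (normal_pdf (0 : R) 1 x)%:E).
  by apply/measurable_EFinP; exact: measurable_normal_pdf.
have mfc : measurable_fun setT (f \o @rV_cons R n : 'rV[R]_n * measurableTypeR R -> _).
  by apply: measurableT_comp mf _; exact: mcons.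
have mh : measurable_fun setT h.
  by apply: emeasurable_funM => //; exact: (measurableT_comp mphi measurable_snd).
have h0 z : (0 <= h z)%E by rewrite mule_ge0// lee_fin normal_pdf_ge0.
have md : measurable_fun setT (fun z : 'rV[R]_n * measurableTypeR R =>
    (gauss_density z.1)%:E).
  apply/measurable_EFinP; apply: measurableT_comp measurable_fst.
  exact: measurable_gauss_density.
transitivity (\int[gauss_rV R n]_v \int[lebesgue_measure]_x h (v, x))%E.
  rewrite (ge0_integral_law (@mcons n) (@gauss_rVSE n))//.
  rewrite (fubini_tonelli1 (m1 := gauss_rV R n) (m2 := @stdn R)
    (fun z => f (rV_cons z)))//.
  apply: eq_integral => v _; rewrite /fubini_F ge0_integral_stdn//.
  exact: (measurableT_comp mfc (pair1_measurable v)).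
rewrite IH; last 2 first.
- exact: (measurable_fun_fubini_tonelli_F h).
- by move=> v; exact: integral_ge0.
transitivity (\int[@lebesgue_sf n]_v \int[lebesgue_measure]_x
    (h (v, x) * (gauss_density v)%:E))%E.
  apply: eq_integral => v _; rewrite ge0_integralZr//.
  - exact: (measurableT_comp mh (pair1_measurable v)).
  - by rewrite lee_fin gauss_density_ge0.
rewrite -(@fubini_tonelli1 _ _ _ _ _ (@lebesgue_sf n) (@lebesgue_measure R)
  (fun z => h z * (gauss_density z.1)%:E)%E); last 2 first.
- exact: emeasurable_funM.
- by move=> z; rewrite mule_ge0// lee_fin gauss_density_ge0.
rewrite (@ge0_integral_law _ _ _ _ _ (@lebesgue_sf n \x @lebesgue_measure R)%E
  (lebesgue_rV R n.+1) _ (@mcons n)) //.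
- apply: eq_integral => -[v x] _; rewrite /h /= -muleA -EFinM; congr (_ * _%:E)%E.
  rewrite /gauss_density [in RHS]big_ord_recl rV_cons0; congr (_ * _).
  by apply: eq_bigr => i _; rewrite rV_consS.
- apply: emeasurable_funM => //; apply/measurable_EFinP.
  exact: measurable_gauss_density.
- by move=> z; rewrite mule_ge0// lee_fin gauss_density_ge0.
Qed.

End gauss_rV.

(** * Hermite polynomials in several variables *)

Section hermite_polynomials.
Context {R : realType}.
Local Notation H := (@hermite R).

Lemma deriv_hermite k : (H k)^`() = k%:R *: H k.-1.
Proof.
elim: k => [|k IH]; first by rewrite /= derivC scale0r.
rewrite [H k.+1]/= derivB derivM derivX mul1r IH derivZ.
case: k IH => [|k] IH; first by rewrite !scale0r mulr0 subr0 addr0 scale1r.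
rewrite [H k.+1.-1]/= -addrA -scalerAr -scalerBr.
by rewrite -[k.+2%:R]natr1 scalerDl scale1r addrC.
Qed.

Lemma stein_mulX (q : {poly R}) :
  \int[stdn]_x (x * q.[x]) = \int[stdn]_x q^`().[x].
Proof.
have := stein q.
under eq_Rintegral do rewrite hornerD hornerN.
rewrite RintB; [|exact: integr_horner_stdn|exact: integr_horner_stdn].
move=> /eqP; rewrite subr_eq0 => /eqP ->.
by under [RHS]eq_Rintegral do rewrite hornerM hornerX.
Qed.

(** By Stein's identity, X - d/dx is the adjoint of d/dx for the Gaussian measure, and it maps H_k
    to H_(k+1). *)
Lemma Rint_hermiteS k (q : {poly R}) :
  \int[stdn]_x ((H k.+1).[x] * q.[x]) = \int[stdn]_x ((H k).[x] * q^`().[x]).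
Proof.
have := stein_mulX (H k * q); rewrite derivM => E.
under eq_Rintegral do rewrite /= hornerD hornerN hornerM hornerX mulrBl -mulrA -hornerM -[X in _ - X]hornerM.
rewrite RintB; last 2 first.
- have := integr_horner_stdn ('X * (H k * q)); congr integr.
  by apply/funext => x; rewrite [LHS]hornerM hornerX.
- exact: integr_horner_stdn.
rewrite E.
under eq_Rintegral do rewrite hornerD.
rewrite RintD; [|exact: integr_horner_stdn|exact: integr_horner_stdn].
by rewrite addrC addKr; under eq_Rintegral do rewrite hornerM.
Qed.

Lemma hermite_orthogonal j k :
  \int[stdn]_x ((H j).[x] * (H k).[x]) = (j == k)%:R * (k`!)%:R.
Proof.
have Hd i : \int[stdn]_x ((H i.+1).[x] * (H 0).[x]) = 0.
  rewrite Rint_hermiteS deriv_hermite scale0r.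
  by under eq_Rintegral do rewrite horner0 mulr0; rewrite Rintegral_cst// mul0r.
elim: j k => [|j IH] [|k].
- under eq_Rintegral do rewrite /= hornerC mulr1.
  by rewrite Rintegral_cst// !mul1r; exact: (congr1 fine (probability_setT (@stdn R))).
- by under eq_Rintegral do rewrite mulrC; rewrite Hd mul0r.
- by rewrite Hd mul0r.
- rewrite Rint_hermiteS deriv_hermite eqSS.
  under eq_Rintegral do rewrite hornerZ mulrCA.
  rewrite RintZ; last first.
    have := integr_horner_stdn (H j * H k); congr integr.
    by apply/funext => x; rewrite hornerM.
  by rewrite IH factS natrM mulrCA.
Qed.

(** Strong induction along H_(k+1) = X H_k - H_k'. Stein's identity in w turns s w H_k into s^2
    H_k', and s^2 - 1 = - r^2 rebuilds the recurrence at z. *)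
Lemma mehler_hermite (r s z : R) k : r ^+ 2 + s ^+ 2 = 1 ->
  \int[stdn]_w (H k).[r * z + s * w] = r ^+ k * (H k).[z].
Proof.
move=> rs; pose l : {poly R} := (r * z)%:P + s *: 'X.
have le w : l.[w] = r * z + s * w by rewrite /l hornerD hornerC hornerZ hornerX.
have ic q : integr (@stdn R) (fun w : R => q.[r * z + s * w]).
  have := integr_horner_stdn (q \Po l); congr integr.
  by apply/funext => w; rewrite horner_comp le.
have st q : \int[stdn]_w (w * q.[r * z + s * w]) =
    s * \int[stdn]_w q^`().[r * z + s * w].
  rewrite -RintZ//.
  under eq_Rintegral do rewrite -le -horner_comp.
  rewrite stein_mulX; apply: eq_Rintegral => w _.
  rewrite deriv_comp hornerM horner_comp le mulrC; congr (_ * _).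
  by rewrite /l derivD derivC add0r derivZ derivX hornerZ hornerC mulr1.
elim/ltn_ind: k => -[|k] IH.
  under eq_Rintegral do rewrite hornerC.
  rewrite Rintegral_cst// hornerC expr0 !mul1r.
  exact: (congr1 fine (probability_setT (@stdn R))).
have E w : (H k.+1).[r * z + s * w] = r * z * (H k).[r * z + s * w] +
    (s * (w * (H k).[r * z + s * w]) - (H k)^`().[r * z + s * w]).
  by rewrite /= hornerD hornerN hornerM hornerX; ring.
under eq_Rintegral do rewrite E.
have iw : integr (@stdn R) (fun w : R => w * (H k).[r * z + s * w]).
  have := integr_horner_stdn ('X * (H k \Po l)); congr integr.
  by apply/funext => w; rewrite hornerM hornerX horner_comp le.
rewrite RintD; [|exact: integrZ|by apply: integrB => //; exact: integrZ].
rewrite RintB//; last exact: integrZ.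
rewrite !RintZ// st IH//.
rewrite [H k.+1]/= hornerD hornerN hornerM hornerX deriv_hermite hornerZ.
under eq_Rintegral do rewrite hornerZ.
rewrite RintZ//.
case: k IH E iw => [|k] IH E iw; first by rewrite !mul0r !mulr0; ring.
rewrite IH//= !exprS.
have -> : s * (s * (k.+1%:R * (r ^+ k * (H k).[z]))) -
  k.+1%:R * (r ^+ k * (H k).[z]) =
  - ((1 - s ^+ 2) * (k.+1%:R * (r ^+ k * (H k).[z]))) by ring.
by rewrite -rs; ring.
Qed.

End hermite_polynomials.

Section hermite_products.
Context {R : realType} {p : nat}.
Implicit Types m : 'I_p -> nat.

(** Unlike in [hermite_prod], the multi-index is an unbounded function, so that its entries can be
    raised and lowered within one type; [idx] translates between the two. *)
Definition hprod m (x : 'rV[R]_p) : R := \prod_i (hermite (m i)).[x ord0 i].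

Definition degree m := (\sum_i m i)%N.

Let integr_hermiteM m m' i :
  integr (@stdn R) (fun u : R => (hermite (m i)).[u] * (hermite (m' i)).[u]).
Proof.
have := integr_horner_stdn (hermite (m i) * hermite (m' i) : {poly R}).
by congr integr; apply/funext => u; rewrite hornerM.
Qed.

Lemma integr_hprodM m m' : integr (gauss_rV R p) (fun x => hprod m x * hprod m' x).
Proof.
have [h _] := gauss_rV_prod (@integr_hermiteM m m').
by move: h; congr integr; apply/funext => x; rewrite big_split.
Qed.

Lemma measurable_hprod m : measurable_fun setT (hprod m).
Proof.
apply: measurable_prod => i _; apply: measurableT_comp.
  exact: measurable_horner.
exact: measurable_coord_rV.
Qed.

Lemma sqi_hprod m : sqi (gauss_rV R p) (hprod m).
Proof. by split; [exact: measurable_hprod|exact: integr_hprodM]. Qed.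

Lemma hprod_orthogonal m m' : \int[gauss_rV R p]_x (hprod m x * hprod m' x) =
  [forall i, m i == m' i]%:R * (\prod_i (m i)`!)%:R.
Proof.
have [_ h] := gauss_rV_prod (@integr_hermiteM m m').
transitivity (\prod_i \int[@stdn R]_x ((hermite (m i)).[x] * (hermite (m' i)).[x])).
  by rewrite -h; apply: eq_Rintegral => x _; rewrite big_split.
under eq_bigr do rewrite hermite_orthogonal.
have [mm|] := boolP [forall i, m i == m' i].
  rewrite mul1r natr_prod; apply: eq_bigr => i _.
  by rewrite -(eqP (forallP mm i)) eqxx mul1r.
rewrite negb_forall => /existsP[i mi].
by rewrite mul0r (bigD1 i)//= (negbTE mi) !mul0r.
Qed.

Lemma mehler_hprod (r s : R) m (z : 'rV[R]_p) : r ^+ 2 + s ^+ 2 = 1 ->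
  \int[gauss_rV R p]_w hprod m (r *: z + s *: w) = r ^+ degree m * hprod m z.
Proof.
move=> rs.
have i1 i : integr (@stdn R) (fun u : R => (hermite (m i)).[r * z ord0 i + s * u]).
  have := integr_horner_stdn (hermite (m i) \Po ((r * z ord0 i)%:P + s *: 'X)).
  congr integr; apply/funext => u.
  by rewrite horner_comp hornerD hornerC hornerZ hornerX.
have [_ h] := gauss_rV_prod i1.
transitivity (\prod_i \int[@stdn R]_u (hermite (m i)).[r * z ord0 i + s * u]).
  rewrite -h; apply: eq_Rintegral => x _.
  by apply: eq_bigr => i _; rewrite !mxE.
under eq_bigr do rewrite mehler_hermite//.
by rewrite big_split /degree /= -expr_sum.
Qed.

Lemma eq_hprod m m' : m =1 m' -> hprod m = hprod m'.
Proof. by move=> mm; apply/funext => x; apply: eq_bigr => i _; rewrite mm. Qed.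

Definition shift_up m j i := (m i + (i == j))%N.
Definition shift_down m j i := (m i - (i == j))%N.

(** The recurrence x H_k = H_(k+1) + k H_(k-1) in coordinate j. When m j = 0 the truncated
    subtraction in [shift_down] does no harm, its coefficient being 0. *)
Lemma hprod_coord m j (x : 'rV[R]_p) :
  x ord0 j * hprod m x = hprod (shift_up m j) x + (m j)%:R * hprod (shift_down m j) x.
Proof.
rewrite /hprod (bigD1 j)//= [in RHS](bigD1 j)//= [X in _ = _ + _ * X](bigD1 j)//=.
rewrite /shift_up /shift_down eqxx addn1 subn1.
have -> : \prod_(i < p | i != j) (hermite (m i + (i == j))).[x ord0 i] =
    \prod_(i < p | i != j) (hermite (m i)).[x ord0 i].
  by apply: eq_bigr => i /negbTE ->; rewrite addn0.
have -> : \prod_(i < p | i != j) (hermite (m i - (i == j))).[x ord0 i] =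
    \prod_(i < p | i != j) (hermite (m i)).[x ord0 i].
  by apply: eq_bigr => i /negbTE ->; rewrite subn0.
rewrite /= hornerD hornerN hornerM hornerX deriv_hermite hornerZ; ring.
Qed.

Lemma degree_shift_up m j : degree (shift_up m j) = (degree m).+1.
Proof.
rewrite /degree /shift_up big_split /= -addn1; congr addn.
by rewrite (bigD1 j)//= eqxx big1 // => i /negbTE ->.
Qed.

Lemma degree_shift_down m j : (degree (shift_down m j) <= degree m)%N.
Proof. by apply: leq_sum => i _; exact: leq_subr. Qed.

(** The polynomials of degree less than N, generated one Hermite product at a time so that linear
    identities go by induction. The strict bound matches sums over l < N. *)
Inductive hspan (N : nat) : ('rV[R]_p -> R) -> Prop :=
| hspan0 : hspan N (fun=> 0)
| hspanS a m f : (degree m < N)%N -> hspan N f ->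
    hspan N (fun x => a * hprod m x + f x).

Lemma hspan_le N N' f : (N <= N')%N -> hspan N f -> hspan N' f.
Proof.
move=> NN; elim => [|a m {}f mN _ IH]; first exact: hspan0.
by apply: hspanS => //; exact: leq_trans mN NN.
Qed.

Lemma hspanD N f g : hspan N f -> hspan N g -> hspan N (fun x => f x + g x).
Proof.
move=> hf hg; elim: hf => [|a m {}f mN _ IH].
  by under eq_fun do rewrite add0r.
by under eq_fun do rewrite -addrA; exact: hspanS.
Qed.

Lemma hspanZ N k f : hspan N f -> hspan N (fun x => k * f x).
Proof.
elim => [|a m {}f mN _ IH]; first by under eq_fun do rewrite mulr0; exact: hspan0.
by under eq_fun do rewrite mulrDr mulrA; exact: hspanS.
Qed.

Lemma hspan_sum N I (s : seq I) (P : pred I) (F : I -> 'rV[R]_p -> R) :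
  (forall i, P i -> hspan N (F i)) -> hspan N (fun x => \sum_(i <- s | P i) F i x).
Proof.
move=> iF; elim: s => [|i s IH].
  by under eq_fun do rewrite big_nil; exact: hspan0.
have [Pi|Pi] := boolP (P i).
  by under eq_fun do rewrite big_cons Pi; apply: hspanD => //; exact: iF.
by under eq_fun do rewrite big_cons (negbTE Pi).
Qed.

Lemma hspan_hprod N m : (degree m < N)%N -> hspan N (hprod m).
Proof.
move=> mN; have := hspanS 1 mN (hspan0 N); congr hspan.
by apply/funext => x; rewrite mul1r addr0.
Qed.

Lemma hspan1 : hspan 1 (fun=> 1).
Proof.
have := @hspan_hprod 1 (fun=> 0%N) _; rewrite /degree big1// => /(_ isT).
by congr hspan; apply/funext => x; rewrite /hprod big1// => i _; rewrite hornerC.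
Qed.

Lemma hspan_coord N j f : hspan N f -> hspan N.+1 (fun x => x ord0 j * f x).
Proof.
elim => [|a m {}f mN _ IH]; first by under eq_fun do rewrite mulr0; exact: hspan0.
have -> : (fun x : 'rV[R]_p => x ord0 j * (a * hprod m x + f x)) =
    fun x => a * hprod (shift_up m j) x +
      ((a * (m j)%:R) * hprod (shift_down m j) x + x ord0 j * f x).
  apply/funext => x; rewrite mulrDr mulrCA hprod_coord; ring.
apply: hspanS; first by rewrite degree_shift_up.
apply: hspanS => //; apply: leq_ltn_trans (degree_shift_down m j) _.
exact: ltn_trans mN _.
Qed.

Lemma hspan_lformX (t : 'rV[R]_p) c k : hspan k.+1 (fun x => (lform t x + c) ^+ k).
Proof.
elim: k => [|k IH]; first by under eq_fun do rewrite expr0; exact: hspan1.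
have -> : (fun x => (lform t x + c) ^+ k.+1) =
    fun x => \sum_i t ord0 i * (x ord0 i * (lform t x + c) ^+ k) +
      c * (lform t x + c) ^+ k.
  apply/funext => x; rewrite exprS mulrDl; congr (_ + _).
  by rewrite /lform mulr_suml; apply: eq_bigr => i _; rewrite mulrA.
apply: hspanD; last by apply: hspanZ; exact: hspan_le IH.
by apply: hspan_sum => i _; apply: hspanZ; exact: hspan_coord.
Qed.

Lemma sqi_hspan N f : hspan N f -> sqi (gauss_rV R p) f.
Proof.
elim => [|a m {}f mN _ IH]; first exact: sqi0.
by apply: sqiD => //; apply: sqiZ; exact: sqi_hprod.
Qed.

End hermite_products.

(** * Density of the polynomials in Gaussian L^2 *)

Section hermite_density.
Context {R : realType} {p : nat}.
Local Notation gam := (gauss_rV R p).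

Definition hermite_approx (f : 'rV[R]_p -> R) :=
  forall e : R, 0 < e -> exists N q, hspan N q /\ \int[gam]_x ((f x - q x) ^+ 2) <= e.

Lemma Rint_sq_cvg0 (f_ : nat -> 'rV[R]_p -> R) (f g : 'rV[R]_p -> R) :
  (forall n, measurable_fun setT (f_ n)) -> measurable_fun setT f ->
  (forall x, f_ n x @[n --> \oo] --> f x) ->
  integr gam g -> (forall n x, (f x - f_ n x) ^+ 2 <= g x) ->
  forall e : R, 0 < e -> exists n, \int[gam]_x ((f x - f_ n x) ^+ 2) <= e.
Proof.
move=> mf_ mf ff ig fg e e0.
have [||||_ cv] := @Rint_dominated _ _ _ gam (fun n x => (f x - f_ n x) ^+ 2) (fun=> 0) g.
- by move=> n; apply: measurable_funX; exact: measurable_funB.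
- move=> x; rewrite -[X in _ --> X](expr0n R 2) -[X in X ^+ 2](subrr (f x)).
  by apply: (@cvg_comp _ _ _ _ (fun y : R => y ^+ 2));
    [apply: cvgB; [exact: cvg_cst|exact: ff]|exact: sqr_continuous].
- exact: ig.
- by move=> n x; rewrite ger0_norm ?sqr_ge0.
move: cv; rewrite Rintegral_cst// mul0r => /cvgr0Pnorm_le /(_ _ e0) [n _ hn].
by exists n; apply: le_trans (hn n (leqnn n)); rewrite ler_norm.
Qed.

Lemma hermite_approx_lim (f_ : nat -> 'rV[R]_p -> R) (f g : 'rV[R]_p -> R) :
  (forall n, sqi gam (f_ n) /\ hermite_approx (f_ n)) -> sqi gam f ->
  (forall x, f_ n x @[n --> \oo] --> f x) ->
  integr gam g -> (forall n x, (f x - f_ n x) ^+ 2 <= g x) -> hermite_approx f.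
Proof.
move=> hf sf ff ig fg e e0.
(* (u + v)^2 <= 2 u^2 + 2 v^2 turns two errors of e / 4 into e. *)
have e4 : 0 < e / 4 by rewrite divr_gt0.
have [|n hn] := Rint_sq_cvg0 _ (proj1 sf) ff ig fg e4; first by move=> n; case: (hf n) => -[].
have [sfn /(_ _ e4) [N [q [sq hq]]]] := hf n.
exists N, q; split => //.
have := Rint_sqD_le (sqiB sf sfn) (sqiB sfn (sqi_hspan sq)).
under eq_Rintegral => x _ do rewrite subrKA.
lra.
Qed.

Lemma integr_expR_lform (t : 'rV[R]_p) c k : 0 <= k ->
  integr gam (fun x => expR (k * `|lform t x + c|)).
Proof.
move=> k0.
have [h _] := @gauss_rV_prod R p (fun i (u : R) => expR (k * `|t ord0 i| * `|u|))
  (fun i => integr_expR_abs_stdn _).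
apply: le_integr (integrZ (expR (k * `|c|)) h) _.
  apply: measurableT_comp => //; apply: measurable_funM => //.
  apply: measurableT_comp => //; apply: measurable_funD => //.
  exact: measurable_lform.
move=> x; rewrite ger0_norm ?expR_ge0// -expR_sum -expRD ler_expR.
rewrite (le_trans (y := k * (`|c| + \sum_i `|t ord0 i| * `|x ord0 i|)))//.
  apply: ler_wpM2l => //; rewrite addrC (le_trans (ler_normD _ _))// lerD//.
  apply: le_trans (ler_norm_sum _ _ _) _.
  by apply: ler_sum => i _; rewrite normrM.
by rewrite mulrDr mulr_sumr lerD// ler_sum// => i _; rewrite mulrA.
Qed.

(** The Taylor polynomials of the cosine converge pointwise, and exponential moments of linear forms
    dominate their squared errors. *)
Lemma hermite_approx_cos (t : 'rV[R]_p) c :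
  hermite_approx (fun x => cos (lform t x + c)).
Proof.
pose P n x := \sum_(0 <= k < n) cos_coeff' (lform t x + c) k.
have hP n : hspan n.*2.+1 (P n).
  rewrite /P; have -> : (fun x => \sum_(0 <= k < n) cos_coeff' (lform t x + c) k) =
      fun x => \sum_(k < n) (-1) ^+ k / k.*2`!%:R * (lform t x + c) ^+ k.*2.
    by apply/funext => x; rewrite big_mkord; apply: eq_bigr => k _; rewrite /cos_coeff' mulrAC.
  apply: hspan_sum => k _; apply: hspanZ; apply: hspan_le (hspan_lformX _ _ _).
  by rewrite ltnS leq_double ltnW.
have mc : measurable_fun setT (fun x : 'rV[R]_p => cos (lform t x + c)).
  apply: measurableT_comp => //; first exact: (continuous_measurable_fun (@continuous_cos R)).
  by apply: measurable_funD => //; exact: measurable_lform.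
move=> e e0.
(* |cos u - P n| <= 1 + exp |u| <= 2 exp |u|, whose square is the dominating function. *)
have [||||n hn] := @Rint_sq_cvg0 P (fun x => cos (lform t x + c))
  (fun x => 4 * expR (2 * `|lform t x + c|)) _ mc _ _ _ e e0.
- by move=> n; case: (sqi_hspan (hP n)).
- by move=> x; exact: cvg_cos_coeff'.
- by apply: integrZ; exact: integr_expR_lform.
- move=> n x; set u := lform t x + c.
  have -> : expR (2 * `|u|) = expR `|u| ^+ 2 by rewrite -expRM_natl.
  have E1 : 1 <= expR `|u| by rewrite -[leLHS]expR0 ler_expR.
  have := cos_coeff'_sum_le u n; rewrite -/(P n x) ler_norml => /andP[h1 h2].
  have := cos_geN1 u; have := cos_le1 u => h3 h4.
  have h5 : `|cos u - P n x| <= 2 * expR `|u|.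
    by rewrite ler_norml; apply/andP; split; lra.
  rewrite -real_normK ?num_real//.
  have -> : 4 * expR `|u| ^+ 2 = (2 * expR `|u|) ^+ 2 by ring.
  by rewrite lerXn2r// nnegrE// mulr_ge0// expR_ge0.
exists n.*2.+1, (P n); split => //.
Qed.

Lemma hermite_approx_bounded (f : 'rV[R]_p -> R) (M : R) : measurable_fun setT f ->
  (forall x, `|f x| <= M) -> hermite_approx f.
Proof.
move=> mf fM; suff : sqi gam f /\ hermite_approx f by case.
have sbound (h : 'rV[R]_p -> R) (N : R) : measurable_fun setT h ->
  (forall x, `|h x| <= N) -> sqi gam h by exact: sqi_bounded.
apply: (@trig_class _ _ (fun f => sqi gam f /\ hermite_approx f) _ _ _ f M mf fM) => {f M mf fM}.
- move=> a f g [sf hf] [sg hg]; split; first by apply: sqiD => //; exact: sqiZ.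
  move=> e e0.
  (* The divisor a^2 + 1 absorbs the factor a^2 of the scaled error and is never 0. *)
  have e1 : 0 < e / 4 / (a ^+ 2 + 1).
    by rewrite !divr_gt0// ltr_wpDl// sqr_ge0.
  have e2 : 0 < e / 4 by rewrite divr_gt0.
  have [N1 [q1 [hq1 le1]]] := hf _ e1; have [N2 [q2 [hq2 le2]]] := hg _ e2.
  exists (maxn N1 N2), (fun x => a * q1 x + q2 x); split.
    apply: hspanD; first by apply: hspanZ; apply: hspan_le hq1; exact: leq_maxl.
    by apply: hspan_le hq2; exact: leq_maxr.
  have s1 := sqiB sf (sqi_hspan hq1); have s2 := sqiB sg (sqi_hspan hq2).
  have := Rint_sqD_le (sqiZ a s1) s2.
  have -> : (fun x => (a * (f x - q1 x) + (g x - q2 x)) ^+ 2) =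
      fun x => (a * f x + g x - (a * q1 x + q2 x)) ^+ 2.
    by apply/funext => x; congr (_ ^+ 2); ring.
  have -> : (fun x => (a * (f x - q1 x)) ^+ 2) = fun x => a ^+ 2 * (f x - q1 x) ^+ 2.
    by apply/funext => x; rewrite exprMn.
  rewrite RintZ; last by case: s1.
  have h1 : a ^+ 2 * (\int[gam]_x ((f x - q1 x) ^+ 2)) <= e / 4.
    move: le1; rewrite ler_pdivlMr; last by rewrite ltr_wpDl// sqr_ge0.
    by have := Rint_sq_ge0 gam (fun x => f x - q1 x); lra.
  lra.
- move=> f_ f M hf fM' ff.
  have fMf x : `|f x| <= M.
    by apply: (cvgr_to_le (cvg_norm (ff x))); apply: nearW => n; exact: fM'.
  have mf' : measurable_fun setT f.
    apply: (measurable_fun_cvg (h := f_)) => [n|x _]; last exact: ff.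
    by case: (hf n) => -[].
  have sf := sbound _ _ mf' fMf; split => //.
  apply: (@hermite_approx_lim f_ f (cst ((M + M) ^+ 2)) hf sf ff).
    exact: integr_cst.
  move=> n x; rewrite -real_normK ?num_real// lerXn2r ?nnegrE//.
    by rewrite addr_ge0// (le_trans (normr_ge0 _) (fMf x)).
  by rewrite (le_trans (ler_normB _ _))// lerD.
- move=> t c; split; last exact: hermite_approx_cos.
  apply: (sbound _ 1); last by move=> x; rewrite ler_norml cos_geN1 cos_le1.
  apply: measurableT_comp => //; first exact: (continuous_measurable_fun (@continuous_cos R)).
  by apply: measurable_funD => //; exact: measurable_lform.
Qed.

(** Truncating f where |f| exceeds n leaves a squared error of at most f^2, so dominated convergence
    reduces the claim to bounded functions. *)
Lemma hermite_approx_sqi (f : 'rV[R]_p -> R) : sqi gam f -> hermite_approx f.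
Proof.
move=> sf; have [mf if2] := sf.
pose f_ (n : nat) x := f x * \1_[set y | `|f y| <= n%:R] x.
have mA (n : nat) : measurable [set y : 'rV[R]_p | `|f y| <= n%:R].
  rewrite (_ : [set _ | _] = (fun y => `|f y|) @^-1` `]-oo, n%:R]%classic).
    rewrite -[X in measurable X]setTI; exact: (measurableT_comp (@normr_measurable R setT) mf).
  by apply/seteqP; split => y; rewrite /= in_itv.
have mf_ n : measurable_fun setT (f_ n).
  by apply: measurable_funM => //; exact: measurable_indic.
have bf_ n x : `|f_ n x| <= n%:R.
  rewrite /f_ indicE; case: (boolP (x \in _)) => [|_]; last by rewrite mulr0 normr0.
  by rewrite inE /= mulr1.
apply: (@hermite_approx_lim f_ f (fun x => f x ^+ 2)) => //.
- by move=> n; split; [exact: (sqi_bounded _ (mf_ n) (bf_ n))|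
    exact: (hermite_approx_bounded (mf_ n) (bf_ n))].
- move=> x; apply: cvg_near_cst; exists (Num.truncn `|f x|).+1 => //= n /= fn.
  apply/eqP; rewrite /f_ indicE mem_set ?mulr1//=.
  by apply: le_trans (ltW (truncnS_gt _)) _; rewrite ler_nat.
- move=> n x; rewrite /f_ indicE; case: (_ \in _).
    by rewrite mulr1 subrr expr0n sqr_ge0.
  by rewrite mulr0 subr0.
Qed.

End hermite_density.

(** * Pairs of Gaussian vectors *)

Section affine.
Context {R : realType}.
Local Notation leb := (@lebesgue_measure R).

(** Scaled by a, the image of Lebesgue measure under x -> a x + b agrees with Lebesgue measure on
    half-open intervals. *)
Lemma ge0_integral_affine (a b : R) (f : R -> \bar R) : 0 < a ->
  measurable_fun setT f -> (forall x, (0 <= f x)%E) ->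
  (\int[leb]_x f x = a%:E * \int[leb]_x f (a * x + b)%R)%E.
Proof.
move=> a0 mf f0.
pose h : R -> measurableTypeR R := fun x => a * x + b.
have mh : @measurable_fun _ _ (measurableTypeR R) (measurableTypeR R) setT h.
  by apply: measurable_funD => //; exact: measurable_funM.
pose c : {nonneg R} := NngNum (ltW a0).
pose m : {measure set (measurableTypeR R) -> \bar R} := mscale c
  (measure_function_pushforward__canonical__measure_function_Measure leb mh).
have E A : measurable A -> leb A = m A.
  apply: (@lebesgue_measure_unique R m) => _ [[u v]] _ <-.
  transitivity (a%:E * leb (h @^-1` `]u, v]%classic))%E; last by [].
  have -> : h @^-1` `]u, v]%classic = `](u - b) / a, (v - b) / a]%classic.
    apply/seteqP; split => x; rewrite /= !in_itv/= ltr_pdivrMr// ler_pdivlMr// mulrC;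
    by rewrite ltrBlDr lerBrDr.
  rewrite !lebesgue_measure_itv/= !lte_fin ltr_pM2r ?invr_gt0// ltrD2r.
  case: ifPn => _; last by rewrite mule0.
  by rewrite -!EFinD -EFinM; congr EFin; field; rewrite gt_eqF.
rewrite (eq_measure_integral m); last by move=> A mA _; exact: E.
rewrite ge0_integral_mscale//; congr (_ * _)%E.
by rewrite ge0_integral_pushforward// preimage_setT.
Qed.

Lemma normal_prob_affine (m s : R) (A : set R) : 0 < s -> measurable A ->
  normal_prob m s A = stdn [set x | A (m + s * x)].
Proof.
move=> s0 mA; have sn0 : s != 0 by rewrite gt_eqF.
have mA' : measurable [set x : R | A (m + s * x)].
  rewrite -[X in measurable X]setTI.
  have mh : measurable_fun setT (fun x : R => m + s * x).
    by apply: measurable_funD => //; exact: measurable_funM.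
  exact: mh.
transitivity (normal_prob 0 1 [set x | A (m + s * x)]); last by [].
rewrite [LHS]/normal_prob [RHS]/normal_prob integral_mkcond.
have mpat : measurable_fun setT ((fun x : R => (normal_pdf m s x)%:E) \_ A).
  apply/(measurable_restrictT _ mA); apply: measurable_funTS.
  by apply/measurable_EFinP; exact: measurable_normal_pdf.
have mh : measurable_fun setT (fun x : R => s * x + m).
  by apply: measurable_funD => //; exact: measurable_funM.
rewrite (@ge0_integral_affine s m)//; last first.
  by move=> x; rewrite patchE; case: ifPn => // _; rewrite lee_fin normal_pdf_ge0.
rewrite [in RHS]integral_mkcond -ge0_integralZl//; last 3 first.
- exact: (measurableT_comp mpat mh).
- by move=> x _; rewrite patchE; case: ifPn => // _; rewrite lee_fin normal_pdf_ge0.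
- by rewrite lee_fin ltW.
apply: eq_integral => x _; rewrite !patchE addrC.
have -> : (x \in [set x | A (m + s * x)]) = (m + s * x \in A).
  by apply/idP/idP; rewrite !inE.
case: ifPn => _; last by rewrite mule0.
rewrite -EFinM; congr EFin.
rewrite !normal_pdfE ?oner_eq0// /normal_peak /normal_fun expr1n mul1r subr0.
rewrite addrAC subrr add0r -(mulrnAr (s ^+ 2)) sqrtrM ?sqr_ge0// sqrtr_sqr gtr0_norm//.
rewrite invfM !mulrA divff// mul1r; congr (_ * expR _).
by field.
Qed.

End affine.

Section gaussian_characteristic.
Context d (Omega : measurableType d) (R : realType) (P : probability Omega R).

(** [gaussian_rv] leaves the parameters unknown; the first two moments identify them as m = 0 and
    s^2 = v. *)
Lemma characteristic_gaussian (X : Omega -> R) (v c : R) : measurable_fun setT X ->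
  gaussian_rv P X -> 'E_P[X]%E = 0%E -> 'E_P[(fun o => X o ^+ 2)%R]%E = v%:E ->
  \int[P]_o cos (X o + c) = expR (- (v / 2)) * cos c.
Proof.
move=> mX [m [s [s0 lawX]]] EX EX2.
(* A degenerate law is also the image of the standard normal one under x -> m + s x, with s = 0;
   after this step the two cases are treated as one. *)
have key : exists (Q : probability (measurableTypeR R) R) (h : R -> R),
    [/\ measurable_fun setT h, h = (fun x => m + s * x),
      forall A, measurable A -> P (X @^-1` A) = Q (h @^-1` A) &
    [/\ integr Q (fun x : R => x), integr Q (fun x : R => x ^+ 2),
      \int[Q]_x x = 0, \int[Q]_x (x ^+ 2) = 1 &
      forall c, \int[Q]_x cos (s * x + c) = expR (- (s ^+ 2 / 2)) * cos c]].
  exists (@stdn R), (fun x => m + s * x).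
  have mh : measurable_fun setT (fun x : R => m + s * x).
    by apply: measurable_funD => //; exact: measurable_funM.
  split => //.
    move=> A mA; rewrite lawX//; have [->|sn0] := eqVneq s 0.
      rewrite diracE; have [mA'|mA'] := boolP (m \in A).
        rewrite (_ : _ @^-1` A = setT); last first.
          by apply/seteqP; split => x //= _; rewrite mul0r addr0; exact: set_mem.
        exact/esym/(probability_setT (@stdn R)).
      rewrite (_ : _ @^-1` A = set0) ?measure0//.
      apply/seteqP; split => x //=; rewrite mul0r addr0 => Am.
      by move: mA'; rewrite notin_setE.
    by rewrite normal_prob_affine// lt_neqAle eq_sym sn0.
  have i1 : integr (@stdn R) (fun x : R => x).
    have := integr_horner_stdn ('X : {poly R}).
    by congr integr; apply/funext => x; rewrite hornerX.
  have i2 : integr (@stdn R) (fun x : R => x ^+ 2).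
    have := integr_horner_stdn ('X^2 : {poly R}).
    by congr integr; apply/funext => x; rewrite hornerXn.
  split => //.
  - have := @stein_mulX R 1.
    under eq_Rintegral do rewrite hornerC mulr1.
    by move=> ->; rewrite derivC; under eq_Rintegral do rewrite horner0; rewrite Rintegral_cst// mul0r.
  - have := @stein_mulX R 'X.
    under eq_Rintegral do rewrite hornerX.
    move=> ->; rewrite derivX; under eq_Rintegral do rewrite hornerC.
    by rewrite Rintegral_cst// mul1r; exact: (congr1 fine (probability_setT (@stdn R))).
  - by move=> a; exact: characteristic_stdn.
have {key} [Q [h [mh hE lawXQ [i1 i2 E1 E2 Ec]]]] := key.
pose hM : {mfun measurableTypeR R >-> measurableTypeR R} :=
  HB.pack_for {mfun measurableTypeR R >-> measurableTypeR R} h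
    (@isMeasurableFun.Build _ _ (measurableTypeR R) (measurableTypeR R) h mh).
pose nu : probability (measurableTypeR R) R := distribution Q hM.
have nuX A : measurable A -> nu A = P (X @^-1` A) by move=> mA; rewrite lawXQ.
have nuh A : measurable A -> nu A = Q (h @^-1` A) by [].
have mh' : @measurable_fun _ _ (measurableTypeR R) (measurableTypeR R) setT h := mh.
have mX' : @measurable_fun _ _ Omega (measurableTypeR R) setT X := mX.
have tr (f : R -> R) : measurable_fun setT f -> integr Q (f \o h) ->
    integr P (f \o X) /\ \int[P]_o f (X o) = \int[Q]_x f (h x).
  move=> mf iQ.
  have mf' : @measurable_fun _ _ (measurableTypeR R) (measurableTypeR R) setT f := mf.
  have inu := (integr_law mh' nuh mf').2 iQ.
  have iP := (integr_law mX' nuX mf').1 inu; split => //.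
  by rewrite -(Rint_law mX' nuX mf' iP) (Rint_law mh' nuh mf' iQ).
have iQ1 : integr Q (fun x : R => s * x) by exact: integrZ.
have iQ2 : integr Q (fun x : R => s ^+ 2 * x ^+ 2) by exact: integrZ.
have m0 : m = 0.
  have ih : integr Q (id \o h) by rewrite hE; exact: (integrD (integr_cst Q m) iQ1).
  have [iX E] := tr id (@measurable_id _ _ _) ih.
  have : \int[P]_o X o = 0 by move: EX; rewrite unlock /Rintegral => ->.
  rewrite E hE RintD//; last exact: integr_cst.
  rewrite Rintegral_cst// RintZ// E1 mulr0 addr0.
  by rewrite (congr1 fine (probability_setT Q)) mulr1.
have hE' : h = fun x => s * x by rewrite hE m0; apply/funext => x; rewrite add0r.
have s2 : s ^+ 2 = v.
  have i2' : integr Q ((fun x => x ^+ 2) \o h).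
    by move: iQ2; congr integr; apply/funext => x; rewrite /= hE' exprMn.
  have [iX E] := tr (fun x => x ^+ 2) (measurable_funX _ (@measurable_id _ _ _)) i2'.
  have : \int[P]_o (X o ^+ 2) = v by move: EX2; rewrite unlock /Rintegral => ->.
  rewrite E hE'; under eq_Rintegral do rewrite exprMn.
  by rewrite RintZ// E2 mulr1.
have mcos : measurable_fun setT (fun x : R => cos (x + c)).
  apply: measurableT_comp; first exact: (continuous_measurable_fun (@continuous_cos R)).
  exact: measurable_funD.
have icos : integr Q ((fun x : R => cos (x + c)) \o h).
  apply: (@integr_bounded _ _ _ _ _ 1); first exact: measurableT_comp.
  by move=> x; rewrite ler_norml cos_geN1 cos_le1.
have [_ ->] := tr _ mcos icos.
by rewrite hE' Ec s2.
Qed.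

End gaussian_characteristic.

Section horner_affine.
Context {R : realType}.

Lemma integr_horner_affine (q : {poly R}) (a b : R) :
  integr (@stdn R) (fun u : R => q.[a + b * u]).
Proof.
have := integr_horner_stdn (q \Po (a%:P + b *: 'X)); congr integr; apply/funext => u.
by rewrite horner_comp hornerD hornerC hornerZ hornerX.
Qed.

Lemma lformZ n a (t x : 'rV[R]_n) : lform (a *: t) x = a * lform t x.
Proof. by rewrite /lform mulr_sumr; apply: eq_bigr => i _; rewrite mxE mulrA. Qed.

Lemma lform_comb n a b (t x y : 'rV[R]_n) :
  lform t (a *: x + b *: y) = a * lform t x + b * lform t y.
Proof.
rewrite /lform !mulr_sumr -big_split/=; apply: eq_bigr => i _; rewrite !mxE; ring.
Qed.

End horner_affine.

(** * Characteristic functions determine laws *)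

Section law_uniqueness.
Context d1 d2 (O1 : measurableType d1) (O2 : measurableType d2) (R : realType)
  (P1 : probability O1 R) (P2 : probability O2 R) (n : nat).
Variables (X1 : O1 -> 'rV[R]_n) (X2 : O2 -> 'rV[R]_n).
Hypotheses (mX1 : measurable_fun setT X1) (mX2 : measurable_fun setT X2).
Hypothesis cosE : forall t c,
  \int[P1]_o cos (lform t (X1 o) + c) = \int[P2]_o cos (lform t (X2 o) + c).

(** The functions with equal expectations on both sides form a class to which [trig_class_indic]
    applies. Integrability is carried along because linearity of the integrals requires it. *)
Lemma eq_law_cos (A : set 'rV[R]_n) : measurable A -> P1 (X1 @^-1` A) = P2 (X2 @^-1` A).
Proof.
move=> mA.
have mcos t c : measurable_fun setT (fun x : 'rV[R]_n => cos (lform t x + c)).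
  apply: measurableT_comp; first exact: (continuous_measurable_fun (@continuous_cos R)).
  by apply: measurable_funD => //; exact: measurable_lform.
have [_ _] : [/\ integr P1 (\1_A \o X1), integr P2 (\1_A \o X2) &
    \int[P1]_o \1_A (X1 o) = \int[P2]_o \1_A (X2 o)].
  apply: (@trig_class_indic _ _ (fun f => [/\ integr P1 (f \o X1),
    integr P2 (f \o X2) & \int[P1]_o f (X1 o) = \int[P2]_o f (X2 o)])) => //.
  - move=> a f g [f1 f2 fE] [g1 g2 gE]; split.
    + by apply: integrD => //; exact: integrZ.
    + by apply: integrD => //; exact: integrZ.
    + by rewrite !RintD ?RintZ ?fE ?gE//; exact: integrZ.
  - move=> f_ f M hf fM ff.
    have [||||i1 c1] := @Rint_dominated _ _ _ P1 (fun n => f_ n \o X1) (f \o X1) (cst M).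
    + by move=> k; case: (hf k) => /integr_meas.
    + by move=> x; exact: ff.
    + exact: integr_cst.
    + by move=> k x; exact: fM.
    have [||||i2 c2] := @Rint_dominated _ _ _ P2 (fun n => f_ n \o X2) (f \o X2) (cst M).
    + by move=> k; case: (hf k) => _ /integr_meas.
    + by move=> x; exact: ff.
    + exact: integr_cst.
    + by move=> k x; exact: fM.
    split => //.
    suff c2' : \int[P1]_x (f_ n \o X1) x @[n --> \oo] --> \int[P2]_x (f \o X2) x.
      exact: (cvg_unique _ c1 c2').
    apply: cvg_trans c2; apply: near_eq_cvg; apply: nearW => k.
    by case: (hf k).
  - move=> t c; split.
    + apply: (@integr_bounded _ _ _ _ _ 1); first exact: measurableT_comp.
      by move=> x; rewrite ler_norml cos_geN1 cos_le1.
    + apply: (@integr_bounded _ _ _ _ _ 1); first exact: measurableT_comp.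
      by move=> x; rewrite ler_norml cos_geN1 cos_le1.
    + exact: cosE.
have ind d (O : measurableType d) (P : probability O R) (X : O -> 'rV[R]_n) :
    measurable_fun setT X -> (\int[P]_o \1_A (X o))%:E = P (X @^-1` A).
  move=> mX; have mXA : measurable (X @^-1` A) by rewrite -[X in measurable X]setTI; exact: mX.
  rewrite /Rintegral.
  have -> : (fun o => (\1_A (X o))%:E) = (fun o => (\1_(X @^-1` A) o : R)%:E).
    by apply/funext => o; rewrite !indicE; congr (_%:R%:E); apply/idP/idP; rewrite !inE.
  by rewrite integral_indic// setIT fineK// fin_num_measure.
by move=> E; rewrite -!ind// E.
Qed.

End law_uniqueness.

Section gaussian_pair.
Context d (Omega : measurableType d) (R : realType) (P : probability Omega R) (p : nat).
Local Notation gam := (gauss_rV R p).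
Variables (xi1 xi2 : Omega -> 'rV[R]_p) (r : R).
Hypotheses (mxi1 : measurable_fun setT xi1) (mxi2 : measurable_fun setT xi2).
Hypothesis r1 : `|r| <= 1.
Hypothesis xiE : forall t u c, \int[P]_o cos (lform t (xi1 o) + lform u (xi2 o) + c) =
  expR (- ((\sum_i t ord0 i ^+ 2 + \sum_i u ord0 i ^+ 2 + 2 * r * lform t u) / 2)) * cos c.

Lemma law_pair1 A : measurable A -> gam A = P (xi1 @^-1` A).
Proof.
move=> mA; apply/esym; apply: (@eq_law_cos _ _ _ _ _ P gam _ xi1 id) => // t c.
have := xiE t 0 c; under eq_Rintegral do rewrite lform0 addr0.
move=> ->; rewrite characteristic_gauss_rV; congr (expR _ * _).
rewrite [X in _ + X + _]big1 => [|i _]; last by rewrite mxE expr0n.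
have -> : lform t 0 = 0 by rewrite /lform big1// => i _; rewrite mxE mulr0.
by rewrite mulr0 !addr0.
Qed.

Lemma law_pair2 A : measurable A -> gam A = P (xi2 @^-1` A).
Proof.
move=> mA; apply/esym; apply: (@eq_law_cos _ _ _ _ _ P gam _ xi2 id) => // t c.
have := xiE 0 t c; under eq_Rintegral do rewrite lform0 add0r.
move=> ->; rewrite characteristic_gauss_rV; congr (expR _ * _).
rewrite [X in X + _ + _]big1 => [|i _]; last by rewrite mxE expr0n.
by rewrite lform0 mulr0 addr0 add0r.
Qed.

Let s := Num.sqrt (1 - r ^+ 2).

Let rs : r ^+ 2 + s ^+ 2 = 1.
Proof.
rewrite /s sqr_sqrtr; first by rewrite addrC subrK.
by rewrite subr_ge0 -real_normK ?num_real// expr_le1.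
Qed.

Let Z (z : 'rV[R]_p * 'rV[R]_p) : 'rV[R]_(p + p) := row_mx z.1 (r *: z.1 + s *: z.2).
Let X o : 'rV[R]_(p + p) := row_mx (xi1 o) (xi2 o).

Let mZ : measurable_fun setT Z.
Proof.
apply/measurable_fun_rVP => i; rewrite /Z.
case: (split_ordP i) => j ->.
  under eq_fun do rewrite row_mxEl.
  exact: (measurableT_comp (measurable_coord_rV j) measurable_fst).
under eq_fun do rewrite row_mxEr !mxE.
apply: measurable_funD; apply: measurable_funM => //.
  exact: (measurableT_comp (measurable_coord_rV j) measurable_fst).
exact: (measurableT_comp (measurable_coord_rV j) measurable_snd).
Qed.

Let mX : measurable_fun setT X.
Proof.
apply/measurable_fun_rVP => i; rewrite /X.
case: (split_ordP i) => j ->.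
  under eq_fun do rewrite row_mxEl.
  exact: (measurableT_comp (measurable_coord_rV j) mxi1).
under eq_fun do rewrite row_mxEr.
exact: (measurableT_comp (measurable_coord_rV j) mxi2).
Qed.

(** Integrating over w and then over z gives the exponent s^2 |t2|^2 + |t1 + r t2|^2, which is the
    quadratic form of [xiE] because r^2 + s^2 = 1. *)
Let law_XZ A : measurable A -> P (X @^-1` A) = (gam \x gam)%E (Z @^-1` A).
Proof.
move=> mA; apply: (@eq_law_cos _ _ _ _ _ P
  [the probability _ _ of (gam \x gam)%E] _ X Z) => // t c.
pose t1 : 'rV[R]_p := lsubmx t; pose t2 : 'rV[R]_p := rsubmx t.
have E (v w : 'rV[R]_p) : lform t (row_mx v w) = lform t1 v + lform t2 w.
  rewrite /lform big_split_ord /=; congr (_ + _); apply: eq_bigr => i _.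
    by rewrite row_mxEl mxE.
  by rewrite row_mxEr mxE.
rewrite /X; under eq_Rintegral do rewrite E.
rewrite xiE.
have mcZ : measurable_fun setT (fun z => cos (lform t (Z z) + c)).
  apply: measurableT_comp; first exact: (continuous_measurable_fun (@continuous_cos R)).
  apply: measurable_funD => //; exact: (measurableT_comp (measurable_lform t) mZ).
have icZ : integr (gam \x gam)%E (fun z => cos (lform t (Z z) + c)).
  apply: (@integr_bounded _ _ _ [the probability _ _ of (gam \x gam)%E] _ 1) => //.
  by move=> x; rewrite ler_norml cos_geN1 cos_le1.
have [_ /= ->] := Rint_fubini icZ.
have E2 z w : lform t (Z (z, w)) + c = lform (s *: t2) w + (lform (t1 + r *: t2) z + c).
  by rewrite /Z /= E lformD lform_comb !lformZ; ring.
under eq_Rintegral => z _ do (under eq_Rintegral => w _ do rewrite E2).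
under eq_Rintegral => z _ do rewrite characteristic_gauss_rV.
rewrite RintZ; last first.
  apply: (@integr_bounded _ _ _ _ _ 1).
    apply: measurableT_comp; first exact: (continuous_measurable_fun (@continuous_cos R)).
    by apply: measurable_funD => //; exact: measurable_lform.
  by move=> x; rewrite ler_norml cos_geN1 cos_le1.
rewrite characteristic_gauss_rV mulrA -expRD; congr (expR _ * _).
rewrite -opprD -mulrDl; congr (- (_ / 2)).
have -> : \sum_i (s *: t2) ord0 i ^+ 2 = s ^+ 2 * \sum_i t2 ord0 i ^+ 2.
  by rewrite mulr_sumr; apply: eq_bigr => i _; rewrite !mxE exprMn.
have -> : \sum_i (t1 + r *: t2) ord0 i ^+ 2 = \sum_i t1 ord0 i ^+ 2 +
    2 * r * lform t1 t2 + r ^+ 2 * \sum_i t2 ord0 i ^+ 2.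
  rewrite /lform !mulr_sumr -!big_split/=; apply: eq_bigr => i _; rewrite !mxE; ring.
have -> : s ^+ 2 = 1 - r ^+ 2 by rewrite -rs addrC addKr.
ring.
Qed.

Lemma pair_expectation (f h : 'rV[R]_p -> R) : measurable_fun setT f ->
  measurable_fun setT h -> integr P (fun o => f (xi1 o) * h (xi2 o)) ->
  \int[P]_o (f (xi1 o) * h (xi2 o)) =
  \int[gam]_z \int[gam]_w (f z * h (r *: z + s *: w)).
Proof.
move=> mf mh ifh; pose F (v : 'rV[R]_(p + p)) := f (lsubmx v) * h (rsubmx v).
have ml : measurable_fun setT (fun v : 'rV[R]_(p + p) => lsubmx v).
  apply/measurable_fun_rVP => i; under eq_fun do rewrite mxE.
  exact: measurable_coord_rV.
have mr : measurable_fun setT (fun v : 'rV[R]_(p + p) => rsubmx v).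
  apply/measurable_fun_rVP => i; under eq_fun do rewrite mxE.
  exact: measurable_coord_rV.
have mF : measurable_fun setT F.
  apply: measurable_funM; [exact: (measurableT_comp mf ml)|exact: (measurableT_comp mh mr)].
pose XM : {mfun Omega >-> 'rV[R]_(p + p)} :=
  HB.pack_for {mfun Omega >-> 'rV[R]_(p + p)} X (isMeasurableFun.Build _ _ _ _ X mX).
pose nu : probability 'rV[R]_(p + p) R := distribution P XM.
have nuX A : measurable A -> nu A = P (X @^-1` A) by [].
have nuZ A : measurable A -> nu A = (gam \x gam)%E (Z @^-1` A).
  by move=> mA; rewrite -law_XZ.
have iX : integr P (F \o X).
  by move: ifh; congr integr; apply/funext => o; rewrite /F /X /= row_mxKl row_mxKr.
have inu := (integr_law mX nuX mF).2 iX.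
have iZ := (integr_law mZ nuZ mF).1 inu.
transitivity (\int[P]_o F (X o)).
  by apply: eq_Rintegral => o _; rewrite /F /X row_mxKl row_mxKr.
rewrite -(Rint_law mX nuX mF iX) (Rint_law mZ nuZ mF iZ).
have [_ ->] := Rint_fubini iZ.
by apply: eq_Rintegral => z _; apply: eq_Rintegral => w _; rewrite /F /Z /= row_mxKl row_mxKr.
Qed.

Lemma sqi_pair1 (f : 'rV[R]_p -> R) : sqi gam f -> sqi P (f \o xi1).
Proof. exact: (sqi_law mxi1 law_pair1). Qed.

Lemma sqi_pair2 (f : 'rV[R]_p -> R) : sqi gam f -> sqi P (f \o xi2).
Proof. exact: (sqi_law mxi2 law_pair2). Qed.

(** Integrating over w first applies Mehler's formula to the Hermite product alone, so f may be any
    square integrable function. *)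
Lemma pair_hprod (f : 'rV[R]_p -> R) m : sqi gam f ->
  \int[P]_o (f (xi1 o) * hprod m (xi2 o)) =
  r ^+ degree m * \int[gam]_z (f z * hprod m z).
Proof.
move=> sf; rewrite pair_expectation; last 3 first.
- by case: sf.
- exact: measurable_hprod.
- exact: (sqiM (sqi_pair1 sf) (sqi_pair2 (sqi_hprod m))).
have ih z : integr gam (fun w => hprod m (r *: z + s *: w)).
  have [h _] := @gauss_rV_prod R p (fun i (u : R) => (hermite (m i)).[r * z ord0 i + s * u])
    (fun i => integr_horner_affine _ _ _).
  by move: h; congr integr; apply/funext => w; apply: eq_bigr => i _; rewrite !mxE.
under eq_Rintegral => z _ do rewrite RintZ// mehler_hprod// mulrCA.
by rewrite RintZ//; apply: sqiM => //; exact: sqi_hprod.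
Qed.

End gaussian_pair.

(** * Orthogonal projections on Hermite polynomials *)

Section hermite_projection.
Context {R : realType} {p : nat}.
Local Notation gam := (gauss_rV R p).
Implicit Types (g : 'rV[R]_p -> R) (m : 'I_p -> nat).

Lemma integr_gauss_density g : integr gam g ->
  integr (lebesgue_rV R p) (fun w => g w * gauss_density w) /\
  \int[gam]_w g w = \int[lebesgue_rV R p]_w (g w * gauss_density w).
Proof.
move=> ig; apply: integr_density => //.
- exact: measurable_gauss_density.
- exact: gauss_density_ge0.
move=> A mA; rewrite integral_mkcond.
transitivity (\int[gam]_x (\1_A x)%:E)%E; first by rewrite integral_indic// setIT.
rewrite ge0_integral_gauss_rV//; last exact/measurable_EFinP/measurable_indic.
apply: eq_integral => x _; rewrite patchE indicE.
by case: (_ \in _); rewrite ?mul1e ?mul0e.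
Qed.

Lemma gauss_L2_sqi g : gauss_L2 g -> sqi gam g.
Proof.
move=> [mg g2]; split => //; apply/integrableP; split.
  by apply/measurable_EFinP; exact: measurable_funX.
rewrite ge0_integral_gauss_rV//; last first.
  by do 2 apply: measurableT_comp => //; exact: measurable_funX.
apply: le_lt_trans g2; rewrite le_eqVlt; apply/orP; left; apply/eqP.
by apply: eq_integral => x _; rewrite EFinM /= ger0_norm ?sqr_ge0.
Qed.

Definition idx k (nu : {ffun 'I_p -> 'I_k}) : 'I_p -> nat := fun j => nu j.

Lemma hermite_coefE g k (nu : {ffun 'I_p -> 'I_k}) : sqi gam g ->
  hermite_coef g nu = \int[gam]_x (g x * hprod (idx nu) x).
Proof.
move=> sg; have [_ ->] := integr_gauss_density (sqiM sg (sqi_hprod (idx nu))).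
by [].
Qed.

Lemma mfact_gt0 k (nu : {ffun 'I_p -> 'I_k}) : 0 < mfact nu :> R.
Proof. by rewrite ltr0n prodn_gt0// => i; exact: fact_gt0. Qed.

Lemma degree_idx l (nu : {ffun 'I_p -> 'I_l.+1}) :
  (nu \in multi_index l) = (degree (idx nu) == l).
Proof. by rewrite inE. Qed.

(** Orthogonality leaves at most one term, the one whose multi-index is m. *)
Lemma sum_hprod_multi_index l m (a : {ffun 'I_p -> 'I_l.+1} -> R) :
  \sum_(nu in multi_index l) a nu * \int[gam]_x (hprod (idx nu) x * hprod m x) =
  if degree m == l then
    let nu := [ffun j => inord (m j)] in a nu * mfact nu else 0.
Proof.
have off (nu : {ffun 'I_p -> 'I_l.+1}) : ~~ [forall i, idx nu i == m i] ->
    a nu * \int[gam]_x (hprod (idx nu) x * hprod m x) = 0.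
  by move=> h; rewrite hprod_orthogonal (negbTE h) mul0r mulr0.
case: ifPn => [/eqP ml|ml]; last first.
  apply: big1 => nu; rewrite degree_idx => /eqP dnu; apply: off.
  apply: contra ml => /forallP h; rewrite -dnu; apply/eqP.
  by apply: eq_bigr => i _; rewrite (eqP (h i)).
set mu := [ffun j => inord (m j)].
(* Each entry is at most the degree, so [inord] preserves it. *)
have mi i : (m i < l.+1)%N by rewrite ltnS -ml /degree (bigD1 i)//= leq_addr.
have muE i : idx mu i = m i by rewrite /idx ffunE inordK.
have muin : mu \in multi_index l.
  rewrite degree_idx; apply/eqP; rewrite -[RHS]ml.
  by apply: eq_bigr => i _; exact: muE.
rewrite (bigD1 mu)//= big1 => [|nu /andP[_ numu]]; last first.
  apply: off; apply: contra numu => /forallP h; apply/eqP/ffunP => i.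
  by apply: val_inj; rewrite /= (eqP (h i) : nat_of_ord (nu i) = _) -(muE i).
rewrite addr0 hprod_orthogonal (_ : [forall i, _] = true) ?mul1r//.
by apply/forallP => i; rewrite muE.
Qed.

Definition hermite_comp g l x : R :=
  \sum_(nu in multi_index l) hermite_coef g nu / mfact nu * hprod (idx nu) x.

Definition hermite_proj g N x : R := \sum_(l < N) hermite_comp g l x.

Lemma hspan_comp g l : hspan l.+1 (hermite_comp g l).
Proof.
apply: hspan_sum => nu; rewrite degree_idx => /eqP dnu; apply: hspanZ.
by apply: hspan_hprod; rewrite dnu.
Qed.

Lemma hspan_proj g N : hspan N (hermite_proj g N).
Proof. by apply: hspan_sum => l _; apply: hspan_le (hspan_comp _ _). Qed.

Lemma Rint_sumM (f : 'rV[R]_p -> R) I (s : seq I) (Q : pred I) (F : I -> 'rV[R]_p -> R)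
    (c : I -> R) : sqi gam f -> (forall i, sqi gam (F i)) ->
  \int[gam]_x (f x * \sum_(i <- s | Q i) c i * F i x) =
  \sum_(i <- s | Q i) c i * \int[gam]_x (f x * F i x).
Proof.
move=> sf sF.
have E x : f x * (\sum_(i <- s | Q i) c i * F i x) =
    \sum_(i <- s | Q i) c i * (f x * F i x).
  by rewrite mulr_sumr; apply: eq_bigr => i _; rewrite mulrCA.
under eq_Rintegral do rewrite E.
rewrite (@Rint_sum _ _ _ gam _ _ _ (fun i x => c i * (f x * F i x))); last first.
  by move=> i _; apply: integrZ; exact: sqiM.
by apply: eq_bigr => i _; rewrite RintZ//; exact: sqiM.
Qed.

Lemma Rint_comp_hprod g l m : sqi gam g ->
  \int[gam]_x (hprod m x * hermite_comp g l x) =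
  if degree m == l then \int[gam]_x (g x * hprod m x) else 0.
Proof.
move=> sg; rewrite Rint_sumM; [|exact: sqi_hprod|by move=> i; exact: sqi_hprod].
transitivity (\sum_(nu in multi_index l) hermite_coef g nu / mfact nu *
    \int[gam]_x (hprod (idx nu) x * hprod m x)).
  by apply: eq_bigr => nu _; congr (_ * _); apply: eq_Rintegral => x _; rewrite mulrC.
rewrite sum_hprod_multi_index; case: ifPn => // /eqP ml /=.
rewrite divfK ?gt_eqF ?mfact_gt0// hermite_coefE//.
rewrite (@eq_hprod _ _ _ m)// => i; rewrite /idx ffunE inordK//.
by rewrite ltnS -ml /degree (bigD1 i)//= leq_addr.
Qed.

Lemma Rint_sum_ord N (f : 'rV[R]_p -> R) (F : 'I_N -> 'rV[R]_p -> R) :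
  sqi gam f -> (forall i, sqi gam (F i)) ->
  \int[gam]_x (f x * \sum_(i < N) F i x) = \sum_(i < N) \int[gam]_x (f x * F i x).
Proof.
move=> sf sF; have := @Rint_sumM f _ (index_enum 'I_N) xpredT F (fun=> 1) sf sF.
under eq_Rintegral => x _ do (under eq_bigr do rewrite mul1r).
by move=> ->; apply: eq_bigr => i _; rewrite mul1r.
Qed.

Lemma proj_orth g N m : sqi gam g -> (degree m < N)%N ->
  \int[gam]_x (hprod m x * hermite_proj g N x) = \int[gam]_x (g x * hprod m x).
Proof.
move=> sg mN; rewrite Rint_sum_ord; last 2 first.
- exact: sqi_hprod.
- by move=> i; exact: sqi_hspan (hspan_comp _ _).
rewrite (bigD1 (Ordinal mN))//= Rint_comp_hprod// eqxx big1 ?addr0// => i iN.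
rewrite Rint_comp_hprod// ifN//; apply: contra iN => /eqP iN.
by apply/eqP/val_inj.
Qed.

Lemma proj_orth_hspan g N q : sqi gam g -> hspan N q ->
  \int[gam]_x ((g x - hermite_proj g N x) * q x) = 0.
Proof.
move=> sg; have sP := sqi_hspan (hspan_proj g N); have sgP := sqiB sg sP.
elim => [|a m f mN hf IH].
  by under eq_Rintegral do rewrite mulr0; rewrite Rintegral_cst// mul0r.
under eq_Rintegral do rewrite mulrDr mulrCA.
rewrite RintD; last 2 first.
- by apply: integrZ; apply: sqiM => //; exact: sqi_hprod.
- by apply: sqiM => //; exact: sqi_hspan hf.
rewrite IH addr0 RintZ; last by apply: sqiM => //; exact: sqi_hprod.
under eq_Rintegral do rewrite mulrBl [X in _ - X]mulrC.
rewrite RintB; last 2 first.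
- by apply: sqiM => //; exact: sqi_hprod.
- by apply: sqiM => //; exact: sqi_hprod.
by rewrite proj_orth// subrr mulr0.
Qed.

(** The projection error is orthogonal to [hspan N], so Pythagoras applies. Any polynomial
    approximation thus controls the error of the Hermite expansion. *)
Lemma proj_best g N q : sqi gam g -> hspan N q ->
  \int[gam]_x ((g x - hermite_proj g N x) ^+ 2) <= \int[gam]_x ((g x - q x) ^+ 2).
Proof.
move=> sg hq; have hP := hspan_proj g N; have sP := sqi_hspan hP.
have hPq : hspan N (fun x => hermite_proj g N x - q x).
  have := hspanD hP (hspanZ (-1) hq).
  by congr hspan; apply/funext => x; rewrite mulN1r.
have := Rint_sqD (sqiB sg sP) (sqi_hspan hPq).
under eq_Rintegral do rewrite subrKA.
move=> ->; rewrite proj_orth_hspan// mulr0 addr0 lerDl.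
exact: Rint_sq_ge0.
Qed.

Lemma Rint_proj_sq g N : sqi gam g ->
  \int[gam]_x (g x * hermite_proj g N x) = \sum_(l < N) hermite_energy g l.
Proof.
move=> sg; rewrite Rint_sum_ord//; last by move=> i; exact: sqi_hspan (hspan_comp _ _).
apply: eq_bigr => l _; rewrite Rint_sumM//; last by move=> i; exact: sqi_hprod.
by apply: eq_bigr => nu _; rewrite -hermite_coefE// mulrAC expr2.
Qed.

Lemma hermite_bessel g N : sqi gam g ->
  \sum_(l < N) hermite_energy g l <= \int[gam]_x (g x ^+ 2).
Proof.
move=> sg; rewrite -Rint_proj_sq//.
have hP := hspan_proj g N; have sP := sqi_hspan hP.
have := proj_orth_hspan sg hP.
under eq_Rintegral do rewrite mulrBl.
rewrite RintB; [|exact: sqiM|exact: sqiM].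
have -> : \int[gam]_x (hermite_proj g N x * hermite_proj g N x) =
    \int[gam]_x (hermite_proj g N x ^+ 2) by [].
have := Rint_sqB sg sP; have := Rint_sq_ge0 gam (fun x => g x - hermite_proj g N x).
lra.
Qed.

Lemma hermite_energy_ge0 g l : 0 <= hermite_energy g l.
Proof.
apply: sumr_ge0 => nu _; rewrite divr_ge0 ?sqr_ge0// ltW// mfact_gt0//.
Qed.

Lemma sqi_comp g l : sqi gam (hermite_comp g l).
Proof. exact: sqi_hspan (hspan_comp _ _). Qed.

Lemma hermite_coef_comp g k l (nu : {ffun 'I_p -> 'I_l.+1}) : sqi gam g ->
  nu \in multi_index l ->
  hermite_coef (hermite_comp g k) nu = if l == k then hermite_coef g nu else 0.
Proof.
rewrite degree_idx => sg /eqP dnu; rewrite hermite_coefE; last exact: sqi_comp.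
under eq_Rintegral do rewrite mulrC.
by rewrite Rint_comp_hprod// dnu -hermite_coefE.
Qed.

Lemma hermite_coefB g h l (nu : {ffun 'I_p -> 'I_l.+1}) : sqi gam g -> sqi gam h ->
  hermite_coef (fun x => g x - h x) nu = hermite_coef g nu - hermite_coef h nu.
Proof.
move=> sg sh; rewrite !hermite_coefE//; last exact: sqiB.
under eq_Rintegral do rewrite mulrBl.
by rewrite RintB//; apply: sqiM => //; exact: sqi_hprod.
Qed.

(** Brings the remainder of a function of rank kappa under the hypotheses of [pair_le]: below kappa
    the coefficients are already 0, and at kappa they cancel. *)
Lemma hermite_energy_remainder g kappa l : sqi gam g ->
  (forall k, (k < kappa)%N -> forall nu, nu \in multi_index k ->
     @hermite_coef R p g k.+1 nu = 0) ->
  hermite_energy (fun x => g x - hermite_comp g kappa x) l =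
  if (l <= kappa)%N then 0 else hermite_energy g l.
Proof.
move=> sg g0; rewrite /hermite_energy.
have E nu : nu \in multi_index l ->
    hermite_coef (fun x => g x - hermite_comp g kappa x) nu =
    if (l <= kappa)%N then 0 else hermite_coef g nu.
  move=> nul; rewrite hermite_coefB//; last exact: sqi_comp.
  rewrite hermite_coef_comp//; have [lk|lk|lk] := ltngtP l kappa.
  - by rewrite (g0 _ lk)// subrr.
  - by rewrite subr0.
  - by rewrite subrr.
case: ifPn E => lk E; last by apply: eq_bigr => nu /E ->.
by apply: big1 => nu /E ->; rewrite expr0n mul0r.
Qed.

End hermite_projection.

Section pair_inequality.
Context d (Omega : measurableType d) (R : realType) (P : probability Omega R) (p : nat).
Local Notation gam := (gauss_rV R p).
Variables (xi1 xi2 : Omega -> 'rV[R]_p) (r : R).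
Hypotheses (mxi1 : measurable_fun setT xi1) (mxi2 : measurable_fun setT xi2).
Hypothesis r1 : `|r| <= 1.
Hypothesis xiE : forall t u c, \int[P]_o cos (lform t (xi1 o) + lform u (xi2 o) + c) =
  expR (- ((\sum_i t ord0 i ^+ 2 + \sum_i u ord0 i ^+ 2 + 2 * r * lform t u) / 2)) * cos c.
Implicit Type g : 'rV[R]_p -> R.

Lemma pair_comp f g l : sqi gam f -> sqi gam g ->
  \int[P]_o (f (xi1 o) * hermite_comp g l (xi2 o)) =
  r ^+ l * \int[gam]_z (f z * hermite_comp g l z).
Proof.
move=> sf sg; have sP1 := sqi_pair1 mxi1 xiE sf.
have E o : f (xi1 o) * hermite_comp g l (xi2 o) = \sum_(nu in multi_index l)
    hermite_coef g nu / mfact nu * (f (xi1 o) * hprod (idx nu) (xi2 o)).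
  by rewrite mulr_sumr; apply: eq_bigr => nu _; rewrite mulrCA.
have i1 nu : integr P (fun o => f (xi1 o) * hprod (@idx _ l.+1 nu) (xi2 o)).
  apply: (sqiM sP1); exact: (sqi_pair2 mxi2 xiE (sqi_hprod _)).
under eq_Rintegral do rewrite E.
rewrite (@Rint_sum _ _ _ P _ _ _ (fun nu o => hermite_coef g nu / mfact nu *
  (f (xi1 o) * hprod (@idx _ l.+1 nu) (xi2 o)))); last by move=> nu _; exact: integrZ.
rewrite Rint_sumM//; last by move=> nu; exact: sqi_hprod.
rewrite mulr_sumr; apply: eq_bigr => nu; rewrite degree_idx => /eqP dnu.
by rewrite RintZ// (pair_hprod mxi1 mxi2 r1 xiE)// dnu mulrCA.
Qed.

Lemma pair_comp_sq g l : sqi gam g ->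
  \int[P]_o (hermite_comp g l (xi1 o) * hermite_comp g l (xi2 o)) =
  r ^+ l * hermite_energy g l.
Proof.
move=> sg; rewrite pair_comp//; last exact: sqi_comp; congr (_ * _).
rewrite Rint_sumM; [|exact: sqi_comp|by move=> nu; exact: sqi_hprod].
apply: eq_bigr => nu nul; under eq_Rintegral do rewrite mulrC.
rewrite Rint_comp_hprod//; move: nul; rewrite degree_idx => ->.
by rewrite -hermite_coefE// mulrAC expr2.
Qed.

(** Only the second factor is expanded: against its projection of degree less than N, the
    expectation is the sum of r^l E_l, where |r|^l <= |r|^(kappa+1) for l > kappa. The rest of the
    factor is small in mean square, by completeness. *)
Lemma pair_le g (kappa : nat) (T : R) : sqi gam g ->
  (forall l, (l <= kappa)%N -> hermite_energy g l = 0) ->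
  (forall N, \sum_(l < N) hermite_energy g l <= T) ->
  `|\int[P]_o (g (xi1 o) * g (xi2 o))| <= `|r| ^+ kappa.+1 * T.
Proof.
move=> sg g0 gT.
have T0 : 0 <= T by have := gT 0%N; rewrite big_ord0.
have s1 := sqi_pair1 mxi1 xiE sg; have s2 := sqi_pair2 mxi2 xiE sg.
set B := \int[gam]_x (g x ^+ 2).
have B0 : 0 <= B by exact: Rint_sq_ge0.
apply/ler_addgt0Pr => e e0.
(* By Cauchy-Schwarz the square of the error is at most B e', hence at most e^2; the 1 avoids a
   division by 0. *)
pose e' := e ^+ 2 / (B + 1).
have e'0 : 0 < e' by rewrite divr_gt0 ?exprn_gt0// ltr_wpDl.
have [N [q [hq le_q]]] := hermite_approx_sqi sg e'0.
pose S := hermite_proj g N.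
have sS : sqi gam S := sqi_hspan (hspan_proj g N).
have sD := sqiB sg sS.
have sD2 := sqi_pair2 mxi2 xiE sD.
have sS2 := sqi_pair2 mxi2 xiE sS.
have -> : \int[P]_o (g (xi1 o) * g (xi2 o)) = \int[P]_o (g (xi1 o) * S (xi2 o)) +
    \int[P]_o (g (xi1 o) * (g (xi2 o) - S (xi2 o))).
  rewrite -RintD; [|exact: sqiM|exact: sqiM].
  by apply: eq_Rintegral => o _; rewrite -mulrDr subrKC.
rewrite (le_trans (ler_normD _ _))// lerD//.
  have -> : \int[P]_o (g (xi1 o) * S (xi2 o)) = \sum_(l < N) r ^+ l * hermite_energy g l.
    rewrite /S /hermite_proj; under eq_Rintegral do rewrite mulr_sumr.
    rewrite (@Rint_sum _ _ _ P _ _ _ (fun (l : 'I_N) o => g (xi1 o) * hermite_comp g l (xi2 o))).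
      apply: eq_bigr => l _; rewrite pair_comp//; congr (_ * _).
      rewrite Rint_sumM//; last by move=> nu; exact: sqi_hprod.
      by apply: eq_bigr => nu _; rewrite -hermite_coefE// mulrAC expr2.
    move=> l _; apply: (sqiM s1); exact: (sqi_pair2 mxi2 xiE (sqi_comp g l)).
  apply: le_trans (ler_norm_sum _ _ _) _.
  apply: (@le_trans _ _ (\sum_(l < N) `|r| ^+ kappa.+1 * hermite_energy g l)).
    apply: ler_sum => l _; rewrite normrM normrX (ger0_norm (hermite_energy_ge0 _ _)).
    have [lk|lk] := leqP l kappa; first by rewrite g0// !mulr0.
    apply: ler_wpM2r; first exact: hermite_energy_ge0.
    by apply: ler_wiXn2l.
  by rewrite -mulr_sumr ler_wpM2l// exprn_ge0.
rewrite -(@ler_pXn2r _ 2)// ?nnegrE ?(ltW e0)//.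
rewrite real_normK ?num_real//.
apply: (le_trans (y := (\int[P]_x ((g \o xi1) x ^+ 2)) *
  (\int[P]_x (((fun x => g x - S x) \o xi2) x ^+ 2)))).
  exact: (cauchy_schwarz s1 sD2).
have -> : \int[P]_x ((g \o xi1) x ^+ 2) = B.
  have iP : integr P ((fun x => g x ^+ 2) \o xi1) by case: s1.
  have mg2 : measurable_fun setT (fun x => g x ^+ 2) by apply: measurable_funX; case: sg.
  exact: (esym (Rint_law mxi1 (law_pair1 mxi1 xiE) mg2 iP)).
have -> : \int[P]_x (((fun x => g x - S x) \o xi2) x ^+ 2) = \int[gam]_x ((g x - S x) ^+ 2).
  have iP : integr P ((fun x => (g x - S x) ^+ 2) \o xi2) by case: sD2.
  have mg2 : measurable_fun setT (fun x => (g x - S x) ^+ 2).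
    by apply: measurable_funX; case: sD.
  exact: (esym (Rint_law mxi2 (law_pair2 mxi2 xiE) mg2 iP)).
have h := le_trans (proj_best sg hq) le_q.
apply: (@le_trans _ _ (B * e')); first by rewrite ler_wpM2l.
rewrite /e' mulrA ler_pdivrMr ?ltr_wpDl//.
by rewrite mulrC ler_wpM2l ?sqr_ge0// lerDl.
Qed.

End pair_inequality.

(** * Integrals of random fields *)

Section almost_everywhere.
Context d (T : measurableType d) (R : realType) (mu : {measure set T -> \bar R}).

Lemma ae_eq_Rint (f g : T -> R) : measurable_fun setT f -> measurable_fun setT g ->
  {ae mu, forall x, f x = g x} -> \int[mu]_x f x = \int[mu]_x g x.
Proof.
move=> mf mg fg; rewrite /Rintegral; congr fine; apply: ae_eq_integral => //.
- exact/measurable_EFinP.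
- exact/measurable_EFinP.
- by apply: filterS fg => x /= -> _.
Qed.

Lemma ae_le_integr (f g : T -> R) : measurable_fun setT f -> integr mu g ->
  {ae mu, forall x, `|f x| <= g x} -> integr mu f.
Proof.
move=> mf ig fg; have mg := integr_meas ig.
apply/integrableP; split; first exact/measurable_EFinP.
move/integrableP : ig => [_]; apply: le_lt_trans; apply: ae_ge0_le_integral => //.
- by do 2 apply: measurableT_comp => //; exact/measurable_EFinP.
- by do 2 apply: measurableT_comp => //; exact/measurable_EFinP.
- by apply: filterS fg => x fgx _; rewrite lee_fin (le_trans fgx)// ler_norm.
Qed.

End almost_everywhere.

Section field_integral.
Context dT dO (T : measurableType dT) (Omega : measurableType dO) (R : realType)
  (mu : {finite_measure set T -> \bar R}) (P : probability Omega R).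
Implicit Types (F G : T * Omega -> R) (H : Omega -> R).

(** The second moments are bounded uniformly in x, so F is square integrable on the product with the
    finite measure [mu]. *)
Definition sqfield F := measurable_fun setT F /\ exists M : R, forall x,
  integr P (fun o => F (x, o) ^+ 2) /\ \int[P]_o (F (x, o) ^+ 2) <= M.

Definition Kint F o : R := \int[mu]_x F (x, o).

Lemma sqfield_sqi F x : sqfield F -> sqi P (fun o => F (x, o)).
Proof.
move=> [mF [M FM]]; split; last by case: (FM x).
exact: (measurableT_comp mF (pair1_measurable x)).
Qed.

Lemma sqi_sqfield F : sqfield F -> sqi (mu \x P)%E F.
Proof.
move=> [mF [M FM]]; split => //.
apply/(@integrable12ltyP _ _ _ _ _ mu P).
  by apply/measurable_EFinP; exact: measurable_funX.
apply: (@le_lt_trans _ _ (\int[mu]_x (cst M%:E) x)%E); last first.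
  rewrite integral_cst// lte_mul_pinfty ?lee_fin//.
  - have [h hM] := FM point; apply: le_trans hM; exact: Rint_sq_ge0.
  - by rewrite -ge0_fin_numE// fin_num_measure.
have mF2 : measurable_fun setT (fun z : T * Omega => (F z ^+ 2)%:E).
  by apply/measurable_EFinP; exact: measurable_funX.
apply: ge0_le_integral => //.
- by move=> x _; exact: integral_ge0.
- apply: (measurable_fun_fubini_tonelli_F (fun z => `|(F z ^+ 2)%:E|%E)) => //.
  exact: measurableT_comp.
move=> x _; have [h hM] := FM x.
under eq_integral do rewrite /= ger0_norm ?sqr_ge0//.
rewrite -[leLHS]fineK ?lee_fin//.
exact: (integrable_fin_num measurableT h).
Qed.

Lemma sqi_snd H : sqi P H -> sqi (mu \x P)%E (fun z => H z.2).
Proof.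
move=> [mH iH]; split; first exact: (measurableT_comp mH measurable_snd).
have := integr_prodM (integr_cst mu 1) iH; congr integr.
by apply/funext => z; rewrite mul1r.
Qed.

Let sqi1 : sqi P (fun=> 1).
Proof. by apply: (@sqi_bounded _ _ _ P _ 1) => // x; rewrite normr1. Qed.

Lemma integr_sqfield F : sqfield F -> integr (mu \x P)%E F.
Proof.
move=> sF; have := sqiM (sqi_sqfield sF) (sqi_snd sqi1).
by congr integr; apply/funext => z; rewrite mulr1.
Qed.

Lemma measurable_Kint F : sqfield F -> measurable_fun setT (Kint F).
Proof.
move=> sF; apply: measurableT_comp => //.
exact: (measurable_fubini_G (integr_sqfield sF)).
Qed.

Lemma ae_sqi_field F : sqfield F -> {ae P, forall o, sqi mu (fun x => F (x, o))}.
Proof.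
move=> sF; have [mF iF2] := sqi_sqfield sF.
apply: filterS (ae_integrable2 iF2) => o h; split => //.
exact: (measurableT_comp mF (pair2_measurable o)).
Qed.

(** For almost every outcome, Cauchy-Schwarz bounds the square of [Kint F] by the total mass of [mu]
    times the integral of F^2 along the path. *)
Lemma sqi_Kint F : sqfield F -> sqi P (Kint F).
Proof.
move=> sF; split; first exact: measurable_Kint.
have [i2 _] := Rint_fubini_swap (proj2 (sqi_sqfield sF)).
apply: (ae_le_integr _ (integrZ (fine (mu setT)) i2)).
  by apply: measurable_funX; exact: measurable_Kint.
apply: filterS (ae_sqi_field sF) => o so.
rewrite ger0_norm ?sqr_ge0//.
have s1 : sqi mu (fun=> 1) by apply: (@sqi_bounded _ _ _ mu _ 1) => // x; rewrite normr1.
have := cauchy_schwarz s1 so.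
under eq_Rintegral do rewrite mul1r.
by under [X in X * _]eq_Rintegral do rewrite expr1n; rewrite Rintegral_cst// mul1r.
Qed.

(** Used with H = [Kint F] and then with H a single value of the field, it expresses the second
    moment of [Kint F] as a double integral of covariances. *)
Lemma Rint_Kint F H : sqfield F -> sqi P H ->
  \int[P]_o (H o * Kint F o) = \int[mu]_x \int[P]_o (H o * F (x, o)).
Proof.
move=> sF sH; have iHF := sqiM (sqi_snd sH) (sqi_sqfield sF).
have [_ E1] := Rint_fubini iHF; have [i2 E2] := Rint_fubini_swap iHF.
rewrite -E1 E2; apply: ae_eq_Rint.
- by apply: measurable_funM; [case: sH|exact: measurable_Kint].
- exact: integr_meas i2.
- by apply: filterS (ae_sqi_field sF) => o /sqi_integr so; rewrite -(RintZ (H o) so).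
Qed.

Lemma mean_Kint F : sqfield F ->
  \int[P]_o Kint F o = \int[mu]_x \int[P]_o F (x, o).
Proof.
move=> sF; have := Rint_Kint sF sqi1.
under eq_Rintegral do rewrite mul1r.
by under [RHS]eq_Rintegral => x _ do (under eq_Rintegral do rewrite mul1r).
Qed.

Lemma integr_Kint_cov F H : sqfield F -> sqi P H ->
  integr mu (fun x => \int[P]_o (H o * F (x, o))).
Proof.
by move=> sF sH; have [] := Rint_fubini (sqiM (sqi_snd sH) (sqi_sqfield sF)).
Qed.

Lemma sqfieldZ k F : sqfield F -> sqfield (fun z => k * F z).
Proof.
move=> [mF [M FM]]; split; first exact: measurable_funM.
exists (k ^+ 2 * M) => x; have [h hM] := FM x.
have -> : (fun o => (k * F (x, o)) ^+ 2) = fun o => k ^+ 2 * F (x, o) ^+ 2.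
  by apply/funext => o; rewrite exprMn.
by split; [exact: integrZ|rewrite RintZ// ler_wpM2l// sqr_ge0].
Qed.

Lemma sqfieldD F G : sqfield F -> sqfield G -> sqfield (fun z => F z + G z).
Proof.
move=> sF sG; have [mF [M FM]] := sF; have [mG [N GN]] := sG.
split; first exact: measurable_funD.
exists (2 * M + 2 * N) => x.
have sFx := sqfield_sqi x sF; have sGx := sqfield_sqi x sG.
split; first by case: (sqiD sFx sGx).
apply: le_trans (Rint_sqD_le sFx sGx) _.
by rewrite lerD// ler_wpM2l//; [case: (FM x)|case: (GN x)].
Qed.

Lemma sqfield_sum I (s : seq I) (Q : pred I) (F : I -> T * Omega -> R) :
  (forall i, sqfield (F i)) -> sqfield (fun z => \sum_(i <- s | Q i) F i z).
Proof.
move=> sF; elim: s => [|i s IH].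
  under eq_fun do rewrite big_nil; split => //; exists 0 => x.
  under eq_fun do rewrite expr0n; split; first exact: integr_cst.
  by rewrite Rintegral_cst// mul0r.
have [Qi|Qi] := boolP (Q i).
  by under eq_fun do rewrite big_cons Qi; exact: sqfieldD.
by under eq_fun do rewrite big_cons (negbTE Qi).
Qed.

(** Additivity may fail on a null set of outcomes, where the paths are not integrable and the
    integrals take default values. *)
Lemma ae_KintD F G : sqfield F -> sqfield G ->
  {ae P, forall o, Kint (fun z => F z + G z) o = Kint F o + Kint G o}.
Proof.
move=> sF sG; apply: filterS2 (ae_sqi_field sF) (ae_sqi_field sG) => o so1 so2.
by rewrite /Kint RintD//; exact: sqi_integr.
Qed.

Lemma ae_KintZ k F : sqfield F -> {ae P, forall o, Kint (fun z => k * F z) o = k * Kint F o}.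
Proof.
move=> sF; apply: filterS (ae_sqi_field sF) => o so1.
by rewrite /Kint RintZ//; exact: sqi_integr.
Qed.

Lemma ae_Kint_sum I (s : seq I) (Q : pred I) (F : I -> T * Omega -> R) (c : I -> R) :
  (forall i, sqfield (F i)) ->
  {ae P, forall o, Kint (fun z => \sum_(i <- s | Q i) c i * F i z) o =
    \sum_(i <- s | Q i) c i * Kint (F i) o}.
Proof.
move=> sF; elim: s => [|i s IH].
  apply: aeW => o; rewrite big_nil /Kint.
  by under eq_Rintegral do rewrite big_nil; rewrite Rintegral_cst// mul0r.
have [Qi|Qi] := boolP (Q i); last first.
  apply: filterS IH => o; rewrite big_cons (negbTE Qi) => <-; rewrite /Kint.
  by under eq_Rintegral do rewrite big_cons (negbTE Qi).
have sS : sqfield (fun z => \sum_(i <- s | Q i) c i * F i z).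
  by apply: sqfield_sum => j; exact: sqfieldZ.
apply: filterS3 IH (ae_KintZ (c i) (sF i)) (ae_KintD (sqfieldZ (c i) (sF i)) sS) => o h1 h2 h3.
rewrite big_cons Qi -h1 -h2 -h3 /Kint.
by apply: eq_Rintegral => x _; rewrite big_cons Qi.
Qed.

End field_integral.

(** * Integration over sets that need not be measurable *)

Section measurable_kernel.
Context d (T : measurableType d) (R : realType) (mu : {measure set T -> \bar R}).
Variables (D B : set T).
Hypotheses (mB : measurable B) (DB : D `<=` B) (muB : (mu B < +oo)%E).

(* [D] need not be measurable: [D0] has the largest measure among the measurable
   subsets of [D]. *)
Lemma measurable_kernel : exists D0, [/\ measurable D0, D0 `<=` D &
  forall A, measurable A -> A `<=` D -> mu (A `\` D0) = 0%E].
Proof.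
pose S := [set mu A | A in [set A | measurable A /\ A `<=` D]].
pose s := ereal_sup S.
have leB A : measurable A -> A `<=` D -> (mu A <= mu B)%E.
  by move=> mA AD; rewrite le_measure ?inE//; exact: subset_trans DB.
have sB : (s <= mu B)%E.
  by apply: ge_ereal_sup => _ [A [mA AD] <-]; exact: leB.
have s0 : (0 <= s)%E.
  by apply: ereal_sup_ubound; exists set0; [split; [exact: measurable0|exact: sub0set]|exact: measure0].
have sfin : s \is a fin_num by rewrite ge0_fin_numE// (le_lt_trans sB).
have /choice[A_ A_P] (n : nat) : exists A, [/\ measurable A, A `<=` D &
    (s - n.+1%:R^-1%:E < mu A)%E].
  have n0 : (0 < n.+1%:R^-1 :> R) by rewrite invr_gt0.
  have [_ [A [mA AD] <-] h] := ub_ereal_sup_adherent n0 sfin.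
  by exists A.
(* A union of near-maximizers has the maximal measure s; a measurable part of D with positive
   measure outside it would exceed s. *)
pose D0 := \bigcup_n A_ n.
have mD0 : measurable D0 by apply: bigcupT_measurable => n; case: (A_P n).
have D0D : D0 `<=` D by apply: bigcup_sub => n _; case: (A_P n).
have D0s : (s <= mu D0)%E.
  apply/lee_addgt0Pr => e e0.
  have [n _ /(_ n (leqnn n))] := (cvgr0Pnorm_lt _).1 (@cvg_harmonic R) e e0.
  rewrite /= ger0_norm ?invr_ge0// => ne.
  have [mA AD h] := A_P n.
  rewrite -leeBlDr//; apply: le_trans (_ : mu (A_ n) <= _)%E.
    apply: le_trans (ltW h); rewrite leeB// lee_fin; exact: ltW.
  by rewrite le_measure ?inE//; exact: bigcup_sup.
exists D0; split => // A mA AD.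
have h : (mu (A `|` D0) <= mu D0)%E.
  apply: le_trans D0s; apply: ereal_sup_ubound; exists (A `|` D0) => //.
  by split; [exact: measurableU|rewrite subUset].
have mAD : measurable (A `\` D0) by exact: measurableD.
have E : mu (A `|` D0) = (mu (A `\` D0) + mu D0)%E.
  rewrite -measureU//; last by rewrite setDE -setIA setICl setI0.
  by rewrite setUDl setDv setD0 //.
apply/eqP; rewrite eq_le measure_ge0 andbT.
have D0fin : mu D0 \is a fin_num.
  by rewrite ge0_fin_numE// (le_lt_trans (leB _ mD0 D0D)).
by move: h; rewrite E -[leRHS]add0e leeD2rE.
Qed.

Import HBNNSimple.

(** The integral is a supremum over simple functions h below the restriction of f to D. The support
    of such an h is a measurable subset of D, so it lies in D0 up to a null set. *)
Lemma ge0_integral_kernel D0 (f : T -> \bar R) : measurable D0 -> D0 `<=` D ->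
  (forall A, measurable A -> A `<=` D -> mu (A `\` D0) = 0%E) ->
  measurable_fun setT f -> (forall x, (0 <= f x)%E) ->
  (\int[mu]_(x in D) f x = \int[mu]_(x in D0) f x)%E.
Proof.
move=> mD0 D0D D0null mf f0; rewrite integral_mkcond [RHS]integral_mkcond.
have fD0 x : (0 <= (f \_ D) x)%E by rewrite patchE; case: ifPn.
have fD00 x : (0 <= (f \_ D0) x)%E by rewrite patchE; case: ifPn.
apply/eqP; rewrite eq_le; apply/andP; split; last first.
  rewrite !ge0_integralTE//; apply: ereal_sup_le => _ [h hf <-]; exists h => //= x.
  apply: le_trans (hf x) _; rewrite !patchE; case: ifPn => xD0; last by case: ifPn.
  by rewrite mem_set//; apply: D0D; exact: set_mem.
rewrite ge0_integralTE//; apply: ge_ereal_sup => _ [h hf <-].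
have mh : measurable_fun setT (EFin \o h) by exact/measurable_EFinP.
have mS : measurable (h @^-1` [set~ 0]).
  by rewrite -[X in measurable X]setTI; apply: measurable_funP => //; exact: measurableC.
have SD : h @^-1` [set~ 0] `<=` D.
  move=> x /= hx; apply: contrapT => xD; apply: hx.
  have := hf x; rewrite patchE memNset// lee_fin => h0.
  by apply/eqP; rewrite eq_le h0 fun_ge0.
have SN := D0null _ mS SD.
have mSN : measurable (h @^-1` [set~ 0] `\` D0) by exact: measurableD.
rewrite -integralT_nnsfun (ge0_negligible_integral mSN measurableT mh _ SN); last first.
  by move=> x _; rewrite lee_fin.
pose N : set T := h @^-1` [set~ 0] `\` D0.
apply: (@le_trans _ _ (\int[mu]_(x in setT `\` N) (f \_ D0) x)%E).
  apply: ge0_le_integral => //.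
  - exact: measurableD.
  - by move=> x _; rewrite lee_fin.
  - exact: measurable_funTS.
  - by apply: measurable_funTS; apply/(measurable_restrictT _ mD0); exact: measurable_funTS.
  move=> x [_ /= nx]; have [xD0|xD0] := boolP (x \in D0).
    apply: le_trans (hf x) _; rewrite !patchE xD0 mem_set//.
    by apply: D0D; exact: set_mem.
  rewrite patchE (negbTE xD0) lee_fin.
  have [->//|hx] := eqVneq (h x) 0; exfalso; apply: nx; split; first exact/eqP.
  by rewrite notin_setE in xD0.
apply: ge0_subset_integral => //; first exact: measurableD.
by apply/(measurable_restrictT _ mD0); exact: measurable_funTS.
Qed.

Lemma integral_kernel D0 (f : T -> \bar R) : measurable D0 -> D0 `<=` D ->
  (forall A, measurable A -> A `<=` D -> mu (A `\` D0) = 0%E) ->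
  measurable_fun setT f -> (\int[mu]_(x in D) f x = \int[mu]_(x in D0) f x)%E.
Proof.
move=> mD0 D0D D0null mf; rewrite integralE [RHS]integralE.
by congr (_ - _)%E; apply: ge0_integral_kernel => //;
  [exact: measurable_funepos|exact: measurable_funeneg].
Qed.

End measurable_kernel.

Section finite_restriction.
Context d (T : measurableType d) (R : realType) (mu : {measure set T -> \bar R}).
Variables (D : set T) (mD : measurable D) (muD : (mu D < +oo)%E).
Local Notation muD' := (mfrestr mD muD).

Lemma ge0_integral_mfrestr (f : T -> \bar R) : measurable_fun setT f ->
  (forall x, (0 <= f x)%E) -> (\int[muD']_x f x = \int[mu]_(x in D) f x)%E.
Proof.
move=> mf f0; rewrite (@ge0_integral_density _ _ _ mu muD' \1_D)//.
- rewrite [RHS]integral_mkcond; apply: eq_integral => x _; rewrite patchE indicE.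
  by case: (_ \in _); rewrite ?mule1 ?mule0.
- by move=> A mA; rewrite integral_indic// setIC.
Qed.

Lemma Rintegral_mfrestr (f : T -> R) : measurable_fun setT f ->
  \int[muD']_x f x = \int[mu]_(x in D) f x.
Proof.
move=> mf; rewrite /Rintegral; congr fine; rewrite integralE [RHS]integralE.
have mfE : measurable_fun setT (EFin \o f) by exact/measurable_EFinP.
by congr (_ - _)%E; apply: ge0_integral_mfrestr => //;
  [exact: measurable_funepos|exact: measurable_funeneg].
Qed.

End finite_restriction.

(** * Slowly varying functions *)

Section potter.
Context {R : realType}.
Local Notation leb := (@lebesgue_measure R).

Lemma integr_indic_itv (a b : R) : integr leb (\1_`[a, b] : R -> R).
Proof. exact: integrable_indic_itv. Qed.

Lemma Rint_indic_itv (a b : R) : a <= b -> \int[leb]_x (\1_`[a, b] x : R) = b - a.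
Proof.
move=> ab; rewrite /Rintegral integral_indic//= setIT lebesgue_measure_itv/= lte_fin.
move: ab; rewrite le_eqVlt => /predU1P[->|->]; first by rewrite ltxx subrr.
by rewrite -EFinB.
Qed.

Section additive.
Variable h : R -> R.
Hypothesis mh : measurable_fun setT h.
Hypothesis hs : forall s : R, h (u + s) - h u @[u --> +oo] --> (0 : R).

Let dist u s : R := Num.min 1 `|h s - h u|.

(* [I] tends to 0 by dominated convergence, and [dist u v <= I u + I v] for v in
   [u, u + 1], by averaging the triangle inequality through s over [u + 1, u + 2]. *)
Let I (u : R) : R := \int[leb]_s (dist u s * \1_`[u, u + 2] s).

Let mdist u : measurable_fun setT (dist u).
Proof.
apply: measurable_minr => //; apply: measurableT_comp => //.
exact: measurable_funB.
Qed.

Let dist_ge0 u s : 0 <= dist u s.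
Proof. by rewrite /dist le_min ler01 normr_ge0. Qed.

Let dist_le1 u s : dist u s <= 1.
Proof. by rewrite /dist ge_min lexx. Qed.

Let mI u : measurable_fun setT (fun s => dist u s * \1_`[u, u + 2] s).
Proof. by apply: measurable_funM => //; exact: measurable_indic. Qed.

Let iI u : integr leb (fun s => dist u s * \1_`[u, u + 2] s).
Proof.
apply: (@le_integr _ _ _ leb _ (\1_`[u, u + 2] : R -> R)).
- exact: mI.
- exact: integr_indic_itv.
move=> s; rewrite normrM (ger0_norm (dist_ge0 _ _)) [X in _ * X]ger0_norm//.
by rewrite ler_piMl.
Qed.

Let I_shift u : I u = \int[leb]_s (dist u (s + u) * \1_`[0, 2] s).
Proof.
rewrite /I /Rintegral (@ge0_integral_affine R 1 u)//.
- rewrite mul1e; congr fine; apply: eq_integral => s _; rewrite mul1r !indicE.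
  congr (_ * _%:R)%:E; congr nat_of_bool; apply/idP/idP;
  by rewrite !inE/= !in_itv/= lerDr addrC lerD2l.
- exact/measurable_EFinP.
- by move=> s; rewrite lee_fin mulr_ge0.
Qed.

Let I_small : exists N : R, forall u, N <= u -> I u < 1 / 4.
Proof.
apply: contrapT => nE.
(* Dominated convergence is about sequences, so the claim is refuted along a sequence u n >= n with
   I (u n) >= 1 / 4. *)
have /choice[u uP] (n : nat) : exists u : R, n%:R <= u /\ 1 / 4 <= I u.
  apply: contrapT => nex; apply: nE; exists n%:R => u nu; rewrite ltNge; apply/negP => Iu.
  by apply: nex; exists u.
have uy : u n @[n --> \oo] --> +oo.
  apply/cvgryPge => A; exists (Num.truncn A).+1 => // n /= An.
  apply: le_trans (proj1 (uP n)); apply: (le_trans (ltW (truncnS_gt _))).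
  by rewrite ler_nat.
have [||||_ cv] := @Rint_dominated _ _ _ leb
  (fun n s => dist (u n) (s + u n) * \1_`[0, 2] s) (fun=> 0) (\1_`[0, 2] : R -> R).
- move=> n; apply: measurable_funM; last exact: measurable_indic.
  by apply: (measurableT_comp (mdist _)); exact: measurable_funD.
- move=> s.
  have c1 : `|h (u n + s) - h (u n)| @[n --> \oo] --> (0 : R).
    rewrite -(normr0 R); apply: cvg_norm.
    exact: (cvg_comp _ _ uy (hs s)).
  apply/cvgr0Pnorm_le => e e0; move/cvgr0Pnorm_le : c1 => /(_ e e0).
  apply: filterS => n /=; rewrite normr_id => le_e.
  rewrite ger0_norm ?mulr_ge0//; apply: (@le_trans _ _ (dist (u n) (s + u n))).
    by rewrite ler_piMr// indicE; case: (_ \in _).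
  by rewrite /dist ge_min (addrC s) le_e orbT.
- exact: integr_indic_itv.
- move=> n s; rewrite normrM (ger0_norm (dist_ge0 _ _)) [X in _ * X]ger0_norm//.
  by rewrite ler_piMl.
move: cv; rewrite Rintegral_cst// mul0r => /cvgr0Pnorm_lt /(_ (1 / 4)) [].
  by rewrite divr_gt0.
move=> n _ /(_ n (leqnn n)) /=; rewrite -I_shift => hlt.
have := le_lt_trans (ler_norm _) hlt; rewrite ltNge; apply/negP/negPn.
by case: (uP n).
Qed.

Let locally_bounded : exists N : R, forall u v, N <= u -> u <= v <= u + 1 ->
  `|h v - h u| <= 1.
Proof.
have [N NI] := I_small; exists N => u v Nu /andP[uv vu].
have Nv : N <= v by exact: le_trans Nu uv.
pose a := dist u v.
have : a <= I u + I v.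
  rewrite /I -RintD//.
  (* The interval [u + 1, u + 2] has length 1 and lies in both [u, u + 2] and [v, v + 2]. *)
  have <- : \int[leb]_s (a * \1_`[u + 1, u + 2] s) = a.
    rewrite RintZ; last exact: integr_indic_itv.
    have -> : \int[leb]_x (\1_`[u + 1, u + 2] x : R) = 1.
      have u12 : u + 1 <= u + 2 by lra.
      rewrite (Rint_indic_itv u12); ring.
    by rewrite mulr1.
  apply: le_Rintegral => //.
  - by apply: integrZ; exact: integr_indic_itv.
  - exact: integrD (iI u) (iI v).
  move=> s _; rewrite !indicE.
  have [|_] := boolP (s \in `[u + 1, u + 2]%classic); last first.
    by rewrite mulr0 addr_ge0// mulr_ge0//.
  rewrite inE/= in_itv/= => /andP[us su].
  rewrite !mem_set ?mulr1//=; last 2 first.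
  - by rewrite in_itv/=; apply/andP; split; lra.
  - by rewrite in_itv/=; apply/andP; split; lra.
  rewrite /a /dist.
  have tri : `|h v - h u| <= `|h s - h u| + `|h s - h v|.
    have -> : h v - h u = (h s - h u) - (h s - h v) by ring.
    exact: ler_normB.
  have n1 := normr_ge0 (h s - h u); have n2 := normr_ge0 (h s - h v).
  rewrite !minEle; case: ifP => c1; case: ifP => c2; case: ifP => c3; lra.
have := NI u Nu; have := NI v Nv => h1 h2 h3.
(* Below 1 the truncation in [dist] is inactive, so a is |h v - h u| itself. *)
have : a < 1 by lra.
by rewrite /a /dist gt_min ltxx /= => /ltW.
Qed.

(** Far out, a unit step changes h by at most e, and the remaining fraction of a step changes it by
    at most 1. *)
Lemma sublinear (e : R) : 0 < e -> exists M C : R, forall u, M <= u ->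
  `|h u| <= e * u + C.
Proof.
move=> e0; have [N hN] := locally_bounded.
have [N' [_ hN']] := (cvgr0Pnorm_le _).1 (hs 1) e e0.
(* M >= 0 bounds by u the number of unit steps from M to u; M > N' makes each of them small. *)
pose M := Num.max 0 (Num.max N (N' + 1)).
have M0 : 0 <= M by rewrite le_max lexx.
have MN : N <= M by rewrite !le_max lexx orbT.
have MN' : N' < M by rewrite !lt_max (ltrDl N' 1) ltr01 !orbT.
have step (n : nat) u : M + n%:R <= u <= M + n%:R + 1 -> `|h u - h M| <= n%:R * e + 1.
  elim: n u => [|n IH] u.
    by rewrite addr0 mul0r add0r => /hN; exact.
  rewrite -natr1 => /andP[u1 u2].
  have h1 : `|h (u - 1) - h M| <= n%:R * e + 1.
    by apply: IH; apply/andP; split; lra.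
  have n0 : 0 <= n%:R :> R by [].
  have h2 : `|h u - h (u - 1)| <= e.
    by have := hN' (u - 1); rewrite subrK; apply; lra.
  have -> : h u - h M = (h u - h (u - 1)) + (h (u - 1) - h M) by ring.
  apply: le_trans (ler_normD _ _) _; lra.
exists M, (1 + `|h M|) => u Mu.
pose n := Num.truncn (u - M).
have uM0 : 0 <= u - M by rewrite subr_ge0.
have /andP[n1 n2] := truncn_itv uM0.
have h1 : `|h u - h M| <= n%:R * e + 1.
  apply: step; apply/andP; split; first by move: n1; rewrite -/n; lra.
  by move: n2; rewrite -/n -natr1; lra.
have h2 : n%:R * e <= e * u.
  rewrite mulrC ler_pM2l//; apply: le_trans n1 _; lra.
have -> : h u = (h u - h M) + h M by ring.
apply: le_trans (ler_normD _ _) _; lra.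
Qed.

End additive.

(** In logarithmic coordinates slow variation says that increments of h over fixed distances vanish
    at infinity; exponentiating |h u| <= e u + C gives both bounds. *)
Lemma potter (L : R -> R) (e : R) : slowly_varying L -> 0 < e ->
  exists A C : R, [/\ 1 <= A, 0 < C & forall t, A <= t ->
    C^-1 * t `^ (- e) <= L t <= C * t `^ e].
Proof.
move=> [[X [X0 mL Lpos]] Ls] e0.
(* The maximum with X keeps the argument where L is measurable and positive, and leaves h unchanged
   near infinity. *)
pose h u := ln (L (Num.max X (expR u))).
have maxX u : X <= Num.max X (expR u) by rewrite le_max lexx.
have mh : measurable_fun setT h.
  apply: measurableT_comp; first exact: measurable_ln.
  apply: (measurable_comp (F := `[X, +oo[%classic)) mL _ => //.
    by move=> _ [u _ <-] /=; rewrite in_itv/= andbT.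
  by apply: measurable_maxr => //; exact: measurable_expR.
have hs s : h (u + s) - h u @[u --> +oo] --> (0 : R).
  have ey : (@expR R) x @[x --> +oo%R] --> +oo%R.
    apply/cvgryPge => A; exists A; split; first exact: num_real.
    move=> u /= Au; apply: (le_trans (ltW Au)); apply: le_trans (expR_ge1Dx _); lra.
  have c1 : L (expR s * expR u) / L (expR u) @[u --> +oo] --> (1 : R).
    exact: (cvg_comp _ _ ey (Ls _ (expR_gt0 s))).
  have c2 : ln (L (expR s * expR u) / L (expR u)) @[u --> +oo] --> (0 : R).
    rewrite -(@ln1 R).
    exact: (continuous_cvg _ (continuous_ln ltr01) c1).
  apply: cvg_trans c2; apply: near_eq_cvg.
  exists (ln X + `|s|); split; first exact: num_real.
  move=> u /= Xu.
  have s1 := ler_norm s; have s2 := ler_norm (- s); rewrite normrN in s2.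
  have e1 : X <= expR u.
    by rewrite -[leLHS]lnK ?posrE// ler_expR; have := normr_ge0 s; lra.
  have e2 : X <= expR (u + s).
    by rewrite -[leLHS]lnK ?posrE// ler_expR; lra.
  have L1 := Lpos _ e1; have L2 := Lpos _ e2.
  by rewrite /h !max_r// -expRD (addrC s) lnM ?posrE ?invr_gt0// lnV ?posrE.
have [M [C hM]] := sublinear mh hs e0.
exists (Num.max 1 (Num.max X (expR M))), (expR C); split.
- by rewrite le_max lexx.
- exact: expR_gt0.
move=> t; rewrite !ge_max => /and3P[t1 Xt Mt].
have t0 : 0 < t by exact: lt_le_trans t1.
have E : L t = expR (h (ln t)).
  by rewrite /h [expR (ln t)]lnK ?posrE// max_r// lnK ?posrE ?Lpos.
have := hM (ln t) _; rewrite -ler_expR lnK ?posrE// => /(_ Mt).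
rewrite ler_norml => /andP[l1 l2].
rewrite E -expRN /powR gt_eqF// -!expRD !ler_expR; apply/andP; split; lra.
Qed.

End potter.

(** * Cubes *)

Section cubes.
Context {R : realType} {d : nat}.
Local Notation mu := (lebesgue_rV R d).
Implicit Types (c x y : 'rV[R]_d) (s : R).

(** The closed ball of the sup norm: its volume is explicit, and the constants lost against
    Euclidean balls do not affect exponents. *)
Definition cube c s := box (c - const_mx s) (c + const_mx s).

Lemma cubeP c s x : cube c s x <-> forall i, `|x ord0 i - c ord0 i| <= s.
Proof.
split=> h i; have := h i; rewrite ?in_itv/= !mxE ler_norml; lra.
Qed.

Lemma measurable_cube c s : measurable (cube c s).
Proof. exact: measurable_box. Qed.

Lemma lebesgue_cube c s : 0 <= s -> mu (cube c s) = ((2 * s) ^+ d)%:E.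
Proof.
move=> s0; rewrite /cube lebesgue_rV_box => [|i]; last by rewrite !mxE; lra.
congr EFin; rewrite -[X in _ ^+ X]card_ord -prodr_const; apply: eq_bigr => i _.
rewrite !mxE; ring.
Qed.

Lemma coord_le_enorm x i : `|x ord0 i| <= enorm x.
Proof.
rewrite -sqrtr_sqr ler_sqrt; last by apply: sumr_ge0 => j _; exact: sqr_ge0.
by rewrite (bigD1 i)//= lerDl sumr_ge0// => j _; exact: sqr_ge0.
Qed.

Lemma enorm_notin_cube c s y : ~ cube c s y -> s <= enorm (y - c).
Proof.
move=> /cubeP /existsNP [i /negP]; rewrite -ltNge => h.
by apply: le_trans (ltW h) _; have := coord_le_enorm (y - c) i; rewrite !mxE.
Qed.

Lemma enormN x : enorm (- x) = enorm x.
Proof. by congr Num.sqrt; apply: eq_bigr => i _; rewrite mxE sqrrN. Qed.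

Lemma enorm_cube s x y : (0 < d)%N -> 0 <= s -> cube 0 s x -> cube 0 s y ->
  enorm (x - y) <= d%:R * (2 * s).
Proof.
move=> d0 s0 /cubeP hx /cubeP hy.
set u := 2 * s; have u0 : 0 <= u by rewrite mulr_ge0.
have d1 : 1 <= d%:R :> R by rewrite ler1n.
have ds : 0 <= d%:R * u by rewrite mulr_ge0.
rewrite -(ger0_norm ds) -sqrtr_sqr ler_sqrt ?sqr_ge0//.
apply: (@le_trans _ _ (\sum_(i < d) u ^+ 2)).
  apply: ler_sum => i _; rewrite -real_normK ?num_real// lerXn2r ?nnegrE ?mulr_ge0//.
  have := hx i; have := hy i; rewrite !mxE !subr0 => h1 h2.
  by apply: le_trans (ler_normB _ _) _; rewrite /u; lra.
rewrite sumr_const card_ord -[u ^+ 2 *+ d]mulr_natl [(d%:R * u) ^+ 2]exprMn.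
apply: ler_wpM2r; first exact: sqr_ge0.
by rewrite expr2 ler_peMr.
Qed.

Lemma cube_gt0 c s : 0 <= s -> (mu (cube c s) < +oo)%E.
Proof. by move=> s0; rewrite lebesgue_cube// ltry. Qed.

(** The shell between the cubes of radii 2^n and 2^(n+1) has volume at most (4 2^n)^d, and phi <= T
    C q^n on it. With w = 2^d q, its integral is at most T C 4^d w^n, and w > 1 makes the geometric
    sum comparable to its last term. *)
Lemma dyadic_bound (phi : 'rV[R]_d -> R) c (T C q : R) :
  measurable_fun setT phi -> (forall y, 0 <= phi y <= T) -> 0 <= C -> 0 < q ->
  1 < 2 ^+ d * q ->
  (forall n y, ~ cube c (2 ^+ n) y -> phi y <= T * C * q ^+ n) -> forall n,
  (\int[mu]_(y in cube c (2 ^+ n)) (phi y)%:E <=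
   (T * (2 ^+ d + C * 4 ^+ d / (2 ^+ d * q - 1)) * (2 ^+ d * q) ^+ n)%:E)%E.
Proof.
move=> mphi phiT C0 q0 w1 hphi; set w := 2 ^+ d * q; set K := 2 ^+ d + _.
have phi0 y : 0 <= phi y by case/andP: (phiT y).
have T0 : 0 <= T by case/andP: (phiT 0) => h1 h2; exact: le_trans h1 h2.
have w0 : 0 < w - 1 by rewrite subr_gt0.
have ws : 0 < w by rewrite (lt_trans _ w1).
have K1 : 0 <= C * 4 ^+ d / (w - 1).
  by rewrite divr_ge0 ?mulr_ge0 ?exprn_ge0// ltW.
(* The term 2^d of K serves the first cube; the other term makes K (w - 1) >= C 4^d, which pays for
   one shell in the induction. *)
have KE : K * (w - 1) = 2 ^+ d * (w - 1) + C * 4 ^+ d.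
  by rewrite /K; field; rewrite gt_eqF.
have mE : measurable_fun setT (EFin \o phi) by exact/measurable_EFinP.
have bnd (A : set 'rV[R]_d) (b : R) : measurable A -> 0 <= b ->
    (forall y, A y -> phi y <= b) -> (\int[mu]_(y in A) (phi y)%:E <= b%:E * mu A)%E.
  move=> mA b0 Ab; rewrite -integral_cst//; apply: ge0_le_integral => //.
  - by move=> y _; rewrite lee_fin.
  - exact: measurable_funTS.
elim=> [|n IH].
  rewrite !expr0 mulr1; apply: le_trans (bnd _ T (measurable_cube _ _) T0 _) _.
    by move=> y _; case/andP: (phiT y).
  rewrite lebesgue_cube// -EFinM lee_fin mulr1 ler_wpM2l// /K lerDl//.
have sub : cube c (2 ^+ n) `<=` cube c (2 ^+ n.+1).
  move=> y /cubeP h; apply/cubeP => i; apply: le_trans (h i) _.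
  by rewrite exprS ler_peMl ?exprn_ge0// ler1n.
rewrite -(setDUK sub).
rewrite ge0_integral_setU//; last 5 first.
- exact: measurable_cube.
- by apply: measurableD; exact: measurable_cube.
- exact: measurable_funTS.
- by move=> y _; rewrite lee_fin.
- by apply/disj_set2P; rewrite setDIK.
have Tq : 0 <= T * C * q ^+ n by rewrite !mulr_ge0// exprn_ge0// ltW.
apply: (@le_trans _ _ ((T * K * w ^+ n)%:E +
    (T * C * q ^+ n)%:E * mu (cube c (2 ^+ n.+1)))%E).
  apply: leeD => //; apply: le_trans (bnd _ _ _ Tq _) _.
  - by apply: measurableD; exact: measurable_cube.
  - by move=> y [_ /hphi].
  - apply: lee_wpmul2l; first by rewrite lee_fin.
    apply: le_measure; rewrite ?inE; [|exact: measurable_cube|exact: subDsetl].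
    by apply: measurableD; exact: measurable_cube.
rewrite lebesgue_cube ?exprn_ge0// -EFinM -EFinD lee_fin.
have -> : T * C * q ^+ n * (2 * 2 ^+ n.+1) ^+ d = T * (C * 4 ^+ d) * w ^+ n.
  have -> : 2 * 2 ^+ n.+1 = 4 * 2 ^+ n :> R by rewrite exprS; ring.
  rewrite /w !exprMn -exprM mulnC exprM; ring.
have -> : T * K * w ^+ n.+1 = T * K * w ^+ n + T * (K * (w - 1)) * w ^+ n.
  by rewrite exprS; ring.
rewrite lerD2l; apply: ler_wpM2r; first by rewrite exprn_ge0// ltW.
apply: ler_wpM2l => //; rewrite KE lerDr mulr_ge0 ?exprn_ge0//; exact: ltW.
Qed.

Lemma interior_cube (A : set 'rV[R]_d) : interior A 0 ->
  exists e : R, 0 < e /\ cube 0 e `<=` A.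
Proof.
move=> /nbhs_ballP [e /= e0 eA]; exists (e / 2); split; first by rewrite divr_gt0.
move=> x /cubeP hx; apply: eA; split=> // i j; rewrite ord1 !mxE /ball/= sub0r normrN.
by have := hx j; rewrite !mxE subr0; lra.
Qed.

Lemma bounded_cube (A : set 'rV[R]_d) : bounded_set A ->
  exists M : R, 0 < M /\ A `<=` cube 0 M.
Proof.
move=> [M [_ hM]]; exists (Num.max M 0 + 1).
have M0 : 0 < Num.max M 0 + 1 by rewrite ltr_wpDl// le_max lexx orbT.
split => // x Ax; have := hM (Num.max M 0 + 1) _ x Ax => /=.
have -> : M < Num.max M 0 + 1 by rewrite ltr_pwDr// le_max lexx.
move=> /(_ isT) xM; apply/cubeP => i; rewrite !mxE subr0.
apply: le_trans xM; rewrite /Num.norm/= mx_normrE.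
exact: (le_bigmax _ (fun ij : 'I_1 * 'I_d => `|x ij.1 ij.2|) (ord0, i)).
Qed.

End cubes.

(** * Convergence in law *)

Section cdf.
Context {R : realType}.
Implicit Types mu nu : probability (measurableTypeR R) R.

Definition rvcdf mu (t : R) : R := fine (mu `]-oo, t]%classic).

Lemma rvcdfE mu t : mu `]-oo, t]%classic = (rvcdf mu t)%:E.
Proof. by rewrite fineK// fin_num_measure. Qed.

Lemma rvcdf_le mu s t : s <= t -> rvcdf mu s <= rvcdf mu t.
Proof.
move=> st; rewrite /rvcdf fine_le ?fin_num_measure//.
by apply: le_measure; rewrite ?inE//; exact: subset_itvl.
Qed.

Lemma rvcdf_right mu (t e : R) : 0 < e -> exists D : R, 0 < D /\ rvcdf mu (t + D) < rvcdf mu t + e.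
Proof.
move=> e0; pose F n : set (measurableTypeR R) := `]-oo, t + n.+1%:R^-1]%classic.
have : (mu \o F) @ \oo --> mu (\bigcap_n F n).
  apply: nonincreasing_cvg_mu; rewrite -?ge0_fin_numE ?fin_num_measure//; rewrite ?/F.
  - exact: measurable_itv.
  - by move=> i; exact: measurable_itv.
  - by apply: bigcapT_measurable => i; exact: measurable_itv.
  - move=> m n mn; apply/subsetPset; apply: subset_itvl; rewrite bnd_simp lerD2l.
    by rewrite lef_pV2 ?posrE// ler_nat.
have -> : \bigcap_n F n = `]-oo, t]%classic.
  apply/seteqP; split => [x xF|x/= xt n _]; last first.
    by move: xt; rewrite /F/= !in_itv/= => xt; rewrite (le_trans xt)// lerDl.
  rewrite /= in_itv/=; apply/ler_addgt0Pr => D D0.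
  have [n nD] := ltr_add_invr D0.
  have := xF n Logic.I; rewrite /F/= in_itv/= => /le_trans; apply.
  by rewrite lerD2l ltW//; move: nD; rewrite add0r.
rewrite rvcdfE => /fine_cvgP [_ /cvgrPdist_lt/(_ _ e0)] [n _ /(_ n (leqnn _)) /= nE].
exists n.+1%:R^-1; split=> //; rewrite -/(rvcdf mu (t + _)) in nE *.
by move: nE; rewrite /F -/(rvcdf _ _) distrC ltr_norml => /andP[_]; rewrite ltrBlDl.
Qed.

Lemma rvcdf_left mu (t e : R) : mu [set t] = 0%E -> 0 < e ->
  exists D : R, 0 < D /\ rvcdf mu t - e < rvcdf mu (t - D).
Proof.
move=> mut e0; pose F n : set (measurableTypeR R) := `]-oo, t - n.+1%:R^-1]%classic.
have mU : measurable (\bigcup_n F n) by apply: bigcupT_measurable => i; exact: measurable_itv.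
have : (mu \o F) @ \oo --> mu (\bigcup_n F n).
  apply: nondecreasing_cvg_mu => //; first by move=> i; exact: measurable_itv.
  move=> m n mn; apply/subsetPset; apply: subset_itvl; rewrite bnd_simp lerD2l lerN2.
  by rewrite lef_pV2 ?posrE// ler_nat.
have -> : mu (\bigcup_n F n) = mu `]-oo, t]%classic.
  have -> : `]-oo, t]%classic = (\bigcup_n F n) `|` [set t].
    apply/seteqP; split => [x|x].
      rewrite /= in_itv/= le_eqVlt => /predU1P[->|xt]; [by right|left].
      have [n nD] := ltr_add_invr xt; exists n => //.
      by rewrite /F/= in_itv/= lerBrDr ltW.
    move=> [[n _]|->]; rewrite /F/= !in_itv/= //.
    by move=> /le_trans; apply; rewrite gerBl.
  by rewrite measureU0.
rewrite rvcdfE => /fine_cvgP [_ /cvgrPdist_lt/(_ _ e0)] [n _ /(_ n (leqnn _)) /= nE].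
exists n.+1%:R^-1; split=> //.
by move: nE; rewrite /F -/(rvcdf _ _) ltr_norml => /andP[_]; rewrite ltrBlDl ltrBlDr.
Qed.

Definition cdf_continuity mu (t : R) := {for t, continuous (fun s : R => mu `]-oo, s]%classic)}.

Lemma cdf_continuous mu (t : R) : mu [set t] = 0%E -> cdf_continuity mu t.
Proof.
move=> mut; rewrite /cdf_continuity /prop_for/continuous_at rvcdfE.
apply/fine_cvgP; split; first by near=> s; rewrite rvcdfE.
apply/cvgrPdist_lt => e e0.
have [D1 [D10 h1]] := rvcdf_right mu t e0.
have [D2 [D20 h2]] := rvcdf_left mut e0.
apply/nbhs_ballP; exists (Num.min D1 D2); rewrite /= ?lt_min ?D10//.
move=> s; rewrite /ball/= lt_min => /andP[s1 s2]. rewrite -/(rvcdf mu s).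
move: s1 s2. rewrite (@ltr_norml R) (@ltr_norml R) => /andP[s1 _] /andP[_ s2].
have s3 : s <= t + D1 by lra.
have s4 : t - D2 <= s by lra.
by have := rvcdf_le mu s3; have := rvcdf_le mu s4; rewrite ltr_norml; lra.
Unshelve. all: by end_near. Qed.

Lemma atoms_countable mu : countable [set t : R | (0 < mu [set t])%E].
Proof.
(* As a random variable under mu, the identity has law mu, so its mass function is positive exactly
   at the atoms. *)
pose X := HB.pack_for {mfun measurableTypeR R >-> R} (@idfun R)
  (@isMeasurableFun.Build _ _ (measurableTypeR R) R (@idfun R)
    (@measurable_id _ _ setT)).
have -> : [set t : R | (0 < mu [set t])%E] = [set r | 0 < pmf (P := mu) X r].
  apply/seteqP; split=> t /=; rewrite /pmf preimage_id.
    by move=> h; apply: fine_gt0; rewrite h -ge0_fin_numE// fin_num_measure.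
  by move=> h; rewrite -(@fineK _ (mu _)) ?fin_num_measure// lte_fin.
exact: pmf_gt0_countable.
Qed.

(** The atoms of both laws form a countable set, which has Lebesgue measure 0 and cannot contain the
    interval. *)
Lemma continuity_point mu nu (a b : R) : a < b ->
  exists t : R, [/\ a < t < b, mu [set t] = 0%E & nu [set t] = 0%E].
Proof.
move=> ab; apply: contrapT => no.
have sub : `]a, b[%classic `<=` [set t : R | (0 < mu [set t])%E] `|` [set t : R | (0 < nu [set t])%E].
  move=> t; rewrite /= in_itv/= => tab; apply: contrapT => /not_orP[h1 h2]; apply: no.
  exists t; split=> //; apply/eqP; rewrite eq_le measure_ge0 andbT leNgt; exact/negP.
rewrite -bigcup2E in sub.
have cU : countable (\bigcup_i bigcup2 [set t : R | (0 < mu [set t])%E] [set t : R | (0 < nu [set t])%E] i).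
  apply: bigcup_countable => // -[|[|i]] _ /=;
    [exact: atoms_countable|exact: atoms_countable|exact: countable0].
have := countable_lebesgue_measure0 (sub_countable (subset_card_le sub) cU).
rewrite lebesgue_measure_itv/= lte_fin ab -EFinB => -[] /eqP.
by rewrite subr_eq0 gt_eqF.
Qed.

Lemma rvcdf_unique mu nu : rvcdf mu =1 rvcdf nu -> forall A, measurable A -> mu A = nu A.
Proof.
move=> mnE A mA; apply: (@measure_unique _ R (measurableTypeR R) (@RGenOInfty.G R)
  (fun n => `](- n%:R), +oo[%classic)).
- exact: RGenOInfty.measurableE.
- move=> _ _ [x ->] [y ->]; exists (Num.max x y).
  by apply/seteqP; split => z /=; rewrite !in_itv/= !andbT gt_max; [move=> [-> ->]|move=> /andP[-> ->]].
- by move=> n; exists (- n%:R).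
- apply/seteqP; split => // x _; exists (Num.trunc `|x|).+1 => //.
  rewrite /= in_itv/= andbT ltrNl; apply: le_lt_trans (truncnS_gt _).
  by rewrite -normrN ler_norm.
- move=> _ [x ->]; have -> : `]x, +oo[%classic = ~` `]-oo, x]%classic by rewrite setCitvl.
  have ray := @measurable_itv R `]-oo, x].
  by rewrite [LHS]probability_setC// [RHS]probability_setC// !rvcdfE mnE.
- by move=> n; rewrite (le_lt_trans (probability_le1 _ _))// ltry.
- exact: mA.
Qed.

End cdf.

Section limit_law.
Context {R : realType} {dO : measure_display} {Om : measurableType dO}.
Variable P : probability Om R.
Implicit Types mu nu : probability (measurableTypeR R) R.
Implicit Types X Y : R -> Om -> R.

(** The distribution functions agree at common continuity points, which are dense, and right
    continuity does the rest. *)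
Lemma cvg_law_unique X mu nu : cvg_law P X mu -> cvg_law P X nu ->
  forall A, measurable A -> mu A = nu A.
Proof.
move=> Xmu Xnu; apply: rvcdf_unique.
have same (t : R) : mu [set t] = 0%E -> nu [set t] = 0%E -> rvcdf mu t = rvcdf nu t.
  move=> h1 h2; apply: EFin_inj; rewrite -!rvcdfE.
  by apply: cvg_unique (Xmu t (cdf_continuous h1)) (Xnu t (cdf_continuous h2)).
have half (m1 m2 : probability (measurableTypeR R) R) :
    (forall t : R, m1 [set t] = 0%E -> m2 [set t] = 0%E -> rvcdf m1 t = rvcdf m2 t) ->
    forall t, rvcdf m1 t <= rvcdf m2 t.
  move=> h t; apply/ler_addgt0Pr => e e0.
  have [D [D0 hD]] := rvcdf_right m2 t e0.
  have tD : t < t + D by rewrite ltrDl.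
  have [s [/andP[s1 s2] a1 a2]] := continuity_point m1 m2 tD.
  apply: le_trans (rvcdf_le m1 (ltW s1)) _; rewrite h//.
  exact: le_trans (rvcdf_le m2 (ltW s2)) (ltW hD).
move=> t; apply: le_anti; rewrite !half//.
by move=> s h1 h2; rewrite same.
Qed.

(** P (Y <= t) is squeezed between values of the distribution function of X at two continuity points
    t1 < t < t2, up to the probability of a gap. Measurability is asked only for large r because the
    functionals are controlled only there. *)
Lemma slutsky X Y mu :
  (\forall r \near +oo, measurable_fun setT (X r) /\ measurable_fun setT (Y r)) ->
  (forall e : R, 0 < e ->
    fine (P [set o | e < `|X r o - Y r o|]) @[r --> +oo] --> 0) ->
  cvg_law P X mu -> cvg_law P Y mu.
Proof.
move=> mXY XY Xmu t ct.
have arith (x x1 x2 y1 y2 z q e : R) : `|x - x1| < e / 3 -> `|x - x2| < e / 3 ->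
    `|x1 - y1| < e / 3 -> `|x2 - y2| < e / 3 -> `|0 - q| < e / 3 ->
    z <= y2 + q -> y1 <= z + q -> `|x - z| <= e.
  rewrite !ltr_norml ler_norml => /andP[? ?] /andP[? ?] /andP[? ?]
    /andP[? ?] /andP[? ?] ? ?.
  apply/andP; split; lra.
 rewrite rvcdfE; apply/fine_cvgP; split.
  near=> r; apply: fin_num_measure.
  have [_ mY] : measurable_fun setT (X r) /\ measurable_fun setT (Y r) by near: r.
  by rewrite -[X in measurable X]setTI; exact: mY.
apply/cvgrPdist_le => e e0.
have e3 : 0 < e / 3 by rewrite divr_gt0.
have Fc : {for t, continuous (rvcdf mu)}.
  by move: ct; rewrite /prop_for/continuous_at rvcdfE => /fine_cvgP[].
have [D /= D0 hD] : exists2 D, 0 < D & forall s, `|t - s| < D -> `|rvcdf mu t - rvcdf mu s| < e / 3.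
  by move/cvgrPdist_lt: Fc => /(_ _ e3) /nbhs_ballP [D D0 hD]; exists D.
have tD1 : t - D < t by rewrite gtrBl.
have tD2 : t < t + D by rewrite ltrDl.
have [t1 [/andP[t1a t1b] m1 _]] := continuity_point mu mu tD1.
have [t2 [/andP[t2a t2b] m2 _]] := continuity_point mu mu tD2.
have F1 : `|rvcdf mu t - rvcdf mu t1| < e / 3 by apply: hD; rewrite ltr_norml; lra.
have F2 : `|rvcdf mu t - rvcdf mu t2| < e / 3 by apply: hD; rewrite ltr_norml; lra.
have cX (s : R) : mu [set s] = 0%E -> fine (P (X r @^-1` `]-oo, s]%classic)) @[r --> +oo] --> rvcdf mu s.
  by move=> h; have := Xmu s (cdf_continuous h); rewrite rvcdfE => /fine_cvgP[].
(* If |X - Y| <= D', then Y <= t implies X <= t2, and X <= t1 implies Y <= t. *)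
pose D' := Num.min (t - t1) (t2 - t).
have D'0 : 0 < D' by rewrite /D' lt_min; apply/andP; split; lra.
have D'1 : D' <= t - t1 by rewrite /D' ge_min lexx.
have D'2 : D' <= t2 - t by rewrite /D' ge_min lexx orbT.
near=> r; rewrite /=.
have [mX mY] : measurable_fun setT (X r) /\ measurable_fun setT (Y r) by near: r.
have mpre (Z : Om -> R) s : measurable_fun setT Z -> measurable (Z @^-1` `]-oo, s]%classic).
  by move=> mZ; rewrite -[X in measurable X]setTI; exact: mZ.
have mE : measurable [set o | D' < `|X r o - Y r o|].
  rewrite -[X in measurable X]setTI.
  have mN : measurable_fun setT (fun o => `|X r o - Y r o|).
    by apply: (measurableT_comp (@normr_measurable R setT)); exact: measurable_funB.
  exact: (measurable_fun_ltr (measurable_cst D') mN).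
have c1 : `|rvcdf mu t1 - fine (P (X r @^-1` `]-oo, t1]%classic))| < e / 3.
  by near: r; move/cvgrPdist_lt: (cX t1 m1); apply.
have c2 : `|rvcdf mu t2 - fine (P (X r @^-1` `]-oo, t2]%classic))| < e / 3.
  by near: r; move/cvgrPdist_lt: (cX t2 m2); apply.
have c3 : `|0 - fine (P [set o | D' < `|X r o - Y r o|])| < e / 3.
  by near: r; move/cvgrPdist_lt: (XY _ D'0); apply.
have sub (A B : set Om) : measurable A -> measurable B ->
    A `<=` B `|` [set o | D' < `|X r o - Y r o|] ->
    fine (P A) <= fine (P B) + fine (P [set o | D' < `|X r o - Y r o|]).
  move=> mA mB AB; rewrite -fineD ?fin_num_measure//.
  rewrite fine_le ?fin_numD ?fin_num_measure//.
  by apply: le_trans (measureU2 P mB mE); apply: le_measure; rewrite ?inE//; exact: measurableU.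
have u1 : fine (P (Y r @^-1` `]-oo, t]%classic)) <= fine (P (X r @^-1` `]-oo, t2]%classic)) +
    fine (P [set o | D' < `|X r o - Y r o|]).
  apply: sub; [exact: mpre|exact: mpre|move=> o /=; rewrite !in_itv/= => h].
  case: (leP (X r o) t2) => h2; [by left|right]; rewrite ltr_normr; apply/orP; left.
  by apply: le_lt_trans D'2 _; exact: ltr_leB.
have u2 : fine (P (X r @^-1` `]-oo, t1]%classic)) <= fine (P (Y r @^-1` `]-oo, t]%classic)) +
    fine (P [set o | D' < `|X r o - Y r o|]).
  apply: sub; [exact: mpre|exact: mpre|move=> o /=; rewrite !in_itv/= => h].
  case: (leP (Y r o) t) => h2; [by left|right]; rewrite ltr_normr; apply/orP; right.
  by rewrite opprB; apply: le_lt_trans D'1 _; exact: ltr_leB.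
exact: arith F1 F2 c1 c2 c3 u1 u2.
Unshelve. all: by end_near. Qed.

Lemma chebyshev_sq (Z : Om -> R) (e : R) : sqi P Z -> 0 < e ->
  fine (P [set o | e < `|Z o|]) <= (e ^+ 2)^-1 * \int[P]_o (Z o ^+ 2).
Proof.
move=> sZ e0; set A := [set o | _].
have mZ := sZ.1.
have mA : measurable A.
  rewrite -[X in measurable X]setTI.
  have mN : measurable_fun setT (fun o => `|Z o|) by exact: (measurableT_comp (@normr_measurable R setT)).
  exact: (measurable_fun_ltr (measurable_cst e) mN).
have iA : integr P (\1_A : Om -> R).
  apply: (@integr_bounded _ _ _ P _ 1) => [|x]; first exact: measurable_indic.
  by rewrite indicE; case: (_ \in _); rewrite ?normr0 ?normr1.
have -> : fine (P A) = \int[P]_o (\1_A o : R).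
  by rewrite /Rintegral integral_indic// setIT.
rewrite ler_pdivlMl ?exprn_gt0// -RintZ//.
apply: le_Rintegral => //; [exact: integrZ|exact: sZ.2|move=> o _].
rewrite indicE; have [h|h] := boolP (o \in A); last by rewrite mulr0 sqr_ge0.
move: h; rewrite mulr1 inE /A/= => h.
by rewrite -(real_normK (num_real (Z o))) lerXn2r ?nnegrE// ltW.
Qed.

End limit_law.

(** * The covariance of the field *)

Lemma enorm0 (R : realType) n : enorm (0 : 'rV[R]_n) = 0.
Proof. by rewrite /enorm big1 ?sqrtr0// => i _; rewrite mxE expr0n. Qed.

Lemma enorm_gt0 (R : realType) n (x : 'rV[R]_n) : x != 0 -> 0 < enorm x.
Proof.
move=> x0; have [i xi] : exists i, x ord0 i != 0.
  apply: contrapT => /forallNP h; move/negP: x0; apply; apply/eqP/rowP => i.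
  by rewrite mxE; apply/eqP; apply: contrapT => /negP /h.
by rewrite (lt_le_trans _ (coord_le_enorm x i))// normr_gt0.
Qed.

Section covariance.
Context {R : realType} {dO : measure_display} {Om : measurableType dO}.
Variables (P : probability Om R) (d p : nat) (eta : 'rV[R]_d -> Om -> 'rV[R]_p).
Variable rho : R -> R.
Hypothesis eta_measurable : measurable_field eta.
Hypothesis eta_gaussian : gaussian_field P eta.
Hypothesis eta_mean : forall x i, ('E_P[(fun o => eta x o ord0 i)%R] = 0)%E.
Hypothesis eta_cross : forall x y,
  cross_moment P (eta x) (eta y) = map_mx EFin (rho (enorm (y - x)))%:M.
Hypothesis rho0 : rho 0 = 1.

Lemma measurable_eta x : measurable_fun setT (eta x).
Proof. exact: (measurableT_comp eta_measurable (measurable_pair1 x)). Qed.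

Lemma measurable_eta_coord x i : measurable_fun setT (fun o => eta x o ord0 i).
Proof. exact: (measurableT_comp (measurable_coord_rV i) (measurable_eta x)). Qed.

Lemma sqi_eta x i : sqi P (fun o => eta x o ord0 i).
Proof.
have mx := measurable_eta_coord x i; split => //.
have : cross_moment P (eta x) (eta x) i i = 1%:E.
  by rewrite eta_cross subrr enorm0 rho0 !mxE eqxx.
rewrite !mxE unlock => h; apply/integrableP; split.
  by apply/measurable_EFinP; exact: measurable_funX.
under eq_integral => o _ do rewrite /= ger0_norm ?sqr_ge0// expr2.
by rewrite h ltry.
Qed.

Lemma mean_eta x i : \int[P]_o eta x o ord0 i = 0.
Proof. by have := eta_mean x i; rewrite unlock /Rintegral => ->. Qed.

Lemma cov_eta x y i j :
  \int[P]_o (eta x o ord0 i * eta y o ord0 j) = rho (enorm (y - x)) *+ (i == j).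
Proof.
have : cross_moment P (eta x) (eta y) i j = (rho (enorm (y - x)) *+ (i == j))%:E.
  by rewrite eta_cross !mxE.
by rewrite mxE unlock /Rintegral => ->.
Qed.

Lemma sqi_lform_eta t x : sqi P (fun o => lform t (eta x o)).
Proof. by apply: sqi_sum => i _; apply: sqiZ; exact: sqi_eta. Qed.

Lemma cov_lform_eta t u x y : \int[P]_o (lform t (eta x o) * lform u (eta y o)) =
  rho (enorm (y - x)) * lform t u.
Proof.
have -> : (fun o => lform t (eta x o) * lform u (eta y o)) = (fun o =>
    \sum_i \sum_j (t ord0 i * u ord0 j) * (eta x o ord0 i * eta y o ord0 j)).
  apply/funext => o; rewrite /lform big_distrl; apply: eq_bigr => i _.
  by rewrite big_distrr; apply: eq_bigr => j _; rewrite mulrACA.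
have iS i j : integr P (fun o => t ord0 i * u ord0 j * (eta x o ord0 i * eta y o ord0 j)).
  by apply: integrZ; apply: sqiM; exact: sqi_eta.
rewrite Rint_sum => [|i _]; last exact: integr_sum.
rewrite /lform big_distrr; apply: eq_bigr => i _.
rewrite Rint_sum// (bigD1 i)//= big1 => [|j ji]; last first.
  by rewrite RintZ; [rewrite cov_eta eq_sym (negbTE ji) mulr0n mulr0|apply: sqiM; exact: sqi_eta].
rewrite addr0 RintZ; last by apply: sqiM; exact: sqi_eta.
by rewrite cov_eta eqxx mulr1n mulrC.
Qed.

Lemma expectationE (f : Om -> R) : integr P f -> 'E_P[f]%E = (\int[P]_o f o)%:E.
Proof. by move=> i; rewrite unlock /Rintegral fineK//; exact: integrable_fin_num i. Qed.

(** A linear form in two values of the field is a centred Gaussian variable, and its variance is the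
    quadratic form in the exponent. The case x = y is included, thanks to rho 0 = 1. *)
Lemma eta_characteristic x y t u c :
  \int[P]_o cos (lform t (eta x o) + lform u (eta y o) + c) =
  expR (- ((\sum_i t ord0 i ^+ 2 + \sum_i u ord0 i ^+ 2 +
            2 * rho (enorm (y - x)) * lform t u) / 2)) * cos c.
Proof.
pose X o := lform t (eta x o) + lform u (eta y o).
have sX : sqi P X by apply: sqiD; exact: sqi_lform_eta.
have selfE v : lform v v = \sum_i v ord0 i ^+ 2 :> R.
  by apply: eq_bigr => i _; rewrite expr2.
have m0 v z : \int[P]_o lform v (eta z o) = 0.
  rewrite Rint_sum => [|i _]; last by apply: integrZ; apply: sqi_integr; exact: sqi_eta.
  rewrite big1// => i _; rewrite RintZ ?mean_eta ?mulr0//.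
  by apply: sqi_integr; exact: sqi_eta.
apply: (@characteristic_gaussian _ _ _ P X) => //.
- exact: sX.1.
- have := eta_gaussian (fun i : 'I_2 => if i == ord0 then x else y)
    (fun i : 'I_2 => if i == ord0 then t else u).
  congr gaussian_rv; apply/funext => o.
  by rewrite big_ord_recl big_ord1.
- rewrite expectationE; last exact: sqi_integr.
  by rewrite RintD ?m0 ?addr0//; apply: sqi_integr; exact: sqi_lform_eta.
- rewrite expectationE; last exact: sX.2.
  rewrite Rint_sqD; [|exact: sqi_lform_eta|exact: sqi_lform_eta].
  have sq v z : \int[P]_o (lform v (eta z o) ^+ 2) = \sum_i v ord0 i ^+ 2.
    have -> : (fun o => lform v (eta z o) ^+ 2) =
        (fun o => lform v (eta z o) * lform v (eta z o)).
      by apply/funext => o; rewrite expr2.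
    by rewrite cov_lform_eta subrr enorm0 rho0 mul1r selfE.
  by rewrite !sq cov_lform_eta; congr EFin; ring.
Qed.

(** A coordinate, which exists since p > 0, has variance 1 everywhere, so Cauchy-Schwarz bounds its
    covariance. *)
Lemma rho_le1 (p_gt0 : (0 < p)%N) (x y : 'rV[R]_d) : `|rho (enorm (y - x))| <= 1.
Proof.
pose i := Ordinal p_gt0.
have := @cauchy_schwarz _ _ _ P _ _ (sqi_eta x i) (sqi_eta y i).
have sq z : \int[P]_o (eta z o ord0 i ^+ 2) = 1.
  have -> : (fun o => eta z o ord0 i ^+ 2) = (fun o => eta z o ord0 i * eta z o ord0 i).
    by apply/funext => o; rewrite expr2.
  by rewrite cov_eta subrr enorm0 rho0 eqxx.
rewrite !sq mulr1 cov_eta eqxx mulr1n => h.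
by rewrite -(@expr_le1 _ 2)// real_normK// num_real.
Qed.

End covariance.

Lemma stationary_covariance {R : realType} {dO : measure_display} {Om : measurableType dO}
    (P : probability Om R) (d p : nat) (eta : 'rV[R]_d -> Om -> 'rV[R]_p) (rho : R -> R) :
  homogeneous_isotropic P eta ->
  cross_moment P (eta 0) (eta 0) = map_mx EFin 1%:M ->
  (forall x : 'rV[R]_d, x != 0 ->
    cross_moment P (eta 0) (eta x) = map_mx EFin (rho (enorm x))%:M) ->
  rho 0 = 1 -> forall x y,
  cross_moment P (eta x) (eta y) = map_mx EFin (rho (enorm (y - x)))%:M.
Proof.
move=> hom h0 hx rho0 x y.
rewrite (hom x y 0 (y - x)); last by rewrite sub0r enormN -enormN opprB.
have [->|xy] := eqVneq (y - x) 0; last exact: hx.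
by rewrite enorm0 rho0.
Qed.

Lemma pow2_between {R : realType} (a : R) : 1 <= a ->
  exists n, a <= 2 ^+ n <= 2 * a.
Proof.
move=> a1; have ex : exists n, a <= 2 ^+ n.
  exists (Num.trunc a).+1; apply: le_trans (ltW (truncnS_gt a)) _.
  by rewrite -natrX ler_nat ltnW// ltn_expl.
have [n an nmin] := ex_minnP ex; exists n; rewrite an/=.
case: n an nmin => [|n] an nmin; first by rewrite expr0; lra.
rewrite exprS; apply: ler_wpM2l => //; rewrite leNgt; apply/negP => /ltW /nmin.
by rewrite ltnn.
Qed.

Lemma measurable_enorm {R : realType} n : measurable_fun setT (@enorm R n).
Proof.
have ms : measurable_fun setT (@Num.sqrt R).
  by apply: continuous_measurable_fun; exact: sqrt_continuous.
apply: (measurableT_comp ms).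
by apply: measurable_sum => i _; exact: (measurable_funX 2 (measurable_coord_rV i)).
Qed.

Lemma measurable_subr_rV {R : realType} n (x : 'rV[R]_n) :
  measurable_fun setT (fun y : 'rV[R]_n => y - x).
Proof.
apply/measurable_fun_rVP => i; under eq_fun do rewrite !mxE.
by apply: measurable_funB => //; exact: measurable_coord_rV.
Qed.

(** * Power bounds on the covariance *)

Section covariance_decay.
Context {R : realType} (d : nat).
Local Notation mu := (lebesgue_rV R d).
Variables (rho L : R -> R) (alpha : R).
Hypothesis d_gt0 : (0 < d)%N.
Hypothesis rhoE : forall t, 0 < t -> rho t = t `^ (- alpha) * L t.
Hypothesis rho_bounded : forall z : 'rV[R]_d, `|rho (enorm z)| <= 1.
Hypothesis L_slow : slowly_varying L.

(** L is measurable only near infinity, so the powers of rho are replaced by an explicit measurable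
    majorant phi with phi t <= K t^(-beta) for t >= 1, and [dyadic_bound] integrates phi around each
    x. *)
Lemma covariance_upper (k : nat) (beta M : R) : (0 < k)%N -> 0 < beta < d%:R ->
  beta < alpha * k%:R -> 1 <= M ->
  exists (phi : R -> R) (C : R), [/\ measurable_fun setT phi,
    forall t, 0 <= phi t <= 1,
    forall z : 'rV[R]_d, `|rho (enorm z)| ^+ k <= phi (enorm z),
    0 < C &
    forall r x, 1 <= r -> cube 0 (M * r) x ->
      (\int[mu]_(y in cube (0 : 'rV[R]_d) (M * r)) (phi (enorm (y - x)))%:E <=
       (C * r `^ (d%:R - beta))%:E)%E].
Proof.
move=> k0 /andP[beta0 betad] betak M1.
have kR : 0 < k%:R :> R by rewrite ltr0n.
(* With this exponent Potter's bound gives |rho t|^k <= C^k t^(- beta) for t >= A. *)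
pose e := alpha - beta / k%:R.
have e0 : 0 < e by rewrite /e subr_gt0 ltr_pdivrMr.
have [A [C [A1 C0 pot]]] := potter L_slow e0.
(* C^k serves t >= A; for 1 < t < A, the bound |rho| <= 1 suffices because A^beta t^(-beta) >= 1. *)
pose K := C ^+ k + A `^ beta.
have A0 : 0 < A by lra.
have Ab1 : 1 <= A `^ beta by have := ler_powR A1 (ltW beta0); rewrite powRr0.
have Ck : 0 <= C ^+ k by rewrite exprn_ge0// ltW.
have K1 : 1 <= K by rewrite /K; lra.
have K0 : 0 <= K by lra.
pose phi t := Num.min 1 (K * (Num.max 1 t) `^ (- beta)).
have phi01 t : 0 <= phi t <= 1.
  by rewrite /phi ge_min lexx le_min ler01 mulr_ge0// powR_ge0.
have mphi : measurable_fun setT phi.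
  apply: measurable_minr => //; apply: measurable_funM => //.
  apply: (measurableT_comp (measurable_powR _)).
  exact: measurable_maxr.
have phirho (z : 'rV[R]_d) : `|rho (enorm z)| ^+ k <= phi (enorm z).
  have rk1 : `|rho (enorm z)| ^+ k <= 1 by apply: exprn_ile1 => //; exact: rho_bounded.
  rewrite /phi le_min rk1/=; set t := enorm z in rk1 *.
  have [t1|t1] := leP t 1.
    by rewrite powR1 mulr1; lra.
  have t0 : 0 < t by lra.
  have tb : 0 <= t `^ (- beta) by rewrite powR_ge0.
  have [tA|tA] := leP A t; last first.
    apply: le_trans rk1 _.
    have h : 1 <= A `^ beta * t `^ (- beta).
      rewrite powRN -(divff (lt0r_neq0 (powR_gt0 beta t0))).
      by apply: ler_wpM2r; [rewrite invr_ge0 powR_ge0|apply: ge0_ler_powR; rewrite ?nnegrE; lra].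
    apply: le_trans h _; apply: ler_wpM2r => //; rewrite /K; lra.
  have /andP[L1 L2] := pot _ tA.
  have L0 : 0 <= L t by apply: le_trans L1; rewrite mulr_ge0 ?powR_ge0// invr_ge0 ltW.
  apply: (@le_trans _ _ ((C * t `^ (- (beta / k%:R))) ^+ k)).
    apply: lerXn2r; rewrite ?nnegrE//; first by rewrite mulr_ge0 ?powR_ge0// ltW.
    rewrite rhoE// ger0_norm ?mulr_ge0 ?powR_ge0//.
    apply: le_trans (ler_wpM2l (powR_ge0 _ _) L2) _.
    rewrite mulrCA -powRD; last by apply/implyP => _; rewrite gt_eqF.
    by rewrite /e (_ : - alpha + (alpha - beta / k%:R) = - (beta / k%:R)); last ring.
  rewrite exprMn -(powR_mulrn k (powR_ge0 _ _)) -powRrM.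
  have -> : - (beta / k%:R) * k%:R = - beta by field; rewrite gt_eqF.
  by apply: ler_wpM2r => //; rewrite /K; lra.
(* Doubling the radius multiplies the volume by 2^d and the bound on phi by q; the product w = 2^(d
   - beta) exceeds 1 because beta < d. *)
pose q : R := 2 `^ (- beta); pose w := 2 ^+ d * q.
have two0 : (2 : R) != 0 by [].
have wE : w = 2 `^ (d%:R - beta).
  by rewrite /w /q -powR_mulrn// -powRD//; apply/implyP.
have w1 : 1 < w.
  have db : 0 < d%:R - beta by rewrite subr_gt0.
  have := @gt0_ltr_powR R _ db 1 2; rewrite powR1 wE; apply; rewrite ?nnegrE//.
  exact: ltr1n.
have q0 : 0 < q by rewrite powR_gt0.
pose B := 2 ^+ d + K * 4 ^+ d / (w - 1).
have B0 : 0 < B.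
  have : 0 <= K * 4 ^+ d / (w - 1) by rewrite divr_ge0 ?mulr_ge0 ?exprn_ge0//; lra.
  by have : 0 < 2 ^+ d :> R by [rewrite exprn_gt0]; rewrite /B; lra.
exists phi, (B * (4 * M) `^ (d%:R - beta)); split => //.
  by rewrite mulr_gt0// powR_gt0//; lra.
move=> r x r1 xr.
have Mr1 : 1 <= M * r by rewrite -(mulr1 1) ler_pM.
(* The cube of radius 2^n >= 2 M r around x contains the cube of radius M r around 0, and 2^n <= 4 M
   r bounds the cost. *)
have [n /andP[n1 n2]] := @pow2_between R (2 * (M * r)) ltac:(lra).
have mpx : measurable_fun setT (fun y : 'rV[R]_d => phi (enorm (y - x))).
  apply: (measurableT_comp mphi); apply: (measurableT_comp (@measurable_enorm R d)).
  exact: measurable_subr_rV.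
have off m y : ~ cube x (2 ^+ m) y -> phi (enorm (y - x)) <= 1 * K * q ^+ m.
  move=> /enorm_notin_cube; set t := enorm _ => tm.
  have m1 : 1 <= 2 ^+ m :> R by rewrite exprn_ege1// ler1n.
  rewrite /phi ge_min mul1r; apply/orP; right; apply: ler_wpM2l => //.
  have -> : Num.max 1 t = t by apply/max_idPr; lra.
  rewrite /q -powR_mulrn ?powR_ge0// -powRrM mulrC powRrM powR_mulrn//.
  have p1 : 0 < (2 ^+ m) `^ beta by apply: powR_gt0; lra.
  have p2 : 0 < t `^ beta by apply: powR_gt0; lra.
  rewrite !powRN lef_pV2//.
  by apply: ge0_ler_powR; rewrite ?nnegrE; lra.
have := @dyadic_bound R d _ x 1 K q mpx (fun y => phi01 _) K0 q0 w1 off n.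
rewrite mul1r -/w -/B => H; apply: le_trans (le_trans _ H) _.
  apply: ge0_subset_integral => //; [exact: measurable_cube|exact: measurable_cube| | |].
  - by apply/measurable_EFinP; exact: measurable_funTS.
  - by move=> y _; rewrite lee_fin; case/andP: (phi01 (enorm (y - x))).
  - move=> y /cubeP yr; move/cubeP: xr => xr; apply/cubeP => i.
    have := yr i; have := xr i; rewrite !mxE !subr0 => h1 h2.
    apply: le_trans n1; apply: le_trans (ler_normB _ _) _; lra.
have db : 0 <= d%:R - beta by rewrite subr_ge0 ltW.
rewrite lee_fin -mulrA; apply: ler_wpM2l; first exact: ltW.
have -> : (4 * M) `^ (d%:R - beta) * r `^ (d%:R - beta) = (2 * (2 * (M * r))) `^ (d%:R - beta).
  rewrite -powRM; [|lra|lra]; congr (_ `^ _); ring.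
rewrite wE -powR_mulrn ?powR_ge0// powRAC powR_mulrn//.
by apply: ge0_ler_powR => //; rewrite nnegrE; lra.
Qed.

(** Away from the diagonal Potter's lower bound applies. It decreases with the distance, so its
    value at the diameter of the large cube is a lower bound throughout. *)
Lemma covariance_lower (k : nat) (e M : R) : (0 < k)%N -> 0 < alpha -> 0 < e -> 0 < M ->
  exists c A : R, [/\ 0 < c, 0 <= A & forall r (x y : 'rV[R]_d), 0 < r ->
    cube 0 (M * r) x -> cube 0 (M * r) y -> ~ cube x A y ->
    c * r `^ (- (alpha * k%:R + e)) <= rho (enorm (y - x)) ^+ k].
Proof.
move=> k0 a0 e0 M0.
have kR : 0 < k%:R :> R by rewrite ltr0n.
have ek : 0 < e / k%:R by rewrite divr_gt0.
have [A [C [A1 C0 pot]]] := potter L_slow ek.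
(* Two points of the cube of radius M r are at distance at most tau r. *)
pose s := alpha + e / k%:R; pose tau := d%:R * (2 * M).
have s0 : 0 < s by rewrite addr_gt0.
have tau0 : 0 < tau by rewrite !mulr_gt0// ltr0n.
have C'0 : 0 < C^-1 by rewrite invr_gt0.
exists ((C^-1 * tau `^ (- s)) ^+ k), A; split; first by rewrite exprn_gt0// mulr_gt0// powR_gt0.
  lra.
move=> r x y r0 xr yr /enorm_notin_cube; set t := enorm _ => At.
have tr : t <= tau * r.
  have Mr : 0 <= M * r by rewrite mulr_ge0// ltW.
  by rewrite /tau -!mulrA; exact: enorm_cube.
have t0 : 0 < t by lra.
have /andP[L1 _] := pot _ At.
have -> : r `^ (- (alpha * k%:R + e)) = (r `^ (- s)) ^+ k.
  rewrite -(powR_mulrn k (powR_ge0 _ _)) -powRrM; congr (_ `^ _).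
  by rewrite /s; field; rewrite gt_eqF.
rewrite -exprMn; apply: lerXn2r.
- by rewrite nnegrE !mulr_ge0 ?powR_ge0// ltW.
- rewrite nnegrE rhoE// mulr_ge0 ?powR_ge0//; apply: le_trans L1.
  by rewrite mulr_ge0 ?powR_ge0// ltW.
rewrite rhoE//; apply: le_trans (ler_wpM2l (powR_ge0 _ _) L1).
rewrite mulrCA -powRD; last by apply/implyP => _; rewrite gt_eqF.
rewrite -opprD -/s -mulrA; apply: ler_wpM2l; first exact: ltW.
rewrite -powRM; [|exact: ltW|exact: ltW].
have p1 : 0 < t `^ s by exact: powR_gt0.
have p2 : 0 < (tau * r) `^ s by apply: powR_gt0; rewrite mulr_gt0.
rewrite !powRN lef_pV2//.
by apply: ge0_ler_powR; rewrite ?nnegrE ?mulr_ge0 ?(ltW s0) ?(ltW tau0)// ltW.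
Qed.

End covariance_decay.

(** * Second moments of the functionals *)

Section restricted_integral.
Context d (T : measurableType d) (R : realType) (mu : {measure set T -> \bar R}).
Variables (D : set T) (mD : measurable D) (muD : (mu D < +oo)%E).
Local Notation muR := (mfrestr mD muD).

Lemma mfrestr_le (f g : T -> R) : integr muR f -> integr muR g ->
  (forall x, D x -> f x <= g x) -> \int[muR]_x f x <= \int[muR]_x g x.
Proof.
move=> If Ig fg.
have mI : measurable_fun setT (\1_D : T -> R) by exact: measurable_indic.
have cut h : integr muR h -> integr muR (fun x => h x * \1_D x) /\
    \int[muR]_x h x = \int[muR]_x (h x * \1_D x).
  move=> Ih; have mh := integr_meas Ih.
  have mhD : measurable_fun setT (fun x => h x * \1_D x : R) by exact: measurable_funM.
  split.
    apply: (@le_integr _ _ _ muR _ (fun x => `|h x|)) => //.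
      exact: (integrable_abse Ih).
    move=> x; rewrite normrM ler_piMr// indicE.
    by case: (_ \in _); rewrite ?normr1 ?normr0.
  rewrite !Rintegral_mfrestr//; apply: eq_Rintegral => x xD.
  by rewrite indicE xD mulr1.
have [If' ->] := cut _ If; have [Ig' ->] := cut _ Ig.
apply: le_Rintegral => // x _; rewrite indicE.
by have [xD|] := boolP (x \in D); rewrite ?mulr0 ?mulr1//; apply: fg; rewrite inE in xD.
Qed.

Lemma Rint_mfrestr_cst (c : R) : \int[muR]_x c = c * fine (mu D).
Proof.
rewrite Rintegral_mfrestr// /Rintegral integral_cst// fineM//.
by rewrite ge0_fin_numE.
Qed.

End restricted_integral.

Section field_moments.
Context {R : realType} {dO : measure_display} {Om : measurableType dO}.
Variables (P : probability Om R) (d p : nat) (eta : 'rV[R]_d -> Om -> 'rV[R]_p).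
Variable rho : R -> R.
Local Notation gam := (gauss_rV R p).
Local Notation leb := (lebesgue_rV R d).
Hypothesis eta_measurable : measurable_field eta.
Hypothesis rho_bounded : forall x y : 'rV[R]_d, `|rho (enorm (y - x))| <= 1.
Hypothesis etaE : forall x y t u c,
  \int[P]_o cos (lform t (eta x o) + lform u (eta y o) + c) =
  expR (- ((\sum_i t ord0 i ^+ 2 + \sum_i u ord0 i ^+ 2 +
            2 * rho (enorm (y - x)) * lform t u) / 2)) * cos c.

Let meta x : measurable_fun setT (eta x).
Proof. exact: measurable_eta. Qed.

Definition lift_field (g : 'rV[R]_p -> R) (z : 'rV[R]_d * Om) : R := g (eta z.1 z.2).

Lemma law_eta x A : measurable A -> gam A = P (eta x @^-1` A).
Proof. exact: (law_pair1 (meta x) (etaE x x)). Qed.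

Lemma sqfield_lift g : sqi gam g -> sqfield P (lift_field g).
Proof.
move=> sg; split; first exact: (measurableT_comp sg.1 eta_measurable).
exists (\int[gam]_w (g w ^+ 2)) => x.
have [_ ig] := sqi_law (meta x) (law_eta x) sg; split => //.
by rewrite (Rint_law (meta x) (law_eta x) (integr_meas sg.2))// lexx.
Qed.

Lemma mean_lift (m : {finite_measure set 'rV[R]_d -> \bar R}) g : sqi gam g ->
  \int[gam]_w g w = 0 -> \int[P]_o Kint m (lift_field g) o = 0.
Proof.
move=> sg g0; rewrite (mean_Kint m (sqfield_lift sg)).
have -> : (fun x => \int[P]_o lift_field g (x, o)) = (fun=> 0).
  apply/funext => x; rewrite -[RHS]g0 (Rint_law (meta x) (law_eta x))//; first exact: sg.1.
  by apply: sqi_integr; exact: (sqi_law (meta x) (law_eta x) sg).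
by rewrite /Rintegral integral0.
Qed.

Variables (D : set 'rV[R]_d) (mD : measurable D) (muD : (leb D < +oo)%E).
Local Notation m := (mfrestr mD muD).

(** For each x in D the covariances integrate to at most T B in y; integrating over x brings in the
    volume of D. *)
Lemma Kint_lift_upper g (k : nat) (T B : R) (phi : R -> R) : sqi gam g ->
  (forall l, (l <= k)%N -> hermite_energy g l = 0) ->
  (forall N, \sum_(l < N) hermite_energy g l <= T) ->
  measurable_fun setT phi -> (forall t, 0 <= phi t <= 1) ->
  (forall x y : 'rV[R]_d, `|rho (enorm (y - x))| ^+ k.+1 <= phi (enorm (y - x))) ->
  (forall x, D x -> (\int[leb]_(y in D) (phi (enorm (y - x)))%:E <= B%:E)%E) ->
  \int[P]_o (Kint m (lift_field g) o ^+ 2) <= T * B * fine (leb D).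
Proof.
move=> sg g0 gT mphi phi01 rphi phiB.
have sF := sqfield_lift sg; have sK := sqi_Kint m sF.
have T0 : 0 <= T by have := gT 0%N; rewrite big_ord0.
under eq_Rintegral do rewrite expr2.
rewrite Rint_Kint// -Rint_mfrestr_cst.
apply: mfrestr_le => [||x Dx]; [exact: integr_Kint_cov|exact: integr_cst|].
have sx := sqfield_sqi x sF.
under eq_Rintegral do rewrite mulrC.
rewrite Rint_Kint//.
have mpx : measurable_fun setT (fun y : 'rV[R]_d => phi (enorm (y - x))).
  by apply: (measurableT_comp mphi); apply: (measurableT_comp (@measurable_enorm R d));
    exact: measurable_subr_rV.
have ipx : integr m (fun y : 'rV[R]_d => phi (enorm (y - x))).
  apply: (@integr_bounded _ _ _ m _ 1) => // y.
  by have /andP[h0 h1] := phi01 (enorm (y - x)); rewrite ger0_norm.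
apply: (@le_trans _ _ (\int[m]_y (T * phi (enorm (y - x))))).
  apply: mfrestr_le => [||y _]; [exact: integr_Kint_cov|exact: integrZ|].
  rewrite mulrC; apply: le_trans (ler_norm _) _.
  apply: le_trans (pair_le (meta x) (meta y) (rho_bounded x y) (etaE x y) sg g0 gT) _.
  by apply: ler_wpM2r.
rewrite RintZ//; apply: ler_wpM2l => //.
rewrite Rintegral_mfrestr// /Rintegral.
have pB := phiB _ Dx; rewrite -lee_fin fineK//.
rewrite ge0_fin_numE; first exact: le_lt_trans pB (ltry _).
by apply: integral_ge0 => y _; rewrite lee_fin; case/andP: (phi01 (enorm (y - x))).
Qed.

Lemma Kint_lift_lower g (k : nat) (a A : R) : (0 < k)%N -> sqi gam g -> 0 <= a -> 0 <= A ->
  (forall x y : 'rV[R]_d, D x -> D y -> ~ cube x A y -> a <= rho (enorm (y - x)) ^+ k) ->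
  hermite_energy g k * (a * fine (leb D) - (1 + a) * (2 * A) ^+ d) * fine (leb D) <=
  \int[P]_o (Kint m (lift_field (hermite_comp g k)) o ^+ 2).
Proof.
move=> k0 sg a0 A0 rhoa; set G := hermite_comp g k; set E := hermite_energy g k.
have E0 : 0 <= E by exact: hermite_energy_ge0.
have sF : sqfield P (lift_field G) by apply: sqfield_lift; exact: sqi_comp.
have sK := sqi_Kint m sF.
under eq_Rintegral do rewrite expr2.
rewrite Rint_Kint// -Rint_mfrestr_cst.
apply: mfrestr_le => [||x Dx]; [exact: integr_cst|exact: integr_Kint_cov|].
have sx := sqfield_sqi x sF.
under eq_Rintegral do rewrite mulrC.
rewrite Rint_Kint//.
have mI : measurable_fun setT (\1_(cube x A) : 'rV[R]_d -> R).
  by apply: measurable_indic; exact: measurable_cube.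
have iI : integr m (\1_(cube x A) : 'rV[R]_d -> R).
  apply: (@integr_bounded _ _ _ m _ 1) => // y.
  by rewrite indicE; case: (_ \in _); rewrite ?normr0 ?normr1.
have ic c : integr m (fun=> c) by exact: integr_cst.
(* The k-th power of rho is at least a off the cube around x and at least -1 on it; a - (1 + a)
   times the indicator of the cube is below both. *)
apply: (@le_trans _ _ (\int[m]_y (E * (a - (1 + a) * \1_(cube x A) y)))); last first.
  apply: mfrestr_le => [||y Dy].
  - by apply: integrZ; apply: integrB => //; exact: integrZ.
  - exact: integr_Kint_cov.
  rewrite (pair_comp_sq (meta x) (meta y) (rho_bounded x y) (etaE x y))// mulrC.
  apply: ler_wpM2r => //; rewrite indicE.
  have [xy|/negP xy] := boolP (y \in _); last first.
    by rewrite mulr0 subr0; apply: rhoa => // h; apply: xy; rewrite inE.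
  rewrite mulr1; apply: (@le_trans _ _ (-1)); first lra.
  have : `|rho (enorm (y - x)) ^+ k| <= 1 by rewrite normrX exprn_ile1.
  by rewrite ler_norml => /andP[].
rewrite RintZ; last by apply: integrB => //; exact: integrZ.
apply: ler_wpM2l => //; rewrite RintB//; last exact: integrZ.
rewrite RintZ// Rint_mfrestr_cst lerD2l lerN2; apply: ler_wpM2l; first lra.
rewrite Rintegral_mfrestr// /Rintegral integral_indic//; last exact: measurable_cube.
have cA := lebesgue_cube x A0.
rewrite -[leRHS]/(fine ((2 * A) ^+ d)%:E) -cA; apply: fine_le.
- rewrite ge0_fin_numE//; apply: le_lt_trans muD; apply: le_measure; rewrite ?inE//.
  by apply: measurableI => //; exact: measurable_cube.
- by rewrite cA.
- apply: le_measure; rewrite ?inE//; last exact: measurable_cube.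
  by apply: measurableI => //; exact: measurable_cube.
Qed.

End field_moments.

(** * Comparison of standardized variables *)

Section standardization.
Context {R : realType} {dO : measure_display} {Om : measurableType dO}.
Variable P : probability Om R.

Lemma variance_mean0 (X : Om -> R) : sqi P X -> \int[P]_o X o = 0 ->
  fine 'V_P[X]%E = \int[P]_o (X o ^+ 2).
Proof.
move=> sX X0; have iX := sqi_integr sX.
rewrite /variance covariance.unlock (expectationE iX) X0 /=.
have -> : ((X \- cst 0) * (X \- cst 0))%R = (fun o => X o ^+ 2).
  by apply/funext => o; rewrite /= /GRing.mul/= subr0 expr2.
by rewrite expectationE//; exact: sX.2.
Qed.

(** Changing K1 into K perturbs both the numerator and the standard deviation, and each effect is at
    most the L^2 norm of K2 relative to that of K1. *)
Lemma standardize_close (K K1 K2 : Om -> R) : sqi P K -> sqi P K1 -> sqi P K2 ->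
  {ae P, forall o, K o = K1 o + K2 o} ->
  \int[P]_o K o = 0 -> \int[P]_o K1 o = 0 -> 0 < \int[P]_o (K1 o ^+ 2) ->
  [/\ sqi P (standardize P K), sqi P (standardize P K1) &
    \int[P]_o ((standardize P K o - standardize P K1 o) ^+ 2) <=
    4 * (\int[P]_o (K2 o ^+ 2) / \int[P]_o (K1 o ^+ 2))].
Proof.
move=> sK s1 s2 KE K0 K10 v1; rewrite /standardize !variance_mean0//.
set V := \int[P]_o (K o ^+ 2); set V1 := \int[P]_o (K1 o ^+ 2) in v1 *.
set V2 := \int[P]_o (K2 o ^+ 2).
set a := Num.sqrt V; set b := Num.sqrt V1; set c := Num.sqrt V2.
have b0 : 0 < b by rewrite sqrtr_gt0.
have a0 : 0 <= a := sqrtr_ge0 _.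
have c0 : 0 <= c := sqrtr_ge0 _.
have aE : a ^+ 2 = V by rewrite sqr_sqrtr// Rint_sq_ge0.
have bE : b ^+ 2 = V1 by rewrite sqr_sqrtr// Rint_sq_ge0.
have cE : c ^+ 2 = V2 by rewrite sqr_sqrtr// Rint_sq_ge0.
have sZ (f : Om -> R) k : sqi P f -> sqi P (fun o => f o / k).
  by move=> sf; under eq_fun do rewrite mulrC; exact: sqiZ.
split; [exact: sZ|exact: sZ|].
pose C := \int[P]_o (K1 o * K2 o).
have VE : V = V1 + 2 * C + V2.
  rewrite /V1 /C /V2 -Rint_sqD//; apply: ae_eq_Rint.
  - exact: integr_meas sK.2.
  - exact: integr_meas (sqiD s1 s2).2.
  - by apply: filterS KE => o ->.
have Cbc : `|C| <= b * c.
  rewrite -(@ler_pXn2r _ 2)// ?nnegrE ?mulr_ge0 ?(ltW b0)//.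
  by rewrite real_normK ?num_real// exprMn bE cE; exact: cauchy_schwarz.
have /andP[C1 C2] : - (b * c) <= C <= b * c by rewrite -ler_norml.
(* The triangle inequality for the L^2 norms of K, K1 and K2. *)
have ab : (a - b) ^+ 2 <= c ^+ 2.
  have h1 : a <= b + c.
    rewrite -(@ler_pXn2r _ 2)// ?nnegrE ?addr_ge0// ?(ltW b0)//.
    rewrite aE VE -bE -cE; lra.
  have h2 : b - c <= a.
    have [//|bc] := leP (b - c) 0; first lra.
    rewrite -(@ler_pXn2r _ 2)// ?nnegrE ?(ltW bc)//.
    rewrite aE VE -bE -cE; lra.
  rewrite -(real_normK (num_real (a - b))) lerXn2r ?nnegrE// ler_norml; lra.
(* K / a - K1 / b = k K + (K - K1) / b. Both squares have mean at most V2 / V1, and squaring the sum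
   costs a factor 2. *)
pose k := a^-1 - b^-1.
have split1 : (fun o => (K o / a - K1 o / b) ^+ 2) =
    (fun o => (k * K o + b^-1 * (K o - K1 o)) ^+ 2).
  by apply/funext => o; congr (_ ^+ 2); rewrite /k; ring.
have sB := sqiB sK s1.
rewrite split1; apply: le_trans (Rint_sqD_le (sqiZ k sK) (sqiZ b^-1 sB)) _.
have sqZ f l : sqi P f -> \int[P]_o ((l * f o) ^+ 2) = l ^+ 2 * \int[P]_o (f o ^+ 2).
  by move=> sf; under eq_Rintegral do rewrite exprMn; rewrite RintZ//; exact: sf.2.
rewrite !sqZ// -/V.
have -> : \int[P]_o ((K o - K1 o) ^+ 2) = V2.
  apply: ae_eq_Rint; [exact: integr_meas sB.2|exact: integr_meas s2.2|].
  by apply: filterS KE => o ->; rewrite addrC addKr.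
have kV : k ^+ 2 * V <= V2 / V1.
  (* If a = 0 then V = 0, so the term k^2 V vanishes and no division by a is required. *)
  rewrite -aE -cE -bE /k; have [->|an0] := eqVneq a 0.
    by rewrite expr0n mulr0 mulr_ge0 ?invr_ge0 ?sqr_ge0.
  have -> : (a^-1 - b^-1) ^+ 2 * a ^+ 2 = (a - b) ^+ 2 / b ^+ 2.
    by field; rewrite an0 gt_eqF.
  by apply: ler_wpM2r => //; rewrite invr_ge0 sqr_ge0.
have -> : b^-1 ^+ 2 * V2 = V2 / V1 by rewrite exprVn bE mulrC.
lra.
Qed.

(** Chebyshev's inequality turns closeness in mean square into closeness in probability. *)
Lemma cvg_law_close (X Y : R -> Om -> R) (D : R -> R) :
  (\forall r \near +oo, [/\ sqi P (X r), sqi P (Y r) &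
    \int[P]_o ((X r o - Y r o) ^+ 2) <= D r]) ->
  D r @[r --> +oo] --> 0 -> forall mu, cvg_law P X mu -> cvg_law P Y mu.
Proof.
move=> XYD D0 mu; apply: slutsky.
  by apply: filterS XYD => r [[? _] [? _] _].
move=> e e0; have De : (e ^+ 2)^-1 * D r @[r --> +oo] --> 0.
  by rewrite -(mulr0 (e ^+ 2)^-1); apply: cvgMr.
apply: (@squeeze_cvgr _ _ _ _ (fun=> 0) (fun r => (e ^+ 2)^-1 * D r)) => //; last exact: cvg_cst.
near=> r; rewrite fine_ge0//=.
have [sX sY XY] : [/\ sqi P (X r), sqi P (Y r) &
    \int[P]_o ((X r o - Y r o) ^+ 2) <= D r] by near: r.
apply: le_trans (chebyshev_sq (sqiB sX sY) e0) _.
by apply: ler_wpM2l => //; rewrite invr_ge0 sqr_ge0.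
Unshelve. all: by end_near. Qed.

End standardization.

Section hermite_tail.
Context {R : realType} {p : nat}.
Local Notation gam := (gauss_rV R p).
Implicit Type g : 'rV[R]_p -> R.

(** Bessel's inequality makes the series finite, so that [fine] returns its sum and not a default
    value. *)
Lemma hermite_tail_ge g k N : sqi gam g ->
  \sum_(l < N) (if (l <= k)%N then 0 else hermite_energy g l) <= hermite_tail g k.
Proof.
move=> sg; rewrite /hermite_tail.
set S := (\sum_(k.+1 <= l <oo) _)%E.
have E0 l : (0 <= (hermite_energy g l)%:E)%E by rewrite lee_fin hermite_energy_ge0.
have part M : (\sum_(k.+1 <= l < M) (hermite_energy g l)%:E)%E =
    (\sum_(l < M) (if (l <= k)%N then 0 else hermite_energy g l))%:E.
  rewrite sumEFin; congr EFin; rewrite -(big_mkord xpredT (fun l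
     => if (l <= k)%N then 0 else hermite_energy g l)).
  have [kM|Mk] := leqP k.+1 M.
    rewrite (@big_cat_nat _ _ _ k.+1 0 M)//= [X in _ = X + _]big_nat [X in _ = X + _]big1 ?add0r.
      by rewrite !big_nat; apply: eq_bigr => l /andP[kl _]; rewrite leqNgt kl.
    by move=> l /andP[_ lk]; rewrite -ltnS lk.
  rewrite (big_geq (ltnW Mk)).
  apply/esym; rewrite big_nat big1// => l /andP[_ lM].
  by rewrite (leq_trans (ltnW lM)).
have Sle : (S <= (\int[gam]_x (g x ^+ 2))%:E)%E.
  apply: lime_le; first exact: is_cvg_nneseries.
  near=> M; rewrite part lee_fin; apply: le_trans (hermite_bessel M sg).
  by apply: ler_sum => l _; case: ifP => // _; exact: hermite_energy_ge0.
have Sfin : S \is a fin_num.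
  rewrite ge0_fin_numE; first exact: le_lt_trans Sle (ltry _).
  exact: nneseries_ge0.
rewrite -lee_fin fineK// -part; apply: nneseries_lim_ge => l _ _; exact: E0.
Unshelve. all: by end_near. Qed.

Lemma hermite_tail_ge0 g k : sqi gam g -> 0 <= hermite_tail g k.
Proof. by move=> sg; have := hermite_tail_ge k 0 sg; rewrite big_ord0. Qed.

Lemma hermite_energy_rank_gt0 g k : hermite_rank g k -> 0 < hermite_energy g k.
Proof.
move=> [_ _ [nu nuk c0]]; rewrite /hermite_energy (bigD1 nu)//=.
apply: ltr_pwDl; first by rewrite divr_gt0 ?exprn_even_gt0// mfact_gt0.
by apply: sumr_ge0 => nu' _; rewrite divr_ge0 ?sqr_ge0// ltW// mfact_gt0.
Qed.

(** The mean is the coefficient of degree 0, and the rank is positive. *)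
Lemma mean_hermite_rank g k : sqi gam g -> hermite_rank g k -> \int[gam]_x g x = 0.
Proof.
move=> sg [k0 c0 _]; pose nu : {ffun 'I_p -> 'I_1} := [ffun=> ord0].
have nu0 : nu \in multi_index 0.
  by rewrite inE big1// => j _; rewrite ffunE.
have := c0 _ k0 nu nu0; rewrite hermite_coefE// => h; rewrite -[RHS]h.
apply: eq_Rintegral => x _; rewrite /hprod big1 ?mulr1// => j _.
by rewrite /idx ffunE/= hornerC.
Qed.

Lemma mean_hermite_comp g k : sqi gam g -> (0 < k)%N ->
  \int[gam]_x hermite_comp g k x = 0.
Proof.
move=> sg k0; have := Rint_comp_hprod k (fun=> 0%N) sg.
rewrite /degree big1// eq_sym gtn_eqF// => h; rewrite -[RHS]h.
apply: eq_Rintegral => x _; rewrite /hprod big1 ?mul1r// => j _.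
by rewrite hornerC.
Qed.

End hermite_tail.

Section dilation.
Context {R : realType} {d : nat}.
Implicit Type A : set 'rV[R]_d.

Lemma dilate_sub_cube A (M r : R) : 0 <= r -> A `<=` cube 0 M ->
  dilate r A `<=` cube 0 (M * r).
Proof.
move=> r0 AM _ [x /AM /cubeP xM <-]; apply/cubeP => i; have := xM i.
by rewrite !mxE !subr0 normrM ger0_norm// mulrC => h; apply: ler_wpM2r.
Qed.

Lemma cube_sub_dilate A (e r : R) : 0 < r -> cube 0 e `<=` A ->
  cube 0 (e * r) `<=` dilate r A.
Proof.
move=> r0 eA y /cubeP ye; exists (r^-1 *: y); last by rewrite scalerA divff ?scale1r// gt_eqF.
apply: eA; apply/cubeP => i; have := ye i; rewrite !mxE !subr0 => h.
have rv : 0 <= r^-1 by rewrite invr_ge0 ltW.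
by rewrite normrM (ger0_norm rv) mulrC ler_pdivrMr.
Qed.

End dilation.

Section functionals.
Context {R : realType} {dO : measure_display} {Om : measurableType dO}.
Variables (d p : nat) (eta : 'rV[R]_d -> Om -> 'rV[R]_p).
Local Notation leb := (lebesgue_rV R d).
Hypothesis eta_measurable : measurable_field eta.
Variables (Delta D : set 'rV[R]_d) (r : R).
Hypotheses (mD : measurable D) (DDelta : D `<=` dilate r Delta) (muD : (leb D < +oo)%E).
Hypothesis kerD : forall A, measurable A -> A `<=` dilate r Delta -> leb (A `\` D) = 0%E.

(** Passing to the kernel D gives an integral against a finite measure, to which Fubini's theorem
    applies. *)
Lemma field_functionalE g : measurable_fun setT g ->
  field_functional eta Delta g r = Kint (mfrestr mD muD) (lift_field eta g).
Proof.
move=> mg; apply/funext => o.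
have mf : measurable_fun setT (fun x => g (eta x o)).
  apply: (measurableT_comp mg).
  exact: (measurableT_comp eta_measurable (measurable_pair2 o)).
rewrite /Kint Rintegral_mfrestr// /field_functional /Rintegral.
by congr fine; apply: (integral_kernel mD DDelta kerD); exact/measurable_EFinP.
Qed.

Lemma hermite_functionalE g k :
  hermite_functional eta Delta g k r = (fun o => \sum_(nu in @multi_index p k)
    hermite_coef g nu / mfact nu * Kint (mfrestr mD muD) (lift_field eta (hprod (idx nu))) o).
Proof.
apply/funext => o; apply: eq_bigr => nu _; congr (_ * _).
by rewrite -(field_functionalE (measurable_hprod (idx nu))).
Qed.

End functionals.

(** * The reduction to the Hermite component of lowest degree *)

Section reduction.
Context {R : realType} {dO : measure_display} {Om : measurableType dO}.
Variables (P : probability Om R) (d p k : nat) (alpha gamma : R) (rho L : R -> R).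
Variables (Delta : set 'rV[R]_d) (eta : 'rV[R]_d -> Om -> 'rV[R]_p).
Local Notation gam := (gauss_rV R p).
Local Notation leb := (lebesgue_rV R d).
Hypotheses (d_gt0 : (0 < d)%N) (k_gt0 : (0 < k)%N) (alpha_gt0 : 0 < alpha).
Hypotheses (gamma_gt0 : 0 < gamma) (gamma_alpha : gamma < alpha).
Hypothesis gamma_d : gamma < d%:R - alpha * k%:R.
Hypotheses (Delta_bounded : bounded_set Delta) (Delta_origin : interior Delta 0).
Hypothesis eta_measurable : measurable_field eta.
Hypothesis rhoE : forall t, 0 < t -> rho t = t `^ (- alpha) * L t.
Hypothesis rho_bounded : forall x y : 'rV[R]_d, `|rho (enorm (y - x))| <= 1.
Hypothesis L_slow : slowly_varying L.
Hypothesis etaE : forall x y t u c,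
  \int[P]_o cos (lform t (eta x o) + lform u (eta y o) + c) =
  expR (- ((\sum_i t ord0 i ^+ 2 + \sum_i u ord0 i ^+ 2 +
            2 * rho (enorm (y - x)) * lform t u) / 2)) * cos c.

(** C and r0 are chosen before r and g, which lets the function vary with r in the application. *)
Lemma functionals_close : exists C r0 : R, 1 <= r0 /\ forall r g, r0 <= r ->
  sqi gam g -> hermite_rank g k ->
  let X := standardize P (field_functional eta Delta g r) in
  let Y := standardize P (hermite_functional eta Delta g k r) in
  [/\ sqi P X, sqi P Y & \int[P]_o ((X o - Y o) ^+ 2) <=
    C * ((hermite_energy g k)^-1 * hermite_tail g k / r `^ (gamma / 2))].
Proof.
have [M0 [M00 DM0]] := bounded_cube Delta_bounded.
pose M := Num.max M0 1.
have M1 : 1 <= M by rewrite /M le_max lexx orbT.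
have MM : M0 <= M by rewrite /M le_max lexx.
have DM : Delta `<=` cube 0 M.
  move=> x /DM0 /cubeP xM; apply/cubeP => i; apply: le_trans (xM i) _.
  by rewrite /M le_max lexx.
have [e [e0 eD]] := interior_cube Delta_origin.
have kR : 0 < k%:R :> R by rewrite ltr0n.
have ak : 0 < alpha * k%:R by rewrite mulr_gt0.
(* gamma < alpha gives beta < alpha (k + 1), and gamma < d - alpha k gives beta < d, as
   [covariance_upper] requires. *)
pose beta := alpha * k%:R + gamma.
have beta0 : 0 < beta < d%:R.
  by rewrite /beta addr_gt0//= -ltrBrDl.
have betak : beta < alpha * k.+1%:R by rewrite /beta -natr1 mulrDr mulr1 ltrD2l.
have rho_bd (z : 'rV[R]_d) : `|rho (enorm z)| <= 1.
  by have := rho_bounded 0 z; rewrite subr0.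
have [phi [C1 [mphi phi01 rphi C10 phiC]]] :=
  covariance_upper rhoE rho_bd L_slow (ltn0Sn k) beta0 betak M1.
have g2 : 0 < gamma / 2 by rewrite divr_gt0.
have [c [A [c0 A0 rhoc]]] :=
  covariance_lower d_gt0 rhoE L_slow k_gt0 alpha_gt0 g2 (lt_le_trans ltr01 M1).
(* The covariance bound a = c r^(s - d) times a volume of order r^d grows like r^s. *)
pose s := d%:R - (alpha * k%:R + gamma / 2).
have s0 : 0 < s by rewrite /s; move: gamma_d gamma_gt0; lra.
pose b := (2 * e) ^+ d.
have b0 : 0 < b by rewrite exprn_gt0// mulr_gt0.
(* r^s >= Q ensures that the loss (1 + a) (2 A)^d near the diagonal is at most half of a V. *)
pose Q := Num.max 1 (2 * ((1 + c) * (2 * A) ^+ d) / (c * b)).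
have Q1 : 1 <= Q by rewrite /Q le_max lexx.
pose r0 := Q `^ s^-1.
have r01 : 1 <= r0.
  have := ler_powR Q1 (_ : 0 <= s^-1); rewrite powRr0; apply.
  by rewrite invr_ge0 ltW.
exists (4 * (2 * C1 / (c * b))), r0; split=> // r g rr0 sg rank X Y.
have r1 : 1 <= r by exact: le_trans r01 rr0.
have r_gt0 : 0 < r by exact: lt_le_trans r1.
have DrM := dilate_sub_cube (ltW r_gt0) DM.
have eDr := cube_sub_dilate r_gt0 eD.
have Mr : 0 <= M * r by rewrite mulr_ge0 ?(ltW r_gt0)//; exact: le_trans ler01 M1.
have er : 0 <= e * r by rewrite mulr_ge0// ltW.
have [D [mD DDr kerD]] := measurable_kernel (measurable_cube 0 (M * r)) DrM (cube_gt0 0 Mr).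
have DM' : D `<=` cube 0 (M * r) by move=> x /DDr /DrM.
have muD : (leb D < +oo)%E.
  apply: le_lt_trans (cube_gt0 0 Mr); apply: le_measure; rewrite ?inE//; exact: measurable_cube.
pose m := mfrestr mD muD; pose V := fine (leb D).
(* The cube of radius e r is a measurable subset of the dilated set, so it lies in the kernel D up
   to a null set. *)
have Vb : b * r ^+ d <= V.
  have mc := measurable_cube (0 : 'rV[R]_d) (e * r).
  have mcD : measurable (cube 0 (e * r) `\` D) by exact: measurableD.
  have : (leb (cube 0 (e * r)) <= leb D)%E.
    rewrite -[leRHS]adde0 -(kerD _ mc eDr).
    apply: le_trans (measureU2 leb mD mcD); apply: le_measure; rewrite ?inE//.
      exact: measurableU.
    by move=> x cx; have [Dx|Dx] := pselect (D x); [left|right].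
  rewrite lebesgue_cube// -(@fineK _ (leb D)) ?ge0_fin_numE// lee_fin.
  by apply: le_trans; rewrite mulrA exprMn.
have V0 : 0 < V by apply: lt_le_trans Vb; rewrite mulr_gt0// exprn_gt0.
set E := hermite_energy g k; set T := hermite_tail g k.
have E0 : 0 < E by exact: hermite_energy_rank_gt0.
have T0 : 0 <= T by exact: hermite_tail_ge0.
pose gR x := g x - hermite_comp g k x.
have sc : sqi gam (hermite_comp g k) by exact: sqi_comp.
have sR : sqi gam gR by exact: sqiB.
pose K := Kint m (lift_field eta g); pose K1 := Kint m (lift_field eta (hermite_comp g k)).
pose K2 := Kint m (lift_field eta gR).
have sqf h : sqi gam h -> sqfield P (lift_field eta h).
  exact: (sqfield_lift eta_measurable etaE).
have sK h : sqi gam h -> sqi P (Kint m (lift_field eta h)).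
  by move=> sh; apply: sqi_Kint; exact: sqf.
pose H := hermite_functional eta Delta g k r.
have HE : H = (fun o => \sum_(nu in @multi_index p k)
    hermite_coef g nu / mfact nu * Kint m (lift_field eta (hprod (idx nu))) o).
  exact: (hermite_functionalE eta_measurable mD DDr muD kerD).
have KfE : field_functional eta Delta g r = K.
  exact: (field_functionalE eta_measurable mD DDr muD kerD sg.1).
have sH : sqi P H.
  by rewrite HE; apply: sqi_sum => nu _; apply: sqiZ; apply: sK; exact: sqi_hprod.
(* [hermite_functional] integrates the Hermite products one by one, whereas K1 integrates their
   combination; these agree only for almost every outcome. *)
have K1H : {ae P, forall o, K1 o = H o}.
  rewrite HE.
  have := @ae_Kint_sum _ _ _ _ _ m P _ (index_enum _) (fun nu => nu \in @multi_index p k)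
    (fun nu => lift_field eta (hprod (idx nu))) (fun nu => hermite_coef g nu / mfact nu)
    (fun nu => sqf _ (sqi_hprod _)).
  by apply: filterS => o; exact.
have KH : {ae P, forall o, K o = H o + K2 o}.
  have := ae_KintD m (sqf _ sc) (sqf _ sR).
  have -> : (fun z => lift_field eta (hermite_comp g k) z + lift_field eta gR z) =
      lift_field eta g.
    by apply/funext => z; rewrite /lift_field /gR addrC subrK.
  by move=> KD; apply: filterS2 KD K1H => o KDo K1o; rewrite /K KDo -K1o.
have mean h : sqi gam h -> \int[gam]_x h x = 0 -> \int[P]_o Kint m (lift_field eta h) o = 0.
  exact: (mean_lift eta_measurable etaE).
have K0 : \int[P]_o K o = 0 by apply: mean => //; exact: mean_hermite_rank rank.
have mH := sH.1; have mK1 := (sK _ sc).1.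
have H0 : \int[P]_o H o = 0.
  rewrite -(mean _ sc (mean_hermite_comp sg k_gt0)); apply: ae_eq_Rint => //.
  by apply: filterS K1H => o /esym.
have H2 : \int[P]_o (H o ^+ 2) = \int[P]_o (K1 o ^+ 2).
  apply: ae_eq_Rint; [exact: measurable_funX|exact: measurable_funX|].
  by apply: filterS K1H => o ->.
pose W1 := \int[P]_o (K1 o ^+ 2); pose W2 := \int[P]_o (K2 o ^+ 2).
have [_ rk _] := rank.
have up : W2 <= T * (C1 * r `^ (d%:R - beta)) * V.
  apply: (Kint_lift_upper eta_measurable rho_bounded etaE mD muD sR (k := k) (phi := phi)) => //.
  - by move=> l lk; rewrite (hermite_energy_remainder _ sg rk) lk.
  - move=> N; apply: le_trans (hermite_tail_ge k N sg).
    by apply: ler_sum => l _; rewrite (hermite_energy_remainder _ sg rk).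
  - move=> x Dx; apply: le_trans (phiC r x r1 (DM' _ Dx)).
    apply: ge0_subset_integral => //; first exact: measurable_cube.
      apply/measurable_EFinP; apply: measurable_funTS; apply: (measurableT_comp mphi).
      apply: (measurableT_comp (@measurable_enorm R d)); exact: measurable_subr_rV.
    by move=> y _; rewrite lee_fin; case/andP: (phi01 (enorm (y - x))).
pose u := r `^ (- (alpha * k%:R + gamma / 2)); pose a := c * u.
have u0 : 0 < u by exact: powR_gt0.
have a0 : 0 < a by rewrite mulr_gt0.
have low : E * (a * V - (1 + a) * (2 * A) ^+ d) * V <= W1.
  apply: (Kint_lift_lower eta_measurable rho_bounded etaE mD muD) => //; first exact: ltW.
  by move=> x y /DM' Dx /DM' Dy; exact: rhoc.
have uE : u * r ^+ d = r `^ s.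
  rewrite -powR_mulrn ?(ltW r_gt0)// -powRD; last by apply/implyP => _; rewrite gt_eqF.
  by congr (_ `^ _); rewrite /s addrC.
have Qs : Q <= r `^ s.
  have -> : Q = r0 `^ s.
    by rewrite /r0 -powRrM mulVf ?gt_eqF// powRr1//; exact: le_trans ler01 Q1.
  by apply: ge0_ler_powR; rewrite ?nnegrE// ?(ltW s0) ?(ltW r_gt0)//; exact: le_trans ler01 r01.
have aV : c * b * r `^ s <= a * V.
  have -> : c * b * r `^ s = a * (b * r ^+ d) by rewrite -uE /a; ring.
  by apply: ler_wpM2l => //; exact: ltW.
have ac : a <= c.
  rewrite /a ler_piMr ?(ltW c0)// /u powRN invf_le1 ?powR_gt0//.
  have := ler_powR r1 (_ : 0 <= alpha * k%:R + gamma / 2); rewrite powRr0; apply.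
  by rewrite addr_ge0// ltW.
have half : (1 + a) * (2 * A) ^+ d <= a * V / 2.
  have cb : 0 < c * b by rewrite mulr_gt0.
  have A2 : 0 <= (2 * A) ^+ d by rewrite exprn_ge0// mulr_ge0.
  have h1 : 2 * ((1 + c) * (2 * A) ^+ d) <= c * b * r `^ s.
    rewrite -ler_pdivrMl// mulrC; apply: le_trans Qs.
    by rewrite /Q le_max lexx orbT.
  have h2 : (1 + a) * (2 * A) ^+ d <= (1 + c) * (2 * A) ^+ d.
    by apply: ler_wpM2r => //; rewrite lerD2l.
  apply: le_trans h2 _; rewrite ler_pdivlMr// mulrC.
  exact: le_trans h1 aV.
have W1low : E * (a * V / 2) * V <= W1.
  apply: le_trans low; apply: ler_wpM2r; first exact: ltW.
  apply: ler_wpM2l; first exact: ltW.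
  by rewrite lerBrDr [leRHS]splitr lerD2l.
have W10 : 0 < W1 by apply: lt_le_trans W1low; rewrite !mulr_gt0// invr_gt0.
have H20 : 0 < \int[P]_o (H o ^+ 2) by rewrite H2.
have [sX sY XY] := standardize_close (sK _ sg) sH (sK _ sR) KH K0 H0 H20.
rewrite /X /Y KfE; split => //; apply: le_trans XY _; rewrite H2 -/W1 -/W2 -mulrA.
apply: ler_wpM2l => //; rewrite ler_pdivrMr//; apply: le_trans up _.
set z := r `^ (gamma / 2); have z0 : 0 < z by exact: powR_gt0.
(* The upper exponent d - beta is short of the lower exponent s by gamma / 2, which is the power of
   r that divides the energy ratio. *)
have rE : r `^ (d%:R - beta) * z = u * r ^+ d.
  rewrite uE /z -powRD; last by apply/implyP => _; rewrite gt_eqF.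
  by congr (_ `^ _); rewrite /s /beta; field.
apply: (@le_trans _ _ (2 * C1 / (c * b) * (E^-1 * T / z) * (E * (a * V / 2) * V))); last first.
  apply: ler_wpM2l => //; apply: mulr_ge0.
    by apply: ltW; rewrite divr_gt0 ?mulr_gt0.
  by rewrite divr_ge0 ?(ltW z0)// mulr_ge0// invr_ge0 ltW.
have -> : 2 * C1 / (c * b) * (E^-1 * T / z) * (E * (a * V / 2) * V) =
    T * (C1 * (a * V / (c * b * z))) * V.
  by field; rewrite !gt_eqF.
apply: ler_wpM2r; first exact: ltW.
apply: ler_wpM2l => //; apply: ler_wpM2l; first exact: ltW.
rewrite ler_pdivlMr; last by rewrite !mulr_gt0.
by rewrite mulrCA rE uE.
Qed.

End reduction.

Theorem theorem4 (R : realType) (dO : measure_display)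
    (Omega : measurableType dO) (P : probability Omega R)
    (d p kappa : nat) (alpha gamma : R) (L : R -> R)
    (Delta : set 'rV[R]_d) (eta : 'rV[R]_d -> Omega -> 'rV[R]_p)
    (G : R -> 'rV[R]_p -> R)
    (d_ge1 : (1 <= d)%N) (p_ge1 : (1 <= p)%N) (kappa_ge1 : (1 <= kappa)%N)
    (alpha_range : 0 < alpha < d%:R / kappa%:R)
    (Delta_jordan : jordan_measurable Delta)
    (Delta_convex : convex_set Delta)
    (Delta_bounded : bounded_set Delta)
    (Delta_pos : (0 < outer_jordan_content Delta)%E)
    (Delta_origin : interior Delta 0)
    (eta_measurable : measurable_field eta)
    (eta_continuous : mean_square_continuous P eta)
    (eta_gaussian : gaussian_field P eta)
    (eta_hom_iso : homogeneous_isotropic P eta)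
    (eta_mean : forall x i, ('E_P[(fun o => eta x o ord0 i)%R] = 0)%E)
    (eta_cov0 : cross_moment P (eta 0) (eta 0) = map_mx EFin 1%:M)
    (eta_cov : forall x : 'rV[R]_d, x != 0 ->
       cross_moment P (eta 0) (eta x) =
       map_mx EFin (enorm x `^ (- alpha) * L (enorm x))%:M)
    (L_slow : slowly_varying L)
    (G_L2 : forall r : R, 0 < r -> gauss_L2 (G r))
    (G_rank : \forall r \near +oo, hermite_rank (G r) kappa)
    (gamma_range : 0 < gamma < Num.min alpha (d%:R - alpha * kappa%:R))
    (G_tail :
       (hermite_energy (G r) kappa)^-1 * hermite_tail (G r) kappa
         / r `^ (gamma / 2) @[r --> +oo] --> 0) :
  let K r := field_functional eta Delta (G r) r in
  let Kkappa r := hermite_functional eta Delta (G r) kappa r in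
  let X r := standardize P (K r) in
  let Y r := standardize P (Kkappa r) in
  (exists mu, cvg_law P X mu) \/ (exists mu, cvg_law P Y mu) ->
  [/\ exists mu, cvg_law P X mu,
      exists nu, cvg_law P Y nu &
      forall mu nu, cvg_law P X mu -> cvg_law P Y nu ->
        forall A, measurable A -> mu A = nu A].
Proof.
move=> K Kkappa X Y.
(* The power law does not describe distance 0, where the variance 1 must be inserted so that one
   formula covers all pairs of points. *)
pose rho t : R := if t == 0 then 1 else t `^ (- alpha) * L t.
have rho0 : rho 0 = 1 by rewrite /rho eqxx.
have rhoE t : 0 < t -> rho t = t `^ (- alpha) * L t.
  by move=> t0; rewrite /rho gt_eqF.
have cross : forall x y,
    cross_moment P (eta x) (eta y) = map_mx EFin (rho (enorm (y - x)))%:M.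
  apply: stationary_covariance => // x x0; rewrite eta_cov// rhoE//.
  exact: enorm_gt0.
have etaE := eta_characteristic eta_measurable eta_gaussian eta_mean cross rho0.
have rho1 := rho_le1 eta_measurable cross rho0 p_ge1.
have kR : 0 < kappa%:R :> R by rewrite ltr0n.
have /andP[alpha0 _] := alpha_range.
have /andP[gamma0] := gamma_range; rewrite lt_min => /andP[gamma_alpha gamma_d].
have [C [r0 [r01 close]]] := functionals_close d_ge1 kappa_ge1 alpha0 gamma0
  gamma_alpha gamma_d Delta_bounded Delta_origin eta_measurable rhoE rho1 L_slow etaE.
pose D r : R := C * ((hermite_energy (G r) kappa)^-1 * hermite_tail (G r) kappa
  / r `^ (gamma / 2)).
have D0 : D r @[r --> +oo] --> 0 by rewrite -(mulr0 C); apply: cvgMr.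
have XY : \forall r \near +oo, [/\ sqi P (X r), sqi P (Y r) &
    \int[P]_o ((X r o - Y r o) ^+ 2) <= D r].
  near=> r; have rr0 : r0 <= r by near: r; apply: nbhs_pinfty_ge; exact: num_real.
  have r_gt0 : 0 < r by lra.
  apply: close => //; first exact: gauss_L2_sqi (G_L2 _ r_gt0).
  by near: r.
have YX : \forall r \near +oo, [/\ sqi P (Y r), sqi P (X r) &
    \int[P]_o ((Y r o - X r o) ^+ 2) <= D r].
  apply: filterS XY => r [sX sY XYr]; split => //.
  by under eq_Rintegral do rewrite -sqrrN opprB.
have toY := cvg_law_close XY D0; have toX := cvg_law_close YX D0.
(* Either alternative yields a limit law of X; every limit law of X is one of Y, and limit laws are
   unique. *)
move=> XorY; have [mu0 Xmu0] : exists mu, cvg_law P X mu.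
  by case: XorY => // -[mu Ymu]; exists mu; exact: toX.
split; [by exists mu0|by exists mu0; exact: toY|].
by move=> mu nu Xmu Ynu; exact: cvg_law_unique (toY _ Xmu) Ynu.
Unshelve. all: by end_near. Qed.
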